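(* Let $\boldsymbol{a}_0\in\mathbb{R}^{2R}$ be the true value of the parameter $\boldsymbol{a}$ of the interval-monitored simple step-stress model with $R$ independent exponential competing risks described in the context, and let $\widehat{\boldsymbol{a}}^{\beta}$ be the minimum density power divergence estimator (MDPDE) of $\boldsymbol{a}$ with tuning parameter $\beta\ge 0$, computed from $N$ test units. Then, as $N\to\infty$, $$\sqrt{N}\left(\widehat{\boldsymbol{a}}^{\beta}-\boldsymbol{a}_0\right)\xrightarrow{\ L\ }\mathcal{N}\left(\boldsymbol{0},\ \boldsymbol{J}_\beta^{-1}(\boldsymbol{a}_0)\,\boldsymbol{K}_\beta(\boldsymbol{a}_0)\,\boldsymbol{J}_\beta^{-1}(\boldsymbol{a}_0)\right)$$ (convergence in distribution), where $$\boldsymbol{J}_\beta(\boldsymbol{a}_0)=\boldsymbol{W}^T\boldsymbol{D}_{\boldsymbol{p}(\boldsymbol{a}_0)}^{\beta-1}\boldsymbol{W},\qquad \boldsymbol{K}_\beta(\boldsymbol{a}_0)=\boldsymbol{W}^T\left(\boldsymbol{D}_{\boldsymbol{p}(\boldsymbol{a}_0)}^{2\beta-1}-\boldsymbol{p}(\boldsymbol{a}_0)^{\beta}\left(\boldsymbol{p}(\boldsymbol{a}_0)^{\beta}\right)^{T}\right)\boldsymbol{W}.$$ Here $\boldsymbol{p}(\boldsymbol{a}_0)\in\mathbb{R}^{LR+1}$ is the cell probability vector of the model, $\boldsymbol{D}_{\boldsymbol{p}(\boldsymbol{a}_0)}$ is the diagonal matrix whose diagonal entries are the components of $\boldsymbol{p}(\boldsymbol{a}_0)$,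 $\boldsymbol{p}(\boldsymbol{a}_0)^{\beta}$ is the vector of componentwise $\beta$-th powers, and $\boldsymbol{W}$ is the $(LR+1)\times 2R$ matrix $\boldsymbol{W}(\boldsymbol{a})$ defined in the context, evaluated at $\boldsymbol{a}=\boldsymbol{a}_0$.
   Context: **Experiment.** $N$ independent units are placed on a step-stress test with two stress levels $x_1<x_2$. The stress is $x_1$ on $(0,\tau_1]$ and $x_2$ on $(\tau_1,\tau_2]$, with $\tau_0=0<\tau_1<\tau_2$; the test ends at $\tau_2$. Inspection times $0=IT_0<IT_1<\cdots<IT_L=\tau_2$ are fixed in advance and $\tau_1\in\{IT_1,\dots,IT_{L-1}\}$. There are $R$ independent competing risks; only the smallest failure time $T=\min_j T_j$ and its cause are relevant, and only the number of failures due to each cause in each interval $(IT_{l-1},IT_l]$ is recorded. **Model (cumulative exposure, exponential lifetimes).** The parameter is $\boldsymbol{a}=(a_{01},a_{11},\dots,a_{0R},a_{1R})\in\mathbb{R}^{2R}$. For cause $j$ at stress $x_i$ ($i=1,2$) the exponential scale parameter is $\theta_{ij}=\exp(a_{0j}+a_{1j}x_i)$. Put $$h_j^{(1)}=0,\qquad h_j^{(2)}=\tau_1\left(\frac{\exp(a_{0j}+a_{1j}x_2)}{\exp(a_{0j}+a_{1j}x_1)}-1\right).$$ The lifetime $T_j$ attributed to cause $j$ has distribution function $F_j(t)=1-\exp\left(-(t+h_j^{(i)})/\theta_{ij}\right)$ for $\tau_{i-1}\le t<\tau_i$ (for $i=2$ this is extended to all $t\ge\tau_1$), and $T_1,\dots,T_R$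 are independent. Let $$\pi_{ij}=\frac{\theta_{ij}^{-1}}{\sum_{m=1}^R\theta_{im}^{-1}},\qquad S^{(i)}(t)=\exp\left(-\sum_{m=1}^R\frac{t+h_m^{(i)}}{\theta_{im}}\right).$$ For each $l=1,\dots,L$ let $i=i(l)\in\{1,2\}$ be the index of the stress level in force on $(IT_{l-1},IT_l]$, i.e. $\tau_{i-1}<IT_l\le\tau_i$. The probability of failure in the $l$-th interval due to cause $j$, and the probability of surviving the test, are $$p_{lj}(\boldsymbol{a})=\pi_{ij}\left(S^{(i)}(IT_{l-1})-S^{(i)}(IT_l)\right),\qquad p_0(\boldsymbol{a})=S^{(2)}(\tau_2).$$ The probability vector is $\boldsymbol{p}(\boldsymbol{a})=(p_{11},\dots,p_{1R},p_{21},\dots,p_{2R},\dots,p_{L1},\dots,p_{LR},p_0)^T$. Its components sum to $1$, and the counts $(n_{11},\dots,n_{1R},\dots,n_{L1},\dots,n_{LR},n_0)$ (with $n_0$ the number of survivors) are multinomial with $N$ trials and probability vector $\boldsymbol{p}(\boldsymbol{a}_0)$. **Estimator.** Let $\widehat{p}_{lj}=n_{lj}/N$, $\widehat{p}_0=n_0/N$, and let $\widehat{\boldsymbol{p}}$ be the corresponding vector. For $\beta>0$ the density power divergence between $\widehat{\boldsymbol{p}}$ and $\boldsymbol{p}(\boldsymbol{a})$ is $$d_\beta(\widehat{\boldsymbol{p}},\boldsymbol{p}(\boldsymbol{a}))=\sum_{l=1}^L\sum_{j=1}^R\left(p_{lj}(\boldsymbol{a})^{1+\beta}-\left(1+\tfrac1\beta\right)\widehat{p}_{lj}\,p_{lj}(\boldsymbol{a})^{\beta}+\tfrac1\beta\widehat{p}_{lj}^{\,1+\beta}\right)+p_0(\boldsymbol{a})^{1+\beta}-\left(1+\tfrac1\beta\right)\widehat{p}_0\,p_0(\boldsymbol{a})^{\beta}+\tfrac1\beta\widehat{p}_0^{\,1+\beta},$$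 and for $\beta=0$ it is its limit, the Kullback–Leibler divergence $\sum_{l,j}\widehat{p}_{lj}\log(\widehat{p}_{lj}/p_{lj}(\boldsymbol{a}))+\widehat{p}_0\log(\widehat{p}_0/p_0(\boldsymbol{a}))$. The MDPDE is $\widehat{\boldsymbol{a}}^{\beta}=\arg\min_{\boldsymbol{a}}d_\beta(\widehat{\boldsymbol{p}},\boldsymbol{p}(\boldsymbol{a}))$; for $\beta=0$ it is the maximum likelihood estimator. It is assumed throughout that at least one failure is observed for each combination of stress level and cause of failure (an event whose probability tends to $1$ as $N\to\infty$). **The matrix $\boldsymbol{W}(\boldsymbol{a})$.** It is the $(LR+1)\times 2R$ matrix with rows ordered as the components of $\boldsymbol{p}(\boldsymbol{a})$ and columns as the components of $\boldsymbol{a}$, consisting of $R$ column blocks of width 2, the $k$-th block corresponding to $(a_{0k},a_{1k})$; it is the Jacobian matrix of $\boldsymbol{a}\mapsto\boldsymbol{p}(\boldsymbol{a})$. Explicitly, let $$h_k^{\ast(1)}=0,\qquad h_k^{\ast(2)}=\tau_1\frac{\exp(a_{0k}+a_{1k}x_2)}{\exp(a_{0k}+a_{1k}x_1)}(x_2-x_1),$$ let $\delta_{jk}$ be the Kronecker delta, and for $i\in\{1,2\}$ and $t\ge 0$ set $$z^{(i)}_{j,1k}(t)=\pi_{ij}S^{(i)}(t)\left(\pi_{ik}-\delta_{jk}+\frac{t+h_k^{(i)}}{\theta_{ik}}\right),$$ $$z^{(i)}_{j,2k}(t)=\pi_{ij}S^{(i)}(t)\left((\pi_{ik}-\delta_{jk})x_i+\frac{-h_k^{\ast(i)}+(t+h_k^{(i)})x_i}{\theta_{ik}}\right).$$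 In block $k$, the row for $p_{lj}$ is $\left(z^{(i)}_{j,1k}(IT_{l-1})-z^{(i)}_{j,1k}(IT_l),\ z^{(i)}_{j,2k}(IT_{l-1})-z^{(i)}_{j,2k}(IT_l)\right)$ with $i=i(l)$, and the row for $p_0$ is $$\left(S^{(2)}(\tau_2)\frac{\tau_2+h_k^{(2)}}{\theta_{2k}},\ \ S^{(2)}(\tau_2)\frac{-h_k^{\ast(2)}+(\tau_2+h_k^{(2)})x_2}{\theta_{2k}}\right).$$ *)

(* Defs.v *)
From HB Require Import structures.
From mathcomp Require Import all_boot all_order all_algebra.
From mathcomp Require Import all_classical all_reals all_analysis.
Set Implicit Arguments.
Unset Strict Implicit.
Unset Printing Implicit Defensive.
Import Order.TTheory GRing.Theory Num.Theory.
Import numFieldNormedType.Exports.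
Local Open Scope classical_set_scope.
Local Open Scope ring_scope.

(* In 'I_2, the element 0 stands for the first stress level x_1 (and for the
   intercept a_{0j}), the element 1 for the second one x_2 (and for the slope
   a_{1j}).  The values of IT beyond L are irrelevant. *)
Record stepStressTest (R : realType) (L : nat) := StepStressTest {
  stress : 'I_2 -> R;
  tau1 : R;
  tau2 : R;
  IT : nat -> R;
  stress_lt : stress 0 < stress 1;
  tau1_gt0 : 0 < tau1;
  tau1_lt_tau2 : tau1 < tau2;
  IT_0 : IT 0 = 0;
  IT_L : IT L = tau2;
  IT_incr : forall l, (l < L)%N -> IT l < IT l.+1;
  IT_tau1 : exists m, [/\ (0 < m)%N, (m < L)%N & IT m = tau1]
}.

Section Model.
Variables (R : realType) (L r : nat) (D : stepStressTest R L).

(* mxvec is row-major: a parameter is (a_{01}, a_{11}, ..., a_{0r}, a_{1r}), a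
   cell vector is (v_{11}, ..., v_{1r}, ..., v_{L1}, ..., v_{Lr}, v_0)^T. *)
Definition par_vec (f : 'I_r -> 'I_2 -> R) : 'rV[R]_(r * 2) :=
  mxvec (\matrix_(k, b) f k b).

Definition cell_vec (f : 'I_L -> 'I_r -> R) (f0 : R) : 'cV[R]_(L * r + 1) :=
  col_mx (mxvec (\matrix_(l, j) f l j))^T (f0%:M).

Definition cell_idx (l : 'I_L) (j : 'I_r) : 'I_(L * r + 1) :=
  lshift 1 (mxvec_index l j).

(* The interval with (0-based) index l is (IT l, IT l.+1]. *)
Definition stress_idx (l : 'I_L) : 'I_2 := if IT D l.+1 <= tau1 D then 0 else 1.

Variable a : 'rV[R]_(r * 2).

Definition theta (i : 'I_2) (j : 'I_r) : R :=
  expR (vec_mx a j 0 + vec_mx a j 1 * stress D i).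

Definition exposure_shift (i : 'I_2) (j : 'I_r) : R :=
  if i == 0 then 0 else tau1 D * (theta 1 j / theta 0 j - 1).

(* The derivative of exposure_shift i j with respect to the slope a_{1j}. *)
Definition exposure_shift_star (i : 'I_2) (j : 'I_r) : R :=
  if i == 0 then 0
  else tau1 D * (theta 1 j / theta 0 j) * (stress D 1 - stress D 0).

Definition cause_prob (i : 'I_2) (j : 'I_r) : R :=
  (theta i j)^-1 / \sum_(m < r) (theta i m)^-1.

Definition surv (i : 'I_2) (t : R) : R :=
  expR (- \sum_(m < r) (t + exposure_shift i m) / theta i m).

Definition prob_fail (l : 'I_L) (j : 'I_r) : R :=
  let i := stress_idx l in
  cause_prob i j * (surv i (IT D l) - surv i (IT D l.+1)).

Definition prob_surv : R := surv 1 (tau2 D).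

Definition cell_prob : 'cV[R]_(L * r + 1) := cell_vec prob_fail prob_surv.

Definition zfun (i : 'I_2) (j k : 'I_r) (b : 'I_2) (t : R) : R :=
  cause_prob i j * surv i t *
  (if b == 0
   then cause_prob i k - (j == k)%:R + (t + exposure_shift i k) / theta i k
   else (cause_prob i k - (j == k)%:R) * stress D i
        + (- exposure_shift_star i k + (t + exposure_shift i k) * stress D i)
          / theta i k).

Definition W_fail (l : 'I_L) (j k : 'I_r) (b : 'I_2) : R :=
  let i := stress_idx l in zfun i j k b (IT D l) - zfun i j k b (IT D l.+1).

Definition W_surv (k : 'I_r) (b : 'I_2) : R :=
  surv 1 (tau2 D) *
  (if b == 0 then (tau2 D + exposure_shift 1 k) / theta 1 k
   else (- exposure_shift_star 1 k + (tau2 D + exposure_shift 1 k) * stress D 1)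
        / theta 1 k).

(* The Jacobian matrix of cell_prob at a, written out explicitly. *)
Definition W_mx : 'M[R]_(L * r + 1, r * 2) :=
  \matrix_(s, t) cell_vec (fun l j => par_vec (W_fail l j) 0 t)
                          (par_vec W_surv 0 t) s 0.

Definition pow_vec (b : R) : 'cV[R]_(L * r + 1) :=
  map_mx (fun x => x `^ b) cell_prob.

Definition pow_diag (b : R) : 'M[R]_(L * r + 1) := diag_mx (pow_vec b)^T.

Definition J_mx (beta : R) : 'M[R]_(r * 2) :=
  W_mx^T *m pow_diag (beta - 1) *m W_mx.

Definition K_mx (beta : R) : 'M[R]_(r * 2) :=
  W_mx^T *m (pow_diag (2 * beta - 1) - pow_vec beta *m (pow_vec beta)^T)
    *m W_mx.

End Model.

(* For beta = 0 the convention 0 log 0 = 0 is built in, ln being total. *)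
Definition dpd (R : realType) (K : nat) (beta : R) (q p : 'cV[R]_K) : R :=
  if beta == 0 then \sum_(s < K) q s 0 * ln (q s 0 / p s 0)
  else \sum_(s < K) (p s 0 `^ (1 + beta)
                     - (1 + beta^-1) * q s 0 * p s 0 `^ beta
                     + beta^-1 * q s 0 `^ (1 + beta)).

Definition empirical (R : realType) (K : nat) (N : nat) (n : 'cV[nat]_K) :
  'cV[R]_K := map_mx (fun c => c%:R / N%:R) n.

Definition all_causes_observed (R : realType) (L r : nat)
    (D : stepStressTest R L) (n : 'cV[nat]_(L * r + 1)) : Prop :=
  forall (i : 'I_2) (j : 'I_r), exists l : 'I_L,
    stress_idx D l = i /\ (0 < n (cell_idx l j) 0%R)%N.

Definition is_argmin_dpd (R : realType) (L r : nat) (D : stepStressTest R L)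
    (beta : R) (q : 'cV[R]_(L * r + 1)) (a : 'rV[R]_(r * 2)) : Prop :=
  forall b : 'rV[R]_(r * 2),
    dpd beta q (cell_prob D a) <= dpd beta q (cell_prob D b).

(* The infimum of the divergence need not be attained (e.g. when no unit
   survives), so only the attained case constrains the estimator: it is then
   some minimizer, chosen arbitrarily if there are several. *)
Definition is_MDPDE (R : realType) (L r : nat) (D : stepStressTest R L)
    (beta : R) (ahat : nat -> 'cV[nat]_(L * r + 1) -> 'rV[R]_(r * 2)) : Prop :=
  forall (N : nat) (n : 'cV[nat]_(L * r + 1)),
    (\sum_s n s 0%R)%N = N ->
    all_causes_observed D n ->
    (exists a, is_argmin_dpd D beta (empirical R N n) a) ->
    is_argmin_dpd D beta (empirical R N n) (ahat N n).

Definition multinomial_pmf (R : realType) (K : nat) (N : nat) (p : 'cV[R]_K)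
    (n : 'cV[nat]_K) : R :=
  if (\sum_s n s 0%R)%N == N
  then (N`!)%:R / (\prod_s (n s 0%R)`!%:R) * \prod_s p s 0 ^+ n s 0%R
  else 0.

Definition has_multinomial_law (R : realType) (d : measure_display)
    (T : measurableType d) (P : probability T R) (K : nat) (N : nat)
    (p : 'cV[R]_K) (X : T -> 'cV[nat]_K) : Prop :=
  forall n : 'cV[nat]_K,
    measurable (X @^-1` [set n]) /\
    P (X @^-1` [set n]) = (multinomial_pmf N p n)%:E.

Definition borel_rV (R : realType) (k : nat) :=
  g_sigma_algebraType (@open 'rV[R]_k).

(* Every linear functional u has the law N(m u, u^T S u), which is a Dirac mass
   if its variance is 0; that case is separate because normal_prob with standard
   deviation 0 is, by convention, the uniform law on [0, 1]. *)
Definition is_multivariate_normal (R : realType) (k : nat) (m : 'rV[R]_k)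
    (S : 'M[R]_k) (G : probability (borel_rV R k) R) : Prop :=
  forall (u : 'cV[R]_k) (A : set R), measurable A ->
    let mean := (m *m u) 0 0 in
    let var := (u^T *m S *m u) 0 0 in
    G [set x | A (((x : 'rV[R]_k) *m u) 0 0)] =
      if var == 0 then \d_mean A else normal_prob mean (Num.sqrt var) A.

Definition cvg_in_distribution (R : realType) (k : nat)
    (d : nat -> measure_display) (T : forall N, measurableType (d N))
    (P : forall N, probability (T N) R) (Y : forall N, T N -> 'rV[R]_k)
    (G : probability (borel_rV R k) R) : Prop :=
  forall f : 'rV[R]_k -> R, continuous f ->
    (exists M : R, forall x, `|f x| <= M) ->
    (fun N => \int[P N]_w (f (Y N w))%:E)%E @ \oo
      --> (\int[G]_x (f x)%:E)%E.

(* Main.v *)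
Require Import Defs.
From HB Require Import structures.
From mathcomp Require Import all_boot all_order all_algebra.
From mathcomp Require Import all_classical all_reals all_analysis.
From mathcomp Require Import measurable_realfun ring lra.
Set Implicit Arguments.
Unset Strict Implicit.
Unset Printing Implicit Defensive.
Import Order.TTheory GRing.Theory Num.Theory.
Import numFieldNormedType.Exports.
Local Open Scope classical_set_scope.
Local Open Scope ring_scope.

(** Three facts make the theorem true.

    The model is identifiable. The cells of the first and of the last interval together
    with the survivors determine the parameter continuously and differentiably
    (par_ofE, cts_par_of), so W is injective (W_inj) and J is invertible (J_unit), and a
    parameter whose divergence from q is not larger than that of a0 is close to a0 as soon
    as q is close to p(a0) (dpd_consistent, par_consistent). By compactness the
    divergence then attains its minimum (near_argmin).

    The estimator is asymptotically linear. At a minimizer a the divergence is stationary,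
    that is, W(a)^T D^(beta-1) (p(a) - q) = 0 (argmin_score); comparing this equation with its
    linearisation at a0 gives a - a0 = M (q - p(a0)) + o(q - p(a0)) with
    M = J^-1 W^T D^(beta-1) (argmin_linear). All this is a statement about q near p(a0) and
    involves no probability. The sandwich is M (diag p - p p^T) M^T (sandwich_variance).

    A statistic of multinomial counts with such an expansion satisfies the central limit
    theorem (cvg_linear_statistic). The expectation of a function of the counts is an
    average over the steps of a random walk (integral_counts), and the angle-addition
    formula follows the mean of a cosine of a linear score along the walk, which tends to
    exp(-v/2) (cvg_mexp_cos). The Gaussian law has the same means of cosines
    (gauss_mean_cos), and a bounded continuous function is uniformly close on large cubes
    to a combination of such cosines with the same bound (trig_approx), whence convergence
    in law (cvg_mean_of_cos). The limit exists as the law of a linear image of independent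
    standard Gaussian variables (gauss_family, gauss_vector_exists).

    Working with cosines and real hyperbolic functions avoids complex characteristic
    functions: the mean of the cosine of a Gaussian variable is obtained from that of the
    hyperbolic cosine and from stability under convolution (gauss_cos). *)

(** * Elementary bounds *)

Section calc.
Variable R : realType.
Implicit Types x y t : R.

(** Taylor's inequalities for the circular and hyperbolic functions below follow from each
    other by repeated use of this form of the mean value theorem. *)
Lemma le0_derive (f df : R -> R) :
  (forall x, is_derive x (1 : R) f (df x)) -> f 0 = 0 ->
  (forall x, 0 <= x -> 0 <= df x) -> forall x, 0 <= x -> 0 <= f x.
Proof.
move=> fd f0 df0 x x0.
have cf : {within `[0, x], continuous f}.
  apply: continuous_subspaceT => y.
  by apply: differentiable_continuous; apply/derivable1_diffP; have [] := fd y.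
have [c] := MVT_segment x0 (fun y _ => fd y) cf.
rewrite in_itv/= f0 subr0 subr0 => /andP[c0 _] ->.
by rewrite mulr_ge0 ?df0.
Qed.

Lemma sin_le x : 0 <= x -> sin x <= x.
Proof.
move=> x0; rewrite -subr_ge0.
apply: (@le0_derive (fun x => x - sin x) (fun x => 1 - cos x)) => [|y _|//].
- by rewrite sin0 subrr.
- by rewrite subr_ge0 cos_le1.
Qed.

Lemma cos_ge_quad x : 1 - x ^+ 2 / 2 <= cos x.
Proof.
wlog x0 : x / 0 <= x => [H|].
  have [/H//|/ltW x0] := leP 0 x.
  by rewrite -cosN -[in leLHS](sqrrN x) H// oppr_ge0.
rewrite -subr_ge0.
apply: (@le0_derive (fun x => cos x - (1 - x ^+ 2 / 2)) (fun x => x - sin x)) => [y||y y0|//].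
- apply: is_derive_eq; rewrite /GRing.scale/= ?expr1; lra.
- by rewrite cos0 expr0n/=; lra.
- by rewrite subr_ge0 sin_le.
Qed.

Lemma sin_ge_cubic x : 0 <= x -> x - x ^+ 3 / 6 <= sin x.
Proof.
move=> x0; rewrite -subr_ge0.
apply: (@le0_derive (fun x => sin x - (x - x ^+ 3 / 6))
  (fun x => cos x - (1 - x ^+ 2 / 2))) => [y||y y0|//].
- apply: is_derive_eq; rewrite /GRing.scale/= ?expr1; lra.
- by rewrite sin0 expr0n/=; lra.
- by rewrite subr_ge0 cos_ge_quad.
Qed.

Lemma cos_le_quart x : cos x <= 1 - x ^+ 2 / 2 + x ^+ 4 / 24.
Proof.
wlog x0 : x / 0 <= x => [H|].
  have [/H//|/ltW x0] := leP 0 x.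
  have := H (- x); rewrite oppr_ge0 => /(_ x0).
  by rewrite cosN sqrrN (_ : (- x) ^+ 4 = x ^+ 4)//; ring.
rewrite -subr_ge0.
apply: (@le0_derive (fun x => (1 - x ^+ 2 / 2 + x ^+ 4 / 24) - cos x)
  (fun x => sin x - (x - x ^+ 3 / 6))) => [y||y y0|//].
- apply: is_derive_eq; rewrite /GRing.scale/= ?expr1; lra.
- by rewrite cos0 !expr0n/=; lra.
- by rewrite subr_ge0 sin_ge_cubic.
Qed.

Lemma cos_quad_err x : `|cos x - (1 - x ^+ 2 / 2)| <= x ^+ 4 / 24.
Proof.
have := cos_ge_quad x; have := cos_le_quart x.
by move=> h1 h2; rewrite ler_norml; lra.
Qed.

Lemma sin_err x : `|sin x - x| <= `|x| ^+ 3 / 6.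
Proof.
wlog x0 : x / 0 <= x => [H|].
  have [/H//|/ltW x0] := leP 0 x.
  have := H (- x); rewrite oppr_ge0 => /(_ x0).
  by rewrite sinN -opprD !normrN.
rewrite (ger0_norm x0).
have := sin_le x0; have := sin_ge_cubic x0; have : 0 <= x ^+ 3 by rewrite exprn_ge0.
by move=> h0 h1 h2; rewrite ler_norml; lra.
Qed.

Definition cosh x := (expR x + expR (- x)) / 2.
Definition sinh x := (expR x - expR (- x)) / 2.

Lemma coshN x : cosh (- x) = cosh x.
Proof. by rewrite /cosh opprK addrC. Qed.

Lemma cosh0 : cosh 0 = 1.
Proof. by rewrite /cosh oppr0 expR0; lra. Qed.

Lemma sinh0 : sinh 0 = 0.
Proof. by rewrite /sinh oppr0 expR0 subrr mul0r. Qed.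

Instance is_derive_cosh x : is_derive x (1 : R) cosh (sinh x).
Proof.
rewrite (_ : cosh = fun x => (expR x + expR (- x)) / 2)//.
by apply: is_derive_eq; rewrite /sinh /GRing.scale/=; lra.
Qed.

Instance is_derive_sinh x : is_derive x (1 : R) sinh (cosh x).
Proof.
rewrite (_ : sinh = fun x => (expR x - expR (- x)) / 2)//.
by apply: is_derive_eq; rewrite /cosh /GRing.scale/=; lra.
Qed.

Lemma cosh_gt0 x : 0 < cosh x.
Proof. by rewrite divr_gt0// addr_gt0// expR_gt0. Qed.

Lemma sinh_ge0 x : 0 <= x -> 0 <= sinh x.
Proof.
apply: (@le0_derive sinh cosh) => [|y _].
- exact: sinh0.
- by rewrite ltW// cosh_gt0.
Qed.

Lemma cosh_ge1 x : 1 <= cosh x.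
Proof.
wlog x0 : x / 0 <= x => [H|].
  have [/H//|/ltW x0] := leP 0 x.
  by rewrite -coshN H// oppr_ge0.
rewrite -subr_ge0; move: x0.
apply: (@le0_derive (fun x => cosh x - 1) sinh) => [y||y].
- by apply: is_derive_eq; rewrite subr0.
- by rewrite cosh0 subrr.
- exact: sinh_ge0.
Qed.

Lemma sinh_ge x : 0 <= x -> x <= sinh x.
Proof.
rewrite -[_ <= sinh x]subr_ge0.
apply: (@le0_derive (fun x => sinh x - x) (fun x => cosh x - 1)) => [|y _].
- by rewrite sinh0 subrr.
- by rewrite subr_ge0 cosh_ge1.
Qed.

Lemma cosh_ge_quad x : 1 + x ^+ 2 / 2 <= cosh x.
Proof.
wlog x0 : x / 0 <= x => [H|].
  have [/H//|/ltW x0] := leP 0 x.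
  by rewrite -coshN -[in leLHS](sqrrN x) H// oppr_ge0.
rewrite -subr_ge0; move: x0.
apply: (@le0_derive (fun x => cosh x - (1 + x ^+ 2 / 2)) (fun x => sinh x - x)) => [y||y y0].
- apply: is_derive_eq; rewrite /GRing.scale/= ?expr1; lra.
- by rewrite cosh0 expr0n/=; lra.
- by rewrite subr_ge0 sinh_ge.
Qed.

Lemma sinh_ge_cubic x : 0 <= x -> x + x ^+ 3 / 6 <= sinh x.
Proof.
rewrite -[_ <= sinh x]subr_ge0.
apply: (@le0_derive (fun x => sinh x - (x + x ^+ 3 / 6))
  (fun x => cosh x - (1 + x ^+ 2 / 2))) => [y||y _].
- apply: is_derive_eq; rewrite /GRing.scale/= ?expr1; lra.
- by rewrite sinh0 expr0n/=; lra.
- by rewrite subr_ge0 cosh_ge_quad.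
Qed.

Lemma cosh_ge_quart x : 1 + x ^+ 2 / 2 + x ^+ 4 / 24 <= cosh x.
Proof.
wlog x0 : x / 0 <= x => [H|].
  have [/H//|/ltW x0] := leP 0 x.
  have := H (- x); rewrite oppr_ge0 => /(_ x0).
  by rewrite coshN sqrrN (_ : (- x) ^+ 4 = x ^+ 4)//; ring.
rewrite -subr_ge0; move: x0.
apply: (@le0_derive (fun x => cosh x - (1 + x ^+ 2 / 2 + x ^+ 4 / 24))
  (fun x => sinh x - (x + x ^+ 3 / 6))) => [y||y y0].
- apply: is_derive_eq; rewrite /GRing.scale/= ?expr1; lra.
- by rewrite cosh0 !expr0n/=; lra.
- by rewrite subr_ge0 sinh_ge_cubic.
Qed.

Lemma sinh_le x : 0 <= x -> sinh x <= x * cosh x.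
Proof.
rewrite -[sinh x <= _]subr_ge0.
apply: (@le0_derive (fun x => x * cosh x - sinh x) (fun x => x * sinh x)) => [y||y y0].
- by apply: is_derive_eq; rewrite /GRing.scale/=; lra.
- by rewrite sinh0; lra.
- by rewrite mulr_ge0// sinh_ge0.
Qed.

Lemma cosh_le_quad x : cosh x - 1 <= x ^+ 2 / 2 * cosh x.
Proof.
wlog x0 : x / 0 <= x => [H|].
  have [/H//|/ltW x0] := leP 0 x.
  by rewrite -coshN -(sqrrN x) H// oppr_ge0.
rewrite -subr_ge0; move: x0.
apply: (@le0_derive (fun x => x ^+ 2 / 2 * cosh x - (cosh x - 1))
  (fun x => x * cosh x - sinh x + x ^+ 2 / 2 * sinh x)) => [y||y y0].
- apply: is_derive_eq; rewrite /GRing.scale/= ?expr1; lra.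
- by rewrite cosh0 expr0n/=; lra.
- by rewrite addr_ge0 ?subr_ge0 ?sinh_le// mulr_ge0 ?sinh_ge0 ?divr_ge0 ?sqr_ge0.
Qed.

Lemma sinh_le_cubic x : 0 <= x -> sinh x - x <= x ^+ 3 / 6 * cosh x.
Proof.
rewrite -[sinh x - x <= _]subr_ge0.
apply: (@le0_derive (fun x => x ^+ 3 / 6 * cosh x - (sinh x - x))
  (fun x => x ^+ 2 / 2 * cosh x - (cosh x - 1) + x ^+ 3 / 6 * sinh x)) => [y||y y0].
- apply: is_derive_eq; rewrite /GRing.scale/= ?expr1; lra.
- by rewrite sinh0 expr0n/=; lra.
- by rewrite addr_ge0 ?subr_ge0 ?cosh_le_quad// mulr_ge0 ?sinh_ge0 ?divr_ge0 ?exprn_ge0.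
Qed.

Lemma cosh_le_quart x : cosh x - (1 + x ^+ 2 / 2) <= x ^+ 4 / 24 * cosh x.
Proof.
wlog x0 : x / 0 <= x => [H|].
  have [/H//|/ltW x0] := leP 0 x.
  have := H (- x); rewrite oppr_ge0 => /(_ x0).
  by rewrite coshN sqrrN (_ : (- x) ^+ 4 = x ^+ 4)//; ring.
rewrite -subr_ge0; move: x0.
apply: (@le0_derive (fun x => x ^+ 4 / 24 * cosh x - (cosh x - (1 + x ^+ 2 / 2)))
  (fun x => x ^+ 3 / 6 * cosh x - (sinh x - x) + x ^+ 4 / 24 * sinh x)) => [y||y y0].
- apply: is_derive_eq; rewrite /GRing.scale/= ?expr1; lra.
- by rewrite cosh0 !expr0n/=; lra.
- by rewrite addr_ge0 ?subr_ge0 ?sinh_le_cubic// mulr_ge0 ?sinh_ge0 ?divr_ge0 ?exprn_ge0.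
Qed.

(** The quadratic terms cancel, so this trades the cosine of a Gaussian for its
    hyperbolic cosine, whose mean is found by completing a square. *)
Lemma cos_cosh_err x : `|cos x + cosh x - 2| <= x ^+ 4 / 12 * cosh x.
Proof.
have := cos_quad_err x; rewrite ler_norml => /andP[h1 h2].
have h3 := cosh_ge_quart x; have h4 := cosh_le_quart x.
have h5 : x ^+ 4 / 24 <= x ^+ 4 / 24 * cosh x.
  by rewrite ler_peMr ?cosh_ge1// divr_ge0// exprn_even_ge0.
have h6 : 0 <= x ^+ 4 by rewrite exprn_even_ge0.
rewrite ler_norml; lra.
Qed.

Lemma norm_expX_sub (a b : R) n : `|a| <= 1 -> `|b| <= 1 ->
  `|a ^+ n - b ^+ n| <= n%:R * `|a - b|.
Proof.
move=> a1 b1; elim: n => [|n IH]; first by rewrite !expr0 subrr normr0 mul0r.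
rewrite (_ : a ^+ n.+1 - b ^+ n.+1 = a * (a ^+ n - b ^+ n) + (a - b) * b ^+ n); last first.
  by rewrite !exprS; ring.
apply: le_trans (ler_normD _ _) _; rewrite !normrM -natr1 mulrDl mul1r lerD//.
  by apply: le_trans IH; rewrite ler_piMl.
by rewrite ler_piMr// normrX exprn_ile1.
Qed.

Lemma expRN_err y : 0 <= y -> `|expR (- y) - (1 - y)| <= y ^+ 2.
Proof.
move=> y0; have h1 := @expR_ge1Dx R (- y).
rewrite ger0_norm; last by lra.
have [y1|y1] := leP y 1.
  have h2 : expR (- y) * (1 + y) <= 1.
    have := @expR_ge1Dx R y; rewrite -(ler_pM2l (expR_gt0 (- y))).
    by rewrite -expRD addNr expR0.
  have h3 : (1 - y + y ^+ 2) * (1 + y) = 1 + y ^+ 3 by ring.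
  have h4 : 0 <= y ^+ 3 by rewrite exprn_ge0.
  have : expR (- y) * (1 + y) <= (1 - y + y ^+ 2) * (1 + y) by rewrite h3; lra.
  by rewrite ler_pM2r; lra.
have h2 : expR (- y) <= 1 by rewrite expR_le1; lra.
have h3 : y <= y ^+ 2 by rewrite expr2 ler_peMl// ltW.
lra.
Qed.

End calc.

(* Pointwise rules for functions given in applied form, so that they unify with the
   explicit formulas of the model. *)
Section continuity_at.
Variables (R : realType) (T : topologicalType).
Implicit Types (f g : T -> R) (x : T).

Lemma ctsD f g x : {for x, continuous f} -> {for x, continuous g} ->
  {for x, continuous (fun y => f y + g y)}.
Proof. exact: continuousD. Qed.

Lemma ctsM f g x : {for x, continuous f} -> {for x, continuous g} ->
  {for x, continuous (fun y => f y * g y)}.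
Proof. exact: continuousM. Qed.

Lemma ctsN f x : {for x, continuous f} -> {for x, continuous (fun y => - f y)}.
Proof. exact: continuousN. Qed.

Lemma ctsB f g x : {for x, continuous f} -> {for x, continuous g} ->
  {for x, continuous (fun y => f y - g y)}.
Proof. by move=> cf cg; apply: ctsD => //; exact: ctsN. Qed.

Lemma cts_cst (c : R) x : {for x, continuous (fun=> c : R)}.
Proof. exact: cvg_cst. Qed.

Lemma ctsV f x : f x != 0 -> {for x, continuous f} ->
  {for x, continuous (fun y => (f y)^-1)}.
Proof. by move=> f0 cf; exact: cvgV. Qed.

Lemma cts_sum (I : Type) (s : seq I) (F : I -> T -> R) x :
  (forall i, {for x, continuous (F i)}) ->
  {for x, continuous (fun y => \sum_(i <- s) F i y)}.
Proof.
move=> cF; elim: s => [|i s IH].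
  rewrite (_ : (fun y => _) = fun=> 0); first exact: cts_cst.
  by apply/funext => y; rewrite big_nil.
rewrite (_ : (fun y => _) = fun y => F i y + \sum_(j <- s) F j y); first exact: ctsD.
by apply/funext => y; rewrite big_cons.
Qed.

Lemma cts_comp f (h : R -> R) x : {for x, continuous f} ->
  {for f x, continuous h} -> {for x, continuous (fun y => h (f y))}.
Proof. exact: continuous_comp. Qed.

End continuity_at.

Section derivative_rules.
Variable R : realType.
Implicit Types (f g : R -> R) (x df dg : R).

Lemma der_cst (c x : R) : is_derive x (1 : R) (fun=> c) 0.
Proof. exact: is_derive_cst. Qed.

Lemma derD f g x df dg : is_derive x (1 : R) f df -> is_derive x (1 : R) g dg ->
  is_derive x (1 : R) (fun y => f y + g y) (df + dg).
Proof. by move=> hf hg; exact: is_deriveD. Qed.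

Lemma derN f x df : is_derive x (1 : R) f df -> is_derive x (1 : R) (fun y => - f y) (- df).
Proof. by move=> hf; exact: is_deriveN. Qed.

Lemma derB f g x df dg : is_derive x (1 : R) f df -> is_derive x (1 : R) g dg ->
  is_derive x (1 : R) (fun y => f y - g y) (df - dg).
Proof. by move=> hf hg; exact: is_deriveB. Qed.

Lemma derM f g x df dg : is_derive x (1 : R) f df -> is_derive x (1 : R) g dg ->
  is_derive x (1 : R) (fun y => f y * g y) (df * g x + f x * dg).
Proof.
move=> hf hg; have h := is_deriveM hf hg.
by apply: (is_derive_eq h); rewrite /GRing.scale/=; ring.
Qed.

Lemma derV f x df : f x != 0 -> is_derive x (1 : R) f df ->
  is_derive x (1 : R) (fun y => (f y)^-1) (- df / f x ^+ 2).
Proof.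
move=> f0 hf; have h := is_deriveV f0 hf.
by apply: (is_derive_eq h); rewrite /GRing.scale/=; field.
Qed.

Lemma der_comp f (h : R -> R) x df dh : is_derive x (1 : R) f df ->
  is_derive (f x) (1 : R) h dh -> is_derive x (1 : R) (fun y => h (f y)) (dh * df).
Proof. by move=> hf hh; exact: is_derive1_comp. Qed.

Lemma der_sum n (F : 'I_n -> R -> R) x (dF : 'I_n -> R) :
  (forall i, is_derive x (1 : R) (F i) (dF i)) ->
  is_derive x (1 : R) (fun y => \sum_i F i y) (\sum_i dF i).
Proof.
move=> hF; rewrite (_ : (fun y => _) = \sum_i F i); first exact: is_derive_sum.
by apply/funext => y; rewrite fct_sumE.
Qed.

End derivative_rules.

Lemma cts_id (R : realType) (x : R) : {for x, continuous (fun y : R => y)}.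
Proof. exact: cvg_id. Qed.

(** * The multinomial law as a random walk *)

Section multinomial.
Variables (R : realType) (K : nat) (p : 'cV[R]_K).
Hypothesis p_ge0 : forall s, 0 <= p s 0.
Hypothesis p_sum : \sum_s p s 0 = 1.
Implicit Types (n : 'cV[nat]_K) (h : 'cV[nat]_K -> R).

(** The mean of h over the counts of N independent draws with law p, by recursion on the
    draws: the last one adds a unit to the cell s with probability p s. *)
Fixpoint mexp (N : nat) h : R :=
  if N is N'.+1
  then \sum_s p s 0 * mexp N' (fun n => h (\col_t (n t 0%R + (t == s))%N))
  else h 0.

Lemma sum_succ n s :
  (\sum_t (\col_t (n t 0%R + (t == s))%N) t 0%R = (\sum_t n t 0%R).+1)%N.
Proof.
under eq_bigr do rewrite mxE.
rewrite big_split/= -[RHS]addn1; congr (_ + _)%N.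
by rewrite (bigD1 s)//= eqxx big1// => t /negbTE ->.
Qed.

Lemma eq_mexp N h1 h2 :
  (forall n, (\sum_t n t 0%R)%N = N -> h1 n = h2 n) -> mexp N h1 = mexp N h2.
Proof.
elim: N h1 h2 => [|N IH] h1 h2 e /=.
  by apply: e; rewrite big1// => s _; rewrite mxE.
apply: eq_bigr => s _; congr (_ * _); apply: IH => n nN.
by apply: e; rewrite sum_succ nN.
Qed.

Lemma mexpD N h1 h2 : mexp N (fun n => h1 n + h2 n) = mexp N h1 + mexp N h2.
Proof.
elim: N h1 h2 => [//|N IH] h1 h2 /=.
by rewrite -big_split/=; apply: eq_bigr => s _; rewrite IH mulrDr.
Qed.

Lemma mexpZ N c h : mexp N (fun n => c * h n) = c * mexp N h.
Proof.
elim: N h => [//|N IH] h /=.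
by rewrite mulr_sumr; apply: eq_bigr => s _; rewrite IH mulrCA.
Qed.

Lemma mexp_cst N c : mexp N (fun=> c) = c.
Proof.
elim: N => [//|N IH] /=.
by under eq_bigr do rewrite IH; rewrite -mulr_suml p_sum mul1r.
Qed.

Lemma mexp_sum N (I : Type) (r : seq I) (h : I -> 'cV[nat]_K -> R) :
  mexp N (fun n => \sum_(i <- r) h i n) = \sum_(i <- r) mexp N (h i).
Proof.
elim: r => [|i r IH].
  rewrite big_nil -[RHS](mexp_cst N 0); apply: eq_mexp => n _.
  by rewrite big_nil.
rewrite big_cons -IH -mexpD; apply: eq_mexp => n _.
by rewrite big_cons.
Qed.

Lemma le_mexp N h1 h2 :
  (forall n, (\sum_t n t 0%R)%N = N -> h1 n <= h2 n) -> mexp N h1 <= mexp N h2.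
Proof.
elim: N h1 h2 => [|N IH] h1 h2 e /=.
  by apply: e; rewrite big1// => s _; rewrite mxE.
apply: ler_sum => s _; apply: ler_wpM2l => //; apply: IH => n nN.
by apply: e; rewrite sum_succ nN.
Qed.

Lemma norm_mexp_le N h c : (forall n, `|h n| <= c) -> `|mexp N h| <= c.
Proof.
move=> hc; rewrite ler_norml -{1}(mexp_cst N (- c)) -{2}(mexp_cst N c).
by apply/andP; split; apply: le_mexp => n _; have := hc n; rewrite ler_norml => /andP[].
Qed.

(* moments of a score c that is centred under p *)
Section score.
Variable c : 'I_K -> R.
Hypothesis c0 : \sum_s p s 0 * c s = 0.
Let v := \sum_s p s 0 * c s ^+ 2.
Let walk n := \sum_s c s * (n s 0)%:R.

Let walk_succ n s : walk (\col_t (n t 0%R + (t == s))%N) = walk n + c s.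
Proof.
rewrite /walk; under eq_bigr do rewrite mxE natrD mulrDr.
rewrite big_split/=; congr (_ + _).
rewrite (bigD1 s)//= eqxx mulr1 big1 ?addr0// => t /negbTE ->.
by rewrite mulr0.
Qed.

Lemma mexp_walk N : mexp N walk = 0.
Proof.
elim: N => [|N IH] /=; first by rewrite /walk big1// => s _; rewrite mxE mulr0.
under eq_bigr => s _.
  rewrite (eq_mexp (h2 := fun n => walk n + c s)); last by move=> n _; exact: walk_succ.
  rewrite mexpD mexp_cst IH add0r; over.
exact: c0.
Qed.

Lemma mexp_walk_sqr N : mexp N (fun n => walk n ^+ 2) = N%:R * v.
Proof.
elim: N => [|N IH] /=.
  by rewrite /walk big1 ?expr0n ?mul0r// => s _; rewrite mxE mulr0.
under eq_bigr => s _.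
  rewrite (eq_mexp (h2 := fun n => walk n ^+ 2 + (2 * c s * walk n + c s ^+ 2)));
    last by move=> n _; rewrite walk_succ; ring.
  rewrite mexpD mexpD mexpZ mexp_cst mexp_walk IH mulr0 add0r mulrDr; over.
by rewrite big_split/= -mulr_suml p_sum mul1r -natr1 mulrDl mul1r.
Qed.

(** The angle-addition formula makes cosines eigenfunctions of one step of the
    walk, up to an error of third order in the step size t: there is no
    first-order term because the score is centred. *)
Lemma mexp_cos_step (t : R) N th : 0 <= t <= 1 ->
  `|mexp N.+1 (fun n => cos (t * walk n + th))
    - expR (- (t ^+ 2 * v / 2)) * mexp N (fun n => cos (t * walk n + th))|
  <= (\sum_s p s 0 * (c s ^+ 4 + `|c s| ^+ 3) + v ^+ 2) * t ^+ 3.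
Proof.
move=> /andP[t0 t1].
set C := mexp N (fun n => cos (t * walk n + th)).
pose S := mexp N (fun n => sin (t * walk n + th)).
have C1 : `|C| <= 1 by apply: norm_mexp_le => n; exact: cos_max.
have S1 : `|S| <= 1 by apply: norm_mexp_le => n; exact: sin_max.
have -> : mexp N.+1 (fun n => cos (t * walk n + th)) =
   \sum_s p s 0 * (cos (t * c s) * C - sin (t * c s) * S).
  apply: eq_bigr => s _; congr (_ * _).
  rewrite -mulNr -!mexpZ -mexpD; apply: eq_mexp => n _.
  by rewrite walk_succ (_ : _ + th = t * walk n + th + t * c s) ?cosD; ring.
set E := expR _.
have v0 : 0 <= v by apply: sumr_ge0 => s _; rewrite mulr_ge0// sqr_ge0.
have tX (i j : nat) : (i <= j)%N -> t ^+ j <= t ^+ i.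
  by move=> ij; rewrite ler_wiXn2l.
have -> : \sum_s p s 0 * (cos (t * c s) * C - sin (t * c s) * S) - E * C =
  \sum_s p s 0 * ((cos (t * c s) - (1 - (t * c s) ^+ 2 / 2)) * C
     - (sin (t * c s) - t * c s) * S) - (E - (1 - t ^+ 2 * v / 2)) * C.
  rewrite [in RHS](eq_bigr (fun s => p s 0 * (cos (t * c s) * C - sin (t * c s) * S) +
     (p s 0 * (- C) + p s 0 * c s ^+ 2 * (t ^+ 2 / 2 * C) + p s 0 * c s * (t * S)))); last first.
    by move=> s _; ring.
  rewrite !big_split/= -!mulr_suml p_sum c0 -/v; ring.
apply: le_trans (ler_normB _ _) _; rewrite [leRHS]mulrDl; apply: lerD; last first.
  rewrite normrM; apply: (@le_trans _ _ (`|E - (1 - t ^+ 2 * v / 2)|)).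
    by rewrite ler_piMr.
  apply: le_trans (expRN_err _) _; first by rewrite divr_ge0// mulr_ge0// sqr_ge0.
  rewrite (_ : _ ^+ 2 = v ^+ 2 * (t ^+ 4 / 4)); last by field.
  apply: ler_wpM2l; first exact: sqr_ge0.
  have := tX 3%N 4%N isT; have : 0 <= t ^+ 4 by rewrite exprn_ge0.
  by lra.
apply: le_trans (ler_norm_sum _ _ _) _; rewrite mulr_suml; apply: ler_sum => s _.
rewrite normrM ger0_norm// -mulrA; apply: ler_wpM2l => //.
apply: le_trans (ler_normB _ _) _; rewrite [leRHS]mulrDl; apply: lerD; rewrite normrM.
  apply: (@le_trans _ _ ((t * c s) ^+ 4 / 24)).
    by apply: le_trans (cos_quad_err _); rewrite ler_piMr.
  have c4 : 0 <= c s ^+ 4 by rewrite exprn_even_ge0.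
  rewrite exprMn mulrC mulrA mulrC; apply: ler_pM => //.
  - by rewrite mulr_ge0// exprn_ge0.
  - have := tX 3%N 4%N isT; have : 0 <= t ^+ 4 by rewrite exprn_ge0.
    lra.
apply: (@le_trans _ _ (`|t * c s| ^+ 3 / 6)).
  by apply: le_trans (sin_err _); rewrite ler_piMr.
have c3 : 0 <= `|c s| ^+ 3 by rewrite exprn_ge0.
rewrite normrM (ger0_norm t0) exprMn mulrC mulrA mulrC; apply: ler_pM => //.
- by rewrite mulr_ge0// exprn_ge0.
- have : 0 <= t ^+ 3 by rewrite exprn_ge0.
  lra.
Qed.

(** Iterating the step estimate with t = 1 / sqrt N: the N errors of order N^(-3/2) add up
    to a quantity of order 1 / sqrt N. *)
Lemma cvg_mexp_cos th :
  mexp N (fun n => cos (walk n / Num.sqrt N%:R + th)) @[N --> \oo]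
    --> expR (- (v / 2)) * cos th.
Proof.
pose C := \sum_s p s 0 * (c s ^+ 4 + `|c s| ^+ 3) + v ^+ 2.
have C0 : 0 <= C.
  rewrite addr_ge0 ?sqr_ge0// sumr_ge0// => s _; rewrite mulr_ge0//.
  by apply: addr_ge0; [exact: exprn_even_ge0|exact: exprn_ge0].
have v0 : 0 <= v by apply: sumr_ge0 => s _; rewrite mulr_ge0// sqr_ge0.
have H N : (0 < N)%N -> `|mexp N (fun n => cos (walk n / Num.sqrt N%:R + th))
    - expR (- (v / 2)) * cos th| <= C / Num.sqrt N%:R.
  move=> N0; pose t : R := (Num.sqrt N%:R)^-1.
  have sN : 1 <= Num.sqrt N%:R :> R.
    by rewrite -[leLHS]sqrtr1 ler_sqrt ?ler1n// ler0n.
  have t2 : t ^+ 2 = N%:R^-1 by rewrite exprVn sqr_sqrtr.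
  have t01 : 0 <= t <= 1.
    by rewrite invr_ge0 sqrtr_ge0/= invf_le1// (lt_le_trans ltr01).
  have /andP[t0 t1] := t01.
  pose E := expR (- (t ^+ 2 * v / 2)).
  have E1 : `|E| <= 1.
    by rewrite ger0_norm ?expR_ge0// expR_le1 oppr_le0 divr_ge0// mulr_ge0// sqr_ge0.
  have step j : `|mexp j (fun n => cos (t * walk n + th)) - E ^+ j * cos th|
      <= j%:R * (C * t ^+ 3).
    elim: j => [|j IH].
      rewrite /= mul0r /walk big1 ?mulr0 ?add0r ?expr0 ?mul1r ?subrr ?normr0//.
      by move=> s _; rewrite mxE mulr0.
    have := mexp_cos_step j th t01; rewrite -/C -/E => hs.
    rewrite (_ : _ - _ = (mexp j.+1 (fun n => cos (t * walk n + th)) -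
       E * mexp j (fun n => cos (t * walk n + th))) +
       E * (mexp j (fun n => cos (t * walk n + th)) - E ^+ j * cos th)); last first.
      by rewrite exprS; ring.
    apply: le_trans (ler_normD _ _) _.
    rewrite -natr1 mulrDl mul1r addrC; apply: lerD => //.
    by rewrite normrM; apply: le_trans IH; rewrite ler_piMl.
  have := step N.
  have -> : E ^+ N = expR (- (v / 2)).
    rewrite -expRM_natl; congr expR; rewrite t2; field.
    by rewrite pnatr_eq0 -lt0n.
  have -> : N%:R * (C * t ^+ 3) = C * t.
    rewrite exprS t2; field.
    by rewrite pnatr_eq0 -lt0n.
  rewrite (eq_mexp (h2 := fun n => cos (walk n / Num.sqrt N%:R + th)))//.
  by move=> n _; rewrite /t mulrC.
apply/cvgrPdist_le => e e0; near=> N.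
have N0 : (0 < N)%N by near: N; exact: nbhs_infty_gt.
rewrite distrC; apply: le_trans (H _ N0) _.
rewrite ler_pdivrMr ?sqrtr_gt0 ?ltr0n//.
have : (C / e) ^+ 2 <= N%:R by near: N; exact: nbhs_infty_ger.
rewrite -ler_sqrt ?ler0n// sqrtr_sqr ger0_norm; last by rewrite divr_ge0// ltW.
by rewrite ler_pdivrMr// mulrC.
Unshelve. all: by end_near. Qed.

End score.

(** The multinomial coefficient of n0 is a sum over the cell s of the last draw, in which s
    contributes the proportion n0 s / N. *)
Lemma mexp_indic N n0 :
  mexp N (fun n => (n == n0)%:R) = multinomial_pmf N p n0.
Proof.
elim: N n0 => [|N IH] n0 /=.
  rewrite /multinomial_pmf sum_nat_eq0.
  have -> : [forall i, true ==> (n0 i 0%R == 0%N)] = (0 == n0).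
    apply/forallP/eqP => [h|<- i]; last by rewrite mxE.
    by apply/matrixP => i j; rewrite (ord1 j) mxE; exact/esym/eqP/(implyP (h i)).
  case: eqP => // <-; rewrite fact0 div1r big1 ?invr1 ?mul1r; last by move=> s _; rewrite mxE.
  by rewrite big1// => s _; rewrite mxE.
pose pr s : 'cV[nat]_K := \col_t (n0 t 0%R - (t == s))%N.
have step s : p s 0 * mexp N (fun n => ((\col_t (n t 0%R + (t == s))%N) == n0)%:R) =
   (n0 s 0)%:R * (if (\sum_t n0 t 0%R)%N == N.+1 then
    N`!%:R / (\prod_s (n0 s 0%R)`!%:R) * \prod_s p s 0 ^+ n0 s 0%R else 0).
  have [ns0|ns0] := posnP (n0 s 0).
    rewrite ns0 mul0r (eq_mexp (h2 := fun=> 0)) ?mexp_cst ?mulr0// => n _.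
    case: eqP => // /matrixP /(_ s 0); rewrite mxE eqxx ns0 addn1.
    by [].
  have prK : (\col_t (pr s t 0%R + (t == s))%N) = n0.
    apply/matrixP => t j; rewrite (ord1 j) !mxE subnK//.
    by case: eqP => // ->.
  rewrite (eq_mexp (h2 := fun n => (n == pr s)%:R)); last first.
    move=> n _; congr (nat_of_bool _)%:R; apply/eqP/eqP => [e|->]//.
    by apply/matrixP => t j; rewrite (ord1 j) mxE -e mxE addnK.
  rewrite IH /multinomial_pmf -(eqSS _ N) -(sum_succ _ s) prK.
  case: ifP => _; last by rewrite !mulr0.
  have prs : n0 s 0 = (pr s s 0).+1 by rewrite mxE eqxx subn1 prednK.
  have prt t : t != s -> pr s t 0 = n0 t 0.
    by move=> /negbTE ts; rewrite mxE ts subn0.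
  rewrite !(bigD1 (P := xpredT) s)//= [in RHS]prs factS exprS natrM invfM.
  rewrite (eq_bigr (fun t => (n0 t 0)`!%:R)); last by move=> t /prt ->.
  rewrite [in LHS](eq_bigr (P := fun t => t != s) (F1 := fun t => p t 0 ^+ pr s t 0)
    (fun t => p t 0 ^+ n0 t 0)); last by move=> t /prt ->.
  rewrite -prs.
  set A := \prod_(_ < _ | _) _; set B := \prod_(_ < _ | _) _.
  rewrite !invfM; set A' := A^-1; set f := ((pr s s 0)`!)%:R^-1.
  have : (n0 s 0)%:R != 0 :> R by rewrite pnatr_eq0 -lt0n.
  by move=> ?; field.
under eq_bigr do rewrite step.
rewrite -mulr_suml -natr_sum /multinomial_pmf; case: eqP => [->|]; last by rewrite mulr0.
by rewrite mulrA mulrA -natrM -factS.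
Qed.

Section law.
Variables (d : measure_display) (T : measurableType d) (P : probability T R).
Variables (N : nat) (X : T -> 'cV[nat]_K).
Hypothesis X_law : has_multinomial_law P N p X.

Lemma measurable_counts (B : set 'cV[nat]_K) : measurable (X @^-1` B).
Proof.
have -> : X @^-1` B = \bigcup_i (if `[< B i >] then X @^-1` [set i] else set0).
  apply/seteqP; split=> [w Bw|w [i _]].
    by exists (X w) => //; case: asboolP.
  by case: asboolP => // Bi /= ->.
apply: countable_bigcupT_measurable; first exact: countableP.
by move=> i; case: ifP => _ //; case: (X_law i).
Qed.

Lemma measurable_fun_counts h : measurable_fun setT (fun w => h (X w)).
Proof.
by move=> _ B mB; rewrite setTI; exact: (measurable_counts (h @^-1` B)).
Qed.

(* A finite list that contains every count vector of total N. *)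
Let V : seq 'cV[nat]_K := 
  undup [seq \col_s (nat_of_ord (f s)) | f : {ffun 'I_K -> 'I_N.+1} <- enum {: {ffun 'I_K -> 'I_N.+1}}].

Let VP n : (\sum_t n t 0%R)%N = N -> n \in V.
Proof.
move=> nN; rewrite mem_undup; apply/mapP.
exists [ffun s => inord (n s 0)]; first by rewrite mem_enum.
apply/matrixP => i j; rewrite (ord1 j) mxE ffunE inordK// ltnS -nN.
by rewrite (bigD1 (P := xpredT) i)//= leq_addr.
Qed.

Lemma mexp_supp h : mexp N h = \sum_(n <- V) h n * multinomial_pmf N p n.
Proof.
under eq_bigr do rewrite -mexp_indic -mexpZ.
rewrite -mexp_sum; apply: eq_mexp => n nN.
rewrite (bigD1_seq n)//= ?undup_uniq//; last exact: VP.
rewrite eqxx mulr1 big1 ?addr0// => m /negbTE; rewrite eq_sym => ->.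
by rewrite mulr0.
Qed.

(** Almost surely the counts lie in the finite list V, on which both sides are the same
    finite sum. *)
Lemma integral_counts h : (\int[P]_w (h (X w))%:E = (mexp N h)%:E)%E.
Proof.
pose B := [set n | n \in V].
have mX n : measurable (X @^-1` [set n]) by case: (X_law n).
pose g w : R := \sum_(n <- V) h n * \1_(X @^-1` [set n]) w.
have gE w : B (X w) -> g w = h (X w).
  move=> BX; rewrite /g (bigD1_seq (X w))//= ?undup_uniq//.
  rewrite indicE mem_set// mulr1 big1 ?addr0// => m mX'.
  by rewrite indicE memNset ?mulr0//= => e; rewrite e eqxx in mX'.
have ig n : P.-integrable setT (EFin \o (fun w => h n * \1_(X @^-1` [set n]) w)).
  rewrite (_ : _ \o _ = fun w => ((h n)%:E * (\1_(X @^-1` [set n]) w)%:E)%E)//.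
  by apply: integrableZl => //; exact: integrable_indic.
have Eg : (\int[P]_w (g w)%:E = (mexp N h)%:E)%E.
  under eq_integral do rewrite -sumEFin.
  rewrite integral_sum//; rewrite mexp_supp -sumEFin; apply: eq_bigr => n _.
  under eq_integral do rewrite EFinM.
  rewrite integralZl//; last exact: integrable_indic.
  rewrite integral_indic// setIT EFinM; congr (_ * _)%E.
  by case: (X_law n).
rewrite -Eg; apply: ae_eq_integral => //.
- exact/measurable_EFinP/measurable_fun_counts.
- apply/measurable_EFinP/measurable_sum => n.
  by apply: measurable_funM => //; exact: measurable_indic.
exists (X @^-1` (~` B)); split; first exact: measurable_counts.
  have <- : ((1 - P (X @^-1` B)) = 0)%E.
    suff -> : P (X @^-1` B) = 1%E by rewrite subee.
    have -> : X @^-1` B = \bigcup_(n in [set` V]) X @^-1` [set n].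
      by apply/seteqP; split => [w Bw|w [n nV /= ->]]//; exists (X w).
    rewrite measure_fin_bigcup; [|exact: finite_seq| |by []].
      rewrite -fsbig_seq ?undup_uniq// -(mexp_cst N 1) mexp_supp -sumEFin.
      by apply: eq_bigr => n _; rewrite mul1r; case: (X_law n).
    by move=> i j _ _ [w [/= <- <-]].
  by rewrite -probability_setC//; exact: measurable_counts.
move=> w /= H Bw; apply: H => _.
by rewrite /= gE.
Qed.

End law.
End multinomial.

(** * Trigonometric approximation and weak convergence *)

Section bernstein.
Variable R : realType.
Implicit Types (y : R) (h : nat -> R).

Definition bern (n : nat) y (j : nat) : R := y ^+ j * (1 - y) ^+ (n - j) *+ 'C(n, j).

Lemma bern_ge0 n y j : 0 <= y <= 1 -> 0 <= bern n y j.
Proof. by move=> /andP[y0 y1]; rewrite mulrn_wge0// mulr_ge0 ?exprn_ge0 ?subr_ge0. Qed.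

(** One more coin toss with success probability y; the first two moments of the binomial
    law are found by induction from this identity. *)
Lemma bern_succ n y h :
  \sum_(j < n.+2) bern n.+1 y j * h j =
  y * (\sum_(j < n.+1) bern n y j * h j.+1)
  + (1 - y) * \sum_(j < n.+1) bern n y j * h j.
Proof.
rewrite big_ord_recl [X in (1 - y) * X]big_ord_recl mulrDr !mulr_sumr /=.
rewrite addrCA; congr (_ + _).
  by rewrite /bern !bin0 !subn0 !expr0 exprS; ring.
transitivity (\sum_(i < n.+1) (y * (bern n y i * h i.+1) +
   (1 - y) * (y ^+ i.+1 * (1 - y) ^+ (n - i.+1) *+ 'C(n, i.+1) * h i.+1))).
  apply: eq_bigr => i _; rewrite /bump leq0n add1n /bern subSS binS mulrnDr !exprS.
  have [ni|ni] := leqP n i.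
    have -> : nat_of_ord i = n by apply/eqP; rewrite eqn_leq ni -ltnS ltn_ord.
    by rewrite bin_small// !mulr0n; ring.
  rewrite -(subnSK ni) exprS; ring.
rewrite big_split/=; congr (_ + _).
by rewrite big_ord_recr/= bin_small// mulr0n mul0r mulr0 addr0.
Qed.

Lemma bern_sum n y : \sum_(j < n.+1) bern n y j = 1.
Proof.
elim: n => [|n IH]; first by rewrite big_ord1 /bern !expr0 bin0; ring.
have := bern_succ n y (fun=> 1).
under eq_bigr do rewrite mulr1; move=> ->.
by under eq_bigr do rewrite mulr1; rewrite IH; ring.
Qed.

Lemma bern_mean n y : \sum_(j < n.+1) bern n y j * (j%:R - n%:R * y) = 0.
Proof.
elim: n => [|n IH]; first by rewrite big_ord1/= mul0r subr0 mulr0.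
rewrite (bern_succ n y (fun j => j%:R - n.+1%:R * y))/=.
under eq_bigr => j _.
  rewrite (_ : _ * _ = bern n y j * (j%:R - n%:R * y) + bern n y j * (1 - y)); last first.
    by rewrite -!natr1; ring.
  over.
under [X in _ + _ * X]eq_bigr => j _.
  rewrite (_ : _ * _ = bern n y j * (j%:R - n%:R * y) + bern n y j * (- y)); last first.
    by rewrite -!natr1; ring.
  over.
by rewrite !big_split/= IH -!mulr_suml bern_sum; ring.
Qed.

Lemma bern_var n y : \sum_(j < n.+1) bern n y j * (j%:R - n%:R * y) ^+ 2 = n%:R * (y * (1 - y)).
Proof.
elim: n => [|n IH]; first by rewrite big_ord1/= !mul0r subr0 expr0n mulr0.
rewrite (bern_succ n y (fun j => (j%:R - n.+1%:R * y) ^+ 2))/=.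
under eq_bigr => j _.
  rewrite (_ : _ * _ = bern n y j * (j%:R - n%:R * y) ^+ 2 +
     (bern n y j * (j%:R - n%:R * y) * (2 * (1 - y)) + bern n y j * (1 - y) ^+ 2)); last first.
    by rewrite -!natr1; ring.
  over.
under [X in _ + _ * X]eq_bigr => j _.
  rewrite (_ : _ * _ = bern n y j * (j%:R - n%:R * y) ^+ 2 +
     (bern n y j * (j%:R - n%:R * y) * (- 2 * y) + bern n y j * y ^+ 2)); last first.
    by rewrite -!natr1; ring.
  over.
by rewrite !big_split/= IH -!mulr_suml bern_sum bern_mean -natr1; ring.
Qed.

Lemma bern_dist n y : 0 <= y <= 1 -> (0 < n)%N ->
  \sum_(j < n.+1) bern n y j * (j%:R / n%:R - y) ^+ 2 <= n%:R^-1.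
Proof.
move=> /andP[y0 y1] n0; have n0' : n%:R != 0 :> R by rewrite pnatr_eq0 -lt0n.
rewrite (eq_bigr (fun j : 'I_n.+1 => bern n y j * (j%:R - n%:R * y) ^+ 2 * (n%:R^-1) ^+ 2)); last first.
  by move=> j _; field.
rewrite -mulr_suml bern_var (_ : _ * _ = y * (1 - y) * n%:R^-1); last by field.
by rewrite ler_piMl ?invr_ge0// mulr_ile1//; lra.
Qed.

End bernstein.

Section trig_poly.
Variables (R : realType) (k : nat).
Implicit Types (f g : 'rV[R]_k -> R) (x : 'rV[R]_k).

Inductive trig_poly : ('rV[R]_k -> R) -> Prop :=
| trig_cos (u : 'cV[R]_k) th : trig_poly (fun x => cos ((x *m u) 0 0 + th))
| trig_add f g : trig_poly f -> trig_poly g -> trig_poly (fun x => f x + g x)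
| trig_scale c f : trig_poly f -> trig_poly (fun x => c * f x).

Lemma trig_ext f g : f =1 g -> trig_poly f -> trig_poly g.
Proof. by move=> /funext ->. Qed.

Lemma trig_cst c : trig_poly (fun=> c).
Proof.
apply: (@trig_ext (fun x => c * cos ((x *m (0 : 'cV_k)) 0 0 + 0))).
  by move=> x; rewrite mulmx0 mxE addr0 cos0 mulr1.
exact/trig_scale/trig_cos.
Qed.

Lemma trig_mul f g : trig_poly f -> trig_poly g -> trig_poly (fun x => f x * g x).
Proof.
have H (u : 'cV[R]_k) th f0 : trig_poly f0 -> trig_poly (fun x => cos ((x *m u) 0 0 + th) * f0 x).
  elim=> {f0} [v th'|f1 f2 _ h1 _ h2|c f1 _ h1].
  - apply: (@trig_ext (fun x => 2^-1 * (cos ((x *m (u + v)) 0 0 + (th + th')) +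
                               cos ((x *m (u - v)) 0 0 + (th - th'))))).
      move=> x; rewrite mulmxBr mulmxDr !mxE.
      set a := \sum_j x 0 j * u j 0; set b := \sum_j x 0 j * v j 0.
      rewrite (_ : a + b + (th + th') = (a + th) + (b + th')); last by ring.
      rewrite (_ : a - b + (th - th') = (a + th) - (b + th')); last by ring.
      by rewrite cosB cosD; field.
    by apply/trig_scale/trig_add; exact: trig_cos.
  - by apply: trig_ext (trig_add h1 h2) => x; rewrite mulrDr.
  - by apply: trig_ext (trig_scale c h1) => x; rewrite mulrCA.
move=> + tg; elim=> {f} [u th|f1 f2 _ h1 _ h2|c f1 _ h1].
- exact: H.
- by apply: trig_ext (trig_add h1 h2) => x; rewrite mulrDl.
- by apply: trig_ext (trig_scale c h1) => x; rewrite mulrA.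
Qed.

Lemma trig_exp f n : trig_poly f -> trig_poly (fun x => f x ^+ n).
Proof.
move=> tf; elim: n => [|n IH]; first exact: trig_cst.
by apply: trig_ext (trig_mul tf IH) => x; rewrite exprS.
Qed.

Lemma trig_sum (I : finType) (F : I -> 'rV[R]_k -> R) :
  (forall i, trig_poly (F i)) -> trig_poly (fun x => \sum_i F i x).
Proof.
move=> tF; elim: (index_enum I) => [|i s IH].
  by apply: trig_ext (trig_cst 0) => x; rewrite big_nil.
by apply: trig_ext (trig_add (tF i) IH) => x; rewrite big_cons.
Qed.

Lemma trig_prod (I : finType) (F : I -> 'rV[R]_k -> R) :
  (forall i, trig_poly (F i)) -> trig_poly (fun x => \prod_i F i x).
Proof.
move=> tF; elim: (index_enum I) => [|i s IH].
  by apply: trig_ext (trig_cst 1) => x; rewrite big_nil.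
by apply: trig_ext (trig_mul (tF i) IH) => x; rewrite big_cons.
Qed.

Lemma trig_sin_coord i (b : R) : trig_poly (fun x => sin (x 0 i / b)).
Proof.
apply: trig_ext (trig_cos (b^-1 *: delta_mx i 0) (- (pi / 2))) => x.
rewrite cosBpihalf -scalemxAr mxE; congr sin.
rewrite mulrC; congr (_ * _).
by rewrite mxE (bigD1 i)//= big1 ?addr0 ?mxE ?eqxx ?mulr1// => j /negbTE ji; rewrite mxE ji mulr0.
Qed.

(** Heine's theorem on a cube, with only one of the two points in the cube. *)
Lemma unif_cont_cube f (A e : R) : continuous f -> 0 < e ->
  exists2 d : R, 0 < d & forall x y : 'rV[R]_k, (forall i, `|x 0 i| <= A) ->
    (forall i, `|x 0 i - y 0 i| < d) -> `|f x - f y| <= e.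
Proof.
move=> cf e0.
have cK : compact [set x : 'rV[R]_k | forall i, `[- A, A]%classic (x ord0 i)].
  by apply: (@rV_compact _ _ (fun=> `[- A, A]%classic)) => _; exact: segment_compact.
move/compact_near_coveringP : cK => /(_ R (0^'+) (fun (d : R) (x : 'rV[R]_k) => forall y : 'rV[R]_k,
  (forall i, `|x 0 i - y 0 i| < d) -> `|f x - f y| <= e)) H.
have {}H : \forall d \near 0^'+, [set x : 'rV[R]_k | forall i, `[- A, A]%classic (x ord0 i)] `<=`
    (fun x : 'rV[R]_k => forall y : 'rV[R]_k,
      (forall i, `|x 0 i - y 0 i| < d) -> `|f x - f y| <= e).
  apply: H => x _.
  have e2 : 0 < e / 2 by rewrite divr_gt0.
  have /cvgrPdist_lt /(_ _ e2) /nbhs_ballP [r /= r0 hr] := cf x.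
  have r2 : 0 < r / 2 by rewrite divr_gt0.
  exists (ball x (r / 2), [set d | d < r / 2]).
    by split=> /=; [exact: nbhsx_ballx|exact: nbhs_right_lt].
  move=> [z d]/= [xz dr] y zy.
  have fz : `|f x - f z| < e / 2.
    by apply: hr; apply: le_ball xz; rewrite ler_pdivrMr//; lra.
  have fy : `|f x - f y| < e / 2.
    apply: hr; rewrite (splitr r); apply: ball_triangle xz _.
    split=> // i j; rewrite (ord1 i).
    by apply: lt_trans dr; exact: zy.
  rewrite (_ : f z - f y = (f x - f y) - (f x - f z)); last by ring.
  by apply: le_trans (ler_normB _ _) _; rewrite (splitr e) lerD// ltW.
near (0 : R)^'+ => d; exists d => [|x y xA xy].
  by near: d; exact: nbhs_right_gt.
suff /(_ x _ y xy) : [set x : 'rV[R]_k | forall i, `[- A, A]%classic (x ord0 i)] `<=`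
    (fun x : 'rV[R]_k => forall y : 'rV[R]_k,
      (forall i, `|x 0 i - y 0 i| < d) -> `|f x - f y| <= e).
  by apply=> i /=; rewrite in_itv/= -ler_norml.
by near: d.
Unshelve. all: by end_near. Qed.

(** A quantitative form of the monotonicity of the sine between -pi/2 and pi/2: the
    difference of sines is twice a product of a sine and a cosine, and that cosine is at
    least that sine. *)
Lemma sin_sub_ge (a b : R) : - (pi / 2) <= b -> b <= a -> a <= pi / 2 ->
  2 * sin ((a - b) / 2) ^+ 2 <= sin a - sin b.
Proof.
move=> b1 ba a1.
pose u := (a - b) / 2; pose w := (a + b) / 2.
have -> : sin a = sin (w + u) by congr sin; rewrite /u /w; field.
have -> : sin b = sin (w - u) by congr sin; rewrite /u /w; field.
rewrite -/u sinD sinB.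
have u0 : 0 <= u by rewrite /u; lra.
have up : u <= pi / 2 by rewrite /u; lra.
have pi0 := pi_gt0 R.
have su : 0 <= sin u by apply: sin_ge0_pi; rewrite u0/=; lra.
have cw : sin u <= cos w.
  rewrite -cosBpihalf -cos_norm -(cos_norm w).
  have [h1 h2] : `|w| <= `|u - pi / 2| /\ `|u - pi / 2| <= pi.
    rewrite (ler0_norm (_ : u - pi / 2 <= 0)); last by lra.
    split; last by lra.
    by rewrite ler_norml /u /w; lra.
  rewrite leNgt ltr_cos ?in_itv/= ?normr_ge0//= ?(le_trans h1)//.
  by rewrite -leNgt.
have := ler_wpM2l su cw; lra.
Qed.

(* The weights of k independent binomial variables. *)
Section bernstein_vector.
Variables (n : nat) (y : 'I_k -> R).
Let W (J : {ffun 'I_k -> 'I_n.+1}) := \prod_i bern n (y i) (J i).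

Lemma bern_prod_sum : \sum_J W J = 1.
Proof.
rewrite -(bigA_distr_bigA (fun i (j : 'I_n.+1) => bern n (y i) j)).
by rewrite big1// => i _; exact: bern_sum.
Qed.

Lemma bern_prod_marg i (g : nat -> R) :
  \sum_J W J * g (J i) = \sum_(j < n.+1) bern n (y i) j * g j.
Proof.
pose F i' (j : 'I_n.+1) := bern n (y i') j * (if i' == i then g j else 1).
rewrite (eq_bigr (fun J : {ffun 'I_k -> 'I_n.+1} => \prod_i' F i' (J i'))); last first.
  move=> J _; rewrite big_split/=; congr (_ * _).
  rewrite (bigD1 i)//= eqxx big1 ?mulr1// => i' /negbTE ->.
  by [].
rewrite -bigA_distr_bigA (bigD1 i)//= [X in _ * X]big1 ?mulr1.
  by apply: eq_bigr => j _; rewrite /F eqxx.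
move=> i' /negbTE i'i; rewrite /F i'i.
by under eq_bigr do rewrite mulr1; exact: bern_sum.
Qed.

End bernstein_vector.

(** Multivariate Bernstein approximation in the variables (1 + sin (x_i / B)) / 2:
    they range over [0, 1] for every x, so the approximant keeps the bound M on
    the whole space, and they determine x on the cube of half-side B. *)
Lemma trig_approx f (M B e : R) : continuous f -> (forall x, `|f x| <= M) ->
  0 < B -> 0 < e ->
  exists Q, [/\ trig_poly Q, (forall x, `|Q x| <= M) &
    forall x, (forall i, `|x 0 i| <= B) -> `|f x - Q x| <= e].
Proof.
move=> cf fM B0 e0.
have M0 : 0 <= M by apply: le_trans (normr_ge0 _) (fM 0).
have pi2 : 2 <= pi :> R := pi_ge2 R.
have e2 : 0 < e / 2 by rewrite divr_gt0.
have [del del0 ucf] := unif_cont_cube (B * (pi / 2)) cf e2.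
pose d := Num.min (del / B) 1.
have d0 : 0 < d by rewrite lt_min divr_gt0//= ltr01.
have d1 : d <= 1 by rewrite ge_min lexx orbT.
pose eta := 2 * sin (d / 2) ^+ 2.
have sd : 0 < sin (d / 2) by apply: sin_gt0_pi; apply/andP; split; lra.
have eta0 : 0 < eta by rewrite mulr_gt0// exprn_gt0.
pose c := 2 * M / eta ^+ 2.
have c0 : 0 <= c by rewrite divr_ge0 ?sqr_ge0// mulr_ge0.
have gap (a b : R) : - (pi / 2) <= b -> a <= pi / 2 -> d <= a - b -> eta <= sin a - sin b.
  move=> b1 a1 dab; apply: le_trans (sin_sub_ge _ _ _) => //; last by lra.
  rewrite ler_pM2l// ler_sqr ?nnegrE ?(ltW sd)//; last first.
    by apply: sin_ge0_pi; apply/andP; split; lra.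
  by rewrite leNgt ltr_sin ?in_itv/= -?leNgt; [lra|apply/andP; split; lra|apply/andP; split; lra].
have key (x t : 'rV[R]_k) : (forall i, `|x 0 i| <= B * (pi / 2)) -> (forall i, `|t 0 i| <= B * (pi / 2)) ->
    `|f x - f t| <= e / 2 + c * \sum_i (sin (x 0 i / B) - sin (t 0 i / B)) ^+ 2.
  move=> xB tB.
  have [/forallP h|] := boolP [forall i, `|x 0 i - t 0 i| < del].
    apply: le_trans (ucf _ _ xB h) _; rewrite lerDl mulr_ge0// sumr_ge0// => i _.
    exact: sqr_ge0.
  rewrite negb_forall => /existsP[i]; rewrite -leNgt => hi.
  have fxt : `|f x - f t| <= 2 * M.
    by apply: le_trans (ler_normB _ _) _; have := fM x; have := fM t; lra.
  suff H : 2 * M <= c * \sum_i (sin (x 0 i / B) - sin (t 0 i / B)) ^+ 2 by lra.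
  have Hi : eta ^+ 2 <= (sin (x 0 i / B) - sin (t 0 i / B)) ^+ 2.
    rewrite -[leRHS]real_normK ?num_real// ler_sqr ?nnegrE ?(ltW eta0)//.
    have bnd (z : R) : `|z| <= B * (pi / 2) -> - (pi / 2) <= z / B <= pi / 2.
      by rewrite ler_norml mulrC -mulNr ler_pdivlMr// ler_pdivrMr//.
    have /andP[x1 x2] := bnd _ (xB i); have /andP[t1 t2] := bnd _ (tB i).
    have [xt|/ltW tx] := leP (t 0 i) (x 0 i).
      apply: le_trans (ler_norm _); apply: gap => //.
      rewrite ger0_norm ?subr_ge0// in hi.
      by rewrite -mulrBl ge_min ler_pM2r ?invr_gt0// hi.
    rewrite distrC; apply: le_trans (ler_norm _); apply: gap => //.
    rewrite distrC ger0_norm ?subr_ge0// in hi.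
    by rewrite -mulrBl ge_min ler_pM2r ?invr_gt0// hi.
  rewrite /c mulrAC ler_pdivlMr ?exprn_gt0//; apply: ler_wpM2l; first by lra.
  rewrite (bigD1 i)//=; apply: le_trans Hi _; rewrite lerDl sumr_ge0// => j _.
  exact: sqr_ge0.
have [n n0 hn] : exists2 n, (0 < n)%N & c * (k%:R * 4) / n%:R <= e / 2.
  have : \forall n \near \oo, (0 < n)%N /\ (c * (k%:R * 4) / (e / 2) <= n%:R :> R).
    by near=> n; split; near: n; [exact: nbhs_infty_gt|exact: nbhs_infty_ger].
  move=> /filter_ex[n [n0 hn]]; exists n => //.
  by rewrite ler_pdivrMr ?ltr0n// [leRHS]mulrC -ler_pdivrMr.
pose y (x : 'rV[R]_k) i := (1 + sin (x 0 i / B)) / 2.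
have y01 (x : 'rV[R]_k) i : 0 <= y x i <= 1.
  by have := sin_geN1 (x 0 i / B); have := sin_le1 (x 0 i / B); rewrite /y; lra.
pose z (j : nat) : R := 2 * (j%:R / n%:R) - 1.
have z11 (j : 'I_n.+1) : -1 <= z j <= 1.
  have jn : 0 <= (j%:R / n%:R : R) <= 1.
    apply/andP; split; first exact: divr_ge0.
    by rewrite ler_pdivrMr ?ltr0n// mul1r ler_nat -ltnS.
  rewrite /z; lra.
pose t (J : {ffun 'I_k -> 'I_n.+1}) : 'rV[R]_k := \row_i (B * asin (z (J i))).
pose W (x : 'rV[R]_k) (J : {ffun 'I_k -> 'I_n.+1}) := \prod_i bern n (y x i) (J i).
have W0 x J : 0 <= W x J by apply: prodr_ge0 => i _; exact: bern_ge0.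
have W1 x : \sum_J W x J = 1 by exact: bern_prod_sum.
exists (fun x => \sum_J f (t J) * W x J); split.
- apply: trig_sum => J; apply: trig_scale; apply: trig_prod => i.
  have ty : trig_poly (fun x => y x i).
    apply: trig_ext (trig_scale 2^-1 (trig_add (trig_cst 1) (trig_sin_coord i B))) => x.
    by rewrite mulrC.
  have ty' : trig_poly (fun x => 1 - y x i).
    by apply: trig_ext (trig_add (trig_cst 1) (trig_scale (-1) ty)) => x; rewrite mulN1r.
  apply: trig_ext (trig_scale 'C(n, J i)%:R (trig_mul (trig_exp (J i) ty)
    (trig_exp (n - J i) ty'))) => x.
  by rewrite /bern mulr_natl.
- move=> x; apply: le_trans (ler_norm_sum _ _ _) _.
  rewrite -[leRHS]mulr1 -(W1 x) mulr_sumr; apply: ler_sum => J _.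
  by rewrite normrM (ger0_norm (W0 _ _)) ler_wpM2r.
move=> x xB.
have -> : f x - \sum_J f (t J) * W x J = \sum_J W x J * (f x - f (t J)).
  under [RHS]eq_bigr do rewrite mulrBr (mulrC (W x _) (f (t _))).
  by rewrite sumrB -mulr_suml W1 mul1r.
apply: le_trans (ler_norm_sum _ _ _) _.
apply: (@le_trans _ _ (\sum_J W x J * (e / 2 + c * \sum_i 4 * ((J i)%:R / n%:R - y x i) ^+ 2))).
  apply: ler_sum => J _; rewrite normrM (ger0_norm (W0 _ _)) ler_wpM2l//.
  apply: le_trans (key _ _ _ _) _.
  - by move=> i; apply: le_trans (xB i) _; rewrite ler_peMr//; lra.
  - move=> i; rewrite mxE normrM (gtr0_norm B0) ler_pM2l// ler_norml.
    by rewrite asin_geNpi2// asin_lepi2.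
  rewrite lerD2l ler_wpM2l// ler_sum// => i _.
  rewrite mxE (mulrC B) mulfK ?gt_eqF// asinK ?in_itv//=.
  by rewrite /z /y le_eqVlt; apply/orP; left; apply/eqP; field; rewrite pnatr_eq0 -lt0n.
under eq_bigr do rewrite mulrDr (mulrCA _ c) mulr_sumr.
rewrite big_split/= -mulr_suml W1 mul1r -mulr_sumr exchange_big/=.
rewrite [leRHS]splitr lerD2l; apply: le_trans hn.
rewrite -mulrA ler_wpM2l//.
rewrite (_ : _ / n%:R = \sum_(i < k) 4 * n%:R^-1); last first.
  by rewrite sumr_const card_ord -[RHS]mulr_natl mulrA.
apply: ler_sum => i _.
under eq_bigr do rewrite mulrCA.
rewrite -mulr_sumr ler_pM2l// (@bern_prod_marg n (y x) i (fun j => (j%:R / n%:R - y x i) ^+ 2)).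
exact: bern_dist.
Unshelve. all: by end_near. Qed.

End trig_poly.

Section weak_convergence.
Variables (R : realType) (k : nat).
Implicit Types (x : 'rV[R]_k) (f g : 'rV[R]_k -> R) (E : ('rV[R]_k -> R) -> R).

Definition bdd_cont f := continuous f /\ exists M : R, forall x, `|f x| <= M.

(** The properties of integration against a probability measure that the
    approximation argument uses; both the laws of the estimators and the Gaussian
    limit enter through them only. *)
Record is_mean E : Prop := IsMean {
  mean1 : E (fun=> 1) = 1;
  meanD : forall f g, bdd_cont f -> bdd_cont g -> E (fun x => f x + g x) = E f + E g;
  meanZ : forall c f, bdd_cont f -> E (fun x => c * f x) = c * E f;
  le_mean : forall f g, bdd_cont f -> bdd_cont g -> (forall x, f x <= g x) -> E f <= E g
}.

(* a continuous substitute for the indicator of the complement of a cube *)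
Definition tail (B : R) (x : 'rV[R]_k) : R := \sum_i Num.min 1 ((x 0 i / B) ^+ 2).

Lemma bdd_contD f g : bdd_cont f -> bdd_cont g -> bdd_cont (fun x => f x + g x).
Proof.
move=> [cf [M fM]] [cg [M' gM]]; split; first by move=> x; exact: (ctsD (cf x) (cg x)).
by exists (M + M') => x; apply: le_trans (ler_normD _ _) _; exact: lerD.
Qed.

Lemma bdd_contZ c f : bdd_cont f -> bdd_cont (fun x => c * f x).
Proof.
move=> [cf [M fM]]; split; first by move=> x; exact: (ctsM (@cts_cst _ _ c x) (cf x)).
by exists (`|c| * M) => x; rewrite normrM ler_wpM2l.
Qed.

Lemma bdd_cont_cst c : bdd_cont (fun=> c).
Proof. by split; [move=> x; exact: cts_cst|exists `|c|]. Qed.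

Lemma continuous_lin (u : 'cV[R]_k) : continuous (fun x : 'rV[R]_k => (x *m u) 0 0).
Proof.
rewrite (_ : (fun y : 'rV[R]_k => (y *m u) 0 0) = fun y => \sum_j y 0 j * u j 0); last first.
  by apply/funext => y; rewrite mxE.
by move=> x; apply: cts_sum => j; apply: ctsM; [exact: coord_continuous|exact: cts_cst].
Qed.

Lemma trig_bdd_cont f : trig_poly f -> bdd_cont f.
Proof.
elim=> {f} [u th|f g _ hf _ hg|c f _ hf].
- split; last by exists 1 => x; exact: cos_max.
  move=> x; apply: (@cts_comp _ _ (fun x : 'rV[R]_k => (x *m u) 0 0 + th) cos); last exact: continuous_cos.
  by apply: ctsD; [exact: continuous_lin|exact: cts_cst].
- exact: bdd_contD.
- exact: bdd_contZ.
Qed.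

Lemma tail_ge0 B x : 0 <= tail B x.
Proof. by apply: sumr_ge0 => i _; rewrite le_min ler01 sqr_ge0. Qed.

Lemma tail_bdd_cont B : bdd_cont (tail B).
Proof.
split.
  move=> x; apply: cts_sum => i.
  apply: (@continuous_min R _ (fun=> 1) (fun x : 'rV[R]_k => (x 0 i / B) ^+ 2)).
    exact: cts_cst.
  by do 2 (apply: ctsM); do ? [exact: coord_continuous|exact: cts_cst|apply: ctsM].
exists k%:R => x; rewrite ger0_norm ?tail_ge0//.
have -> : k%:R = \sum_(i < k) 1 :> R by rewrite sumr_const card_ord.
by apply: ler_sum => i _; rewrite ge_min lexx.
Qed.

Lemma tail_ge1 (B : R) x i : 0 < B -> B < `|x 0 i| -> 1 <= tail B x.
Proof.
move=> B0 Bx; rewrite /tail (bigD1 i)//= ler_wpDr//.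
  by apply: sumr_ge0 => j _; rewrite le_min ler01 sqr_ge0.
rewrite le_min lexx/= -[leRHS]real_normK ?num_real// exprn_ege1//.
by rewrite normrM normfV (gtr0_norm B0) ler_pdivlMr// mul1r ltW.
Qed.

Lemma mean_cst E c : is_mean E -> E (fun=> c) = c.
Proof.
move=> mE; have := meanZ mE c (bdd_cont_cst 1); by rewrite (mean1 mE) mulr1.
Qed.

(** Outside the cube the two functions differ by at most 2 M, which tail B dominates. *)
Lemma mean_approx E f g (M B e : R) : is_mean E -> bdd_cont f -> bdd_cont g ->
  (forall x, `|f x| <= M) -> (forall x, `|g x| <= M) -> 0 < B -> 0 <= e ->
  (forall x, (forall i, `|x 0 i| <= B) -> `|f x - g x| <= e) ->
  `|E f - E g| <= e + 2 * M * E (tail B).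
Proof.
move=> mE bf bg fM gM B0 e0 fg.
have M0 : 0 <= M by apply: le_trans (normr_ge0 _) (fM 0).
have H x : `|f x - g x| <= e + 2 * M * tail B x.
  have [/forallP h|] := boolP [forall i, `|x 0 i| <= B].
    by apply: le_trans (fg _ h) _; rewrite lerDl !mulr_ge0 ?tail_ge0.
  rewrite negb_forall => /existsP[i]; rewrite -ltNge => /(tail_ge1 B0) t1.
  have : 2 * M <= 2 * M * tail B x by rewrite ler_peMr// mulr_ge0.
  have := ler_normB (f x) (g x); have := fM x; have := gM x; lra.
have bT := bdd_contD (bdd_cont_cst e) (bdd_contZ (2 * M) (tail_bdd_cont B)).
have ET : E (fun x => e + 2 * M * tail B x) = e + 2 * M * E (tail B).
  rewrite (meanD mE) ?mean_cst//; [|exact: bdd_cont_cst|exact/bdd_contZ/tail_bdd_cont].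
  by rewrite (meanZ mE)//; exact: tail_bdd_cont.
rewrite ler_norml; apply/andP; split.
  rewrite lerNl opprB lerBlDr -ET -(meanD mE)//; apply: (le_mean mE) => //.
    exact: bdd_contD.
  by move=> x; have := H x; rewrite ler_norml => /andP[]; lra.
rewrite lerBlDr -ET -(meanD mE)//; apply: (le_mean mE) => //.
  exact: bdd_contD.
by move=> x; have := H x; rewrite ler_norml => /andP[]; lra.
Qed.

(** Lévy's continuity theorem in the case where tightness is known beforehand:
    trigonometric polynomials approximate a bounded continuous function uniformly on
    a large cube, while respecting its bound outside. *)
Theorem cvg_mean_of_cos (E : nat -> ('rV[R]_k -> R) -> R) (E0 : ('rV[R]_k -> R) -> R) :
  (forall n, is_mean (E n)) -> is_mean E0 ->
  (forall (u : 'cV[R]_k) th, E n (fun x => cos ((x *m u) 0 0 + th)) @[n --> \oo]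
     --> E0 (fun x => cos ((x *m u) 0 0 + th))) ->
  (forall e : R, 0 < e -> exists B, [/\ 0 < B, E0 (tail B) <= e &
     \forall n \near \oo, E n (tail B) <= e]) ->
  forall f, bdd_cont f -> E n f @[n --> \oo] --> E0 f.
Proof.
move=> mE mE0 ccos tight f bf.
have ctrig Q : trig_poly Q -> E n Q @[n --> \oo] --> E0 Q.
  elim=> {Q} [u th|g h tg cg th ch|c g tg cg].
  - exact: ccos.
  - have [bg bh] := (trig_bdd_cont tg, trig_bdd_cont th).
    rewrite (meanD mE0)// (_ : (fun n => _) = fun n => E n g + E n h).
      exact: (cvgD cg ch).
    by apply/funext => n; rewrite (meanD (mE n)).
  - have bg := trig_bdd_cont tg.
    rewrite (meanZ mE0)// (_ : (fun n => _) = fun n => c * E n g).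
      exact: (cvgM (cvg_cst _) cg).
    by apply/funext => n; rewrite (meanZ (mE n)).
have [cf [M fM]] := bf.
have M0 : 0 <= M by apply: le_trans (normr_ge0 _) (fM 0).
apply/cvgrPdist_le => e e0.
have e5 : 0 < e / 5 by rewrite divr_gt0.
have [|B [B0 tB0 tB]] := tight (e / 5 / (2 * M + 1)); first by rewrite divr_gt0// ltr_wpDl// mulr_ge0.
have [Q [tQ QM fQ]] := trig_approx cf fM B0 e5.
have bQ := trig_bdd_cont tQ.
have M1 : 0 < 2 * M + 1 by rewrite ltr_wpDl// mulr_ge0.
have bnd (y : R) : y <= e / 5 / (2 * M + 1) -> 2 * M * y <= e / 5.
  move=> hy; apply: le_trans (ler_wpM2l (_ : 0 <= 2 * M) hy) _; first by rewrite mulr_ge0.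
  have : e / 5 / (2 * M + 1) * (2 * M + 1) = e / 5 by rewrite divfK// gt_eqF.
  have : 0 <= e / 5 / (2 * M + 1) by rewrite divr_ge0 ?ltW.
  set t := _ / (2 * M + 1); lra.
have := ctrig _ tQ; move/cvgrPdist_le => /(_ _ e5) hQ.
near=> n.
have h0 : `|E0 f - E0 Q| <= e / 5 + e / 5.
  apply: le_trans (mean_approx mE0 bf bQ fM QM B0 (ltW e5) fQ) _.
  by rewrite lerD2l bnd.
have h1 : `|E n f - E n Q| <= e / 5 + e / 5.
  apply: le_trans (mean_approx (mE n) bf bQ fM QM B0 (ltW e5) fQ) _.
  by rewrite lerD2l bnd//; near: n.
have h2 : `|E0 Q - E n Q| <= e / 5 by near: n.
rewrite (_ : _ - _ = (E0 f - E0 Q) + ((E0 Q - E n Q) - (E n f - E n Q))); last by ring.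
apply: le_trans (ler_normD _ _) _.
have := ler_normB (E0 Q - E n Q) (E n f - E n Q); lra.
Unshelve. all: by end_near. Qed.

End weak_convergence.

(** * Gaussian laws *)

Section affine.
Variable R : realType.
Local Notation mu := (@lebesgue_measure R).

Lemma lebesgue_measure_affine (b c : R) (A : set R) : b != 0 -> measurable A ->
  mu A = (`|b|%:E * mu ((fun x => b * x + c)%R @^-1` A))%E.
Proof.
move=> b0 mA.
have mphi : measurable_fun [set: R] (fun x : R => b * x + c : measurableTypeR R).
  by apply: measurable_funD => //; exact: measurable_funM.
pose nu := mscale (NngNum (normr_ge0 b)) (measure_function_pushforward__canonical__measure_function_Measure mu mphi).
suff H X : ocitv X -> mu X = nu X by exact: (lebesgue_measure_unique H mA).
move=> [[x y]] _ <-.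
rewrite /nu /mscale/= /pushforward/=.
have [bgt|blt|] := ltgtP 0 b; last by move=> e; rewrite -e eqxx in b0.
- have -> : (fun z : R => b * z + c) @^-1` `]x, y] = `](x - c) / b, (y - c) / b]%classic.
    apply/seteqP; split => z /=; rewrite !in_itv/= ltr_pdivrMr// ler_pdivlMr//
      (mulrC z) ltrBlDr lerBrDr//.
  rewrite !lebesgue_measure_itv/= !lte_fin ltr_pM2r ?invr_gt0// ltrD2r.
  case: ifP => _; last by rewrite mule0.
  by rewrite -!EFinB -EFinM gtr0_norm//; congr EFin; field.
- have -> : (fun z : R => b * z + c) @^-1` `]x, y] = `[(y - c) / b, (x - c) / b[%classic.
    apply/seteqP; split => z /=; rewrite !in_itv/= ler_ndivrMr// ltr_ndivlMr//
      (mulrC z) ltrBlDr lerBrDr// andbC//.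
  rewrite !lebesgue_measure_itv/= !lte_fin ltr_nM2r ?invr_lt0// ltrD2r.
  case: ifP => _; last by rewrite mule0.
  by rewrite -!EFinB -EFinM ltr0_norm//; congr EFin; field.
Qed.

Lemma ge0_integral_affine (b c : R) (f : R -> \bar R) : b != 0 ->
  measurable_fun setT f -> (forall x, 0 <= f x)%E ->
  (\int[mu]_x f x = `|b|%:E * \int[mu]_x f (b * x + c)%R)%E.
Proof.
move=> b0 mf f0.
have mphi : measurable_fun [set: R] (fun x : R => b * x + c : measurableTypeR R).
  by apply: measurable_funD => //; exact: measurable_funM.
pose nu := mscale (NngNum (normr_ge0 b)) (measure_function_pushforward__canonical__measure_function_Measure mu mphi).
rewrite (eq_measure_integral nu); last by move=> A mA _; exact: lebesgue_measure_affine.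
rewrite ge0_integral_mscale//=; congr (_ * _)%E.
by rewrite ge0_integral_pushforward.
Qed.

(** The Radon-Nikodym derivative of the normal law is its density almost everywhere. *)
Lemma integral_normal_prob (m s : R) (f : R -> \bar R) :
  measurable_fun setT f -> (forall x, 0 <= f x)%E ->
  (\int[normal_prob m s]_x f x = \int[mu]_x (f x * (normal_pdf m s x)%:E))%E.
Proof.
move=> mf f0.
have dom := normal_prob_dominates m s.
pose g := Radon_Nikodym_SigmaFinite.f (normal_prob m s) mu.
rewrite -(@Radon_Nikodym_SigmaFinite.change_of_variables _ _ _ _ mu dom f)//.
have mg : measurable_fun setT g.
  exact: measurable_int (Radon_Nikodym_SigmaFinite.f_integrable dom).
have mh : measurable_fun setT (fun x => (normal_pdf m s x)%:E).
  by apply/measurable_EFinP; exact: measurable_normal_pdf.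
apply: ae_eq_integral => //; [exact: emeasurable_funM..|].
apply: ae_eqe_mul2l; apply: integral_ae_eq => //.
  exact: (Radon_Nikodym_SigmaFinite.f_integrable dom).
by move=> A _ mA; rewrite -Radon_Nikodym_SigmaFinite.f_integral.
Qed.

Lemma normal_pdf_affine (s b c x : R) : 0 < s -> b != 0 ->
  normal_pdf 0 s x = `|b| * normal_pdf c (`|b| * s) (b * x + c).
Proof.
move=> s0 b0; have nb : 0 < `|b| by rewrite normr_gt0.
rewrite !normal_pdfE ?gt_eqF// ?mulr_gt0// mulrA; congr (_ * _).
  rewrite /normal_peak.
  have -> : (`|b| * s) ^+ 2 * pi *+ 2 = `|b| ^+ 2 * (s ^+ 2 * pi *+ 2) by ring.
  rewrite sqrtrM ?sqr_ge0// sqrtr_sqr normr_id.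
  by rewrite invfM mulrA divff ?mul1r ?gt_eqF.
rewrite /normal_fun; congr expR.
rewrite subr0 addrK !exprMn real_normK ?num_real//.
by field; rewrite b0 gt_eqF.
Qed.

Lemma normal_prob_affine (s b c : R) (A : set R) : 0 < s -> b != 0 -> measurable A ->
  normal_prob 0 s ((fun x => b * x + c) @^-1` A) = normal_prob c (`|b| * s) A.
Proof.
move=> s0 b0 mA; have nb : 0 < `|b| by rewrite normr_gt0.
have mphi : measurable_fun [set: R] (fun x : R => b * x + c).
  by apply: measurable_funD => //; exact: measurable_funM.
have mh : measurable_fun setT (fun x => (normal_pdf c (`|b| * s) x)%:E).
  by apply/measurable_EFinP; exact: measurable_normal_pdf.
have mhA : measurable_fun setT ((fun x => (normal_pdf c (`|b| * s) x)%:E) \_ A).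
  by apply/(measurable_restrictT _ mA); exact: measurable_funTS.
rewrite /normal_prob [RHS]integral_mkcond [LHS]integral_mkcond.
rewrite [RHS](ge0_integral_affine c b0); first last.
- by move=> x; rewrite patchE; case: ifP => // _; rewrite lee_fin normal_pdf_ge0.
- exact: mhA.
rewrite -ge0_integralZl//; first last.
- by move=> x _; rewrite patchE; case: ifP => // _; rewrite lee_fin normal_pdf_ge0.
- exact: (measurableT_comp mhA mphi).
apply: eq_integral => x _; rewrite !patchE.
have -> : (x \in (fun x : R => b * x + c) @^-1` A) = (b * x + c \in A).
  by apply/idP/idP; rewrite !inE.
by case: ifP => _; rewrite ?mule0// (normal_pdf_affine c x s0 b0) EFinM.
Qed.

End affine.

Section gauss_law.
Variable R : realType.
Local Notation mu := (@lebesgue_measure R).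
Implicit Types (v w : R) (A : set R).

(** The centred Gaussian law of variance v; for v = 0 the normal law of standard deviation 0
    would not be the point mass. *)
Definition gauss_law v : probability (measurableTypeR R) R :=
  if v == 0 then (\d_(0 : measurableTypeR R) : probability _ R) else normal_prob 0 (Num.sqrt v).

Lemma gauss_law0 : gauss_law 0 = (\d_(0 : measurableTypeR R) : probability _ R).
Proof. by rewrite /gauss_law eqxx. Qed.

Lemma gauss_law_gt0 v : 0 < v -> gauss_law v = normal_prob 0 (Num.sqrt v).
Proof. by move=> v0; rewrite /gauss_law gt_eqF. Qed.

Lemma gauss_law_scale v b A : 0 <= v -> measurable A ->
  gauss_law v ((fun x => b * x) @^-1` A) = gauss_law (b ^+ 2 * v) A.
Proof.
move=> v0 mA; have [->|b0] := eqVneq b 0.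
  rewrite expr0n/= mul0r gauss_law0/= diracE.
  have [A0|A0] := pselect (A 0).
    rewrite (_ : _ @^-1` A = setT) ?probability_setT ?mem_set//.
    by apply/seteqP; split => x //=; rewrite mul0r.
  rewrite (_ : _ @^-1` A = set0) ?measure0 ?memNset//.
  by apply/seteqP; split => x //=; rewrite mul0r.
move: v0; rewrite le_eqVlt => /predU1P[<-|v0].
  rewrite mulr0 gauss_law0/= !diracE; congr (_%:R%:E); congr nat_of_bool.
  by apply/idP/idP; rewrite !inE/= mulr0.
have bv0 : 0 < b ^+ 2 * v by rewrite mulr_gt0// exprn_even_gt0.
rewrite (gauss_law_gt0 v0) (gauss_law_gt0 bv0) /= sqrtrM ?sqr_ge0// sqrtr_sqr.
rewrite -(normal_prob_affine 0 _ b0 mA) ?sqrtr_gt0//.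
by congr (normal_prob _ _ _); apply/seteqP; split => x /=; rewrite addr0.
Qed.

Lemma measurable_add_preimage (d : measure_display) (T : measurableType d) (f : T -> R) A :
  measurable_fun setT f -> measurable A ->
  measurable [set z : T * measurableTypeR R | A (f z.1 + z.2)].
Proof.
move=> mf mA.
have m : measurable_fun setT (fun z : T * measurableTypeR R => f z.1 + z.2 : R).
  by apply: measurable_funD => //; exact: measurableT_comp.
by rewrite -[X in measurable X]setTI; exact: m.
Qed.

(** After Fubini's theorem the convolution of the two densities is computed by completing
    the square: the product of the densities is the density of the sum times a density
    in the integrated variable (pdfE), which integrates to 1. *)
Lemma gauss_law_conv v w A : 0 <= v -> 0 <= w -> measurable A ->
  (gauss_law v \x gauss_law w)%E [set z : R * R | A (z.1 + z.2)] = gauss_law (v + w) A.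
Proof.
move=> v0 w0 mA.
have mA2 := measurable_add_preimage (@measurable_id _ _ setT) mA.
rewrite /product_measure1/=.
have secE (x : R) : xsection [set z : R * R | A (z.1 + z.2)] x = (fun y => 1 * y + x) @^-1` A.
  by apply/seteqP; split => y; rewrite /xsection/= inE/= mul1r addrC.
move: v0; rewrite le_eqVlt => /predU1P[<-|v0].
  rewrite gauss_law0 add0r integral_dirac//=; last first.
    exact: (measurable_fun_xsection (gauss_law w) mA2).
  rewrite diracT mul1e secE; congr (gauss_law w _).
  by apply/seteqP; split => y /=; rewrite mul1r addr0.
move: w0; rewrite le_eqVlt => /predU1P[<-|w0].
  rewrite gauss_law0 addr0.
  transitivity (\int[gauss_law v]_x (\1_A x)%:E)%E; last by rewrite integral_indic// setIT.
  apply: eq_integral => x _; rewrite /= secE diracE indicE.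
  by congr (_%:R%:E); congr nat_of_bool; apply/idP/idP; rewrite !inE/= mulr0 add0r.
have vw0 := addr_gt0 v0 w0.
rewrite (gauss_law_gt0 v0) (gauss_law_gt0 w0) (gauss_law_gt0 vw0)/=.
set s := Num.sqrt v; set t := Num.sqrt w; set u := Num.sqrt (v + w).
have s0 : 0 < s by rewrite sqrtr_gt0.
have t0 : 0 < t by rewrite sqrtr_gt0.
have u0 : 0 < u by rewrite sqrtr_gt0.
have s2 : s ^+ 2 = v by rewrite sqr_sqrtr// ltW.
have t2 : t ^+ 2 = w by rewrite sqr_sqrtr// ltW.
have u2 : u ^+ 2 = v + w by rewrite sqr_sqrtr// ltW.
clearbody s t u.
have stepE (x : R) : normal_prob 0 t (xsection [set z : R * R | A (z.1 + z.2)] x) =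
    normal_prob x t A.
  have := normal_prob_affine x t0 (oner_neq0 R) mA.
  by rewrite normr1 mul1r -secE.
have pdfE (x z : R) : normal_pdf x t z * normal_pdf 0 s x =
    normal_pdf 0 u z * normal_pdf (z * (v / (v + w))) (s * t / u) x.
  rewrite !normal_pdfE ?gt_eqF ?divr_gt0 ?mulr_gt0//.
  rewrite mulrACA [RHS]mulrACA; congr (_ * _).
    rewrite /normal_peak -!invfM -!sqrtrM ?sqr_ge0//; last 2 first.
    - by rewrite mulrn_wge0// mulr_ge0 ?sqr_ge0 ?pi_ge0.
    - by rewrite mulrn_wge0// mulr_ge0 ?sqr_ge0 ?pi_ge0.
    by congr (Num.sqrt _)^-1; field; rewrite gt_eqF.
  rewrite /normal_fun -!expRD; congr expR.
  rewrite !subr0 exprMn exprVn exprMn u2 t2 s2; field.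
  by rewrite !gt_eqF.
have mpdf (m q : R) : measurable_fun setT (fun x => (normal_pdf m q x)%:E).
  by apply/measurable_EFinP; exact: measurable_normal_pdf.
have pdf0 (m q x : R) : (0 <= (normal_pdf m q x)%:E)%E by rewrite lee_fin normal_pdf_ge0.
under eq_integral do rewrite /= stepE.
pose f (z : measurableTypeR R * measurableTypeR R) : \bar R :=
  (normal_pdf z.1 t z.2 * \1_A z.2)%:E.
have mf : measurable_fun setT f.
  apply/measurable_EFinP; rewrite /normal_pdf gt_eqF//.
  apply: measurable_funM; last by apply: measurableT_comp => //; exact: measurable_indic.
  apply: measurable_funM => //; rewrite /normal_fun.
  apply: measurableT_comp => //.
  apply: measurable_funM => //; apply: measurableT_comp => //.
  by apply: measurable_funX; apply: measurable_funB.
have f0 z : (0 <= f z)%E by rewrite lee_fin mulr_ge0// normal_pdf_ge0.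
have npE (m q : R) : normal_prob m q A = (\int[mu]_y (normal_pdf m q y * \1_A y)%:E)%E.
  rewrite /normal_prob integral_mkcond; apply: eq_integral => y _.
  by rewrite patchE indicE; case: ifP => _; rewrite ?mulr1 ?mulr0.
have mF : measurable_fun setT (fun x => normal_prob x t A).
  rewrite (_ : (fun x => _) = fubini_F mu f).
    exact: (measurable_fun_fubini_tonelli_F f mf f0).
  by apply/funext => x; rewrite npE.
rewrite integral_normal_prob//.
transitivity (\int[mu]_x \int[mu]_y (f (x, y) * (normal_pdf 0 s x)%:E))%E.
  apply: eq_integral => x _; rewrite ge0_integralZr//; last exact: (measurableT_comp mf).
  by rewrite npE.
rewrite (@fubini_tonelli _ _ _ _ R mu mu (fun z => f z * (normal_pdf 0 s z.1)%:E)%E).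
- rewrite npE; apply: eq_integral => y _.
  under eq_integral => x _.
    rewrite /f/= -EFinM mulrAC pdfE mulrAC EFinM; over.
  rewrite ge0_integralZl//; [|exact: mpdf|].
    by rewrite integral_normal_pdf mule1.
  by rewrite lee_fin mulr_ge0// normal_pdf_ge0.
- by apply: emeasurable_funM => //; apply: (measurableT_comp (mpdf 0 s)).
- by move=> z; rewrite mule_ge0.
Qed.

End gauss_law.

Section gauss_fourier.
Variable R : realType.
Local Notation mu := (@lebesgue_measure R).
Implicit Types (v w : R) (A : set R).

Lemma integrable_bounded (d : measure_display) (T : measurableType d)
    (P : {measure set T -> \bar R}) (f : T -> R) (M : R) :
  (P setT < +oo)%E -> measurable_fun setT f -> (forall x, `|f x| <= M) ->
  P.-integrable setT (EFin \o f).
Proof.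
move=> Poo mf fM; apply: measurable_bounded_integrable => //.
exists M; split; first exact: num_real.
by move=> N MN x _; apply: le_trans (fM x) (ltW MN).
Qed.

Lemma integral_image (d1 d2 : measure_display) (T1 : measurableType d1)
    (T2 : measurableType d2) (P : {measure set T1 -> \bar R}) (Q : {measure set T2 -> \bar R})
    (phi : T1 -> T2) (f : T2 -> R) : measurable_fun setT phi ->
  (forall B : set T2, measurable B -> Q B = P (phi @^-1` B)) -> measurable_fun setT f ->
  P.-integrable setT (EFin \o (f \o phi)) ->
  (\int[Q]_y (f y)%:E = \int[P]_x (f (phi x))%:E)%E.
Proof.
move=> mphi QE mf iff.
rewrite (eq_measure_integral (measure_function_pushforward__canonical__measure_function_Measure P mphi)); last first.
  by move=> B mB _; exact: QE.
by rewrite (@integral_pushforward _ _ _ _ _ _ mphi P setT (EFin \o f))//; exact/measurable_EFinP.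
Qed.

Lemma Rintegral_prob_cst (d : measure_display) (T : measurableType d)
  (P : probability T R) (c : R) : \int[P]_x c = c.
Proof.
have pT : (P : {measure set T -> \bar R}) setT = 1%E by exact: probability_setT.
by rewrite Rintegral_cst// pT mulr1.
Qed.

Lemma prob_lty (d : measure_display) (T : measurableType d) (P : probability T R) :
  (P setT < +oo)%E.
Proof. by rewrite probability_setT ltry. Qed.

Lemma integrable_gauss_cos v : (gauss_law v).-integrable setT (EFin \o cos).
Proof.
apply: (@integrable_bounded _ _ _ _ 1) => [||x]; [exact: prob_lty| |exact: cos_max].
by apply: continuous_measurable_fun; exact: continuous_cos.
Qed.

Lemma integrable_gauss_sin v : (gauss_law v).-integrable setT (EFin \o sin).
Proof.
apply: (@integrable_bounded _ _ _ _ 1) => [||x]; [exact: prob_lty| |exact: sin_max].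
by apply: continuous_measurable_fun; exact: continuous_sin.
Qed.

Section integrable_real.
Variables (d : measure_display) (T : measurableType d) (P : {measure set T -> \bar R}).
Implicit Types f g : T -> R.

Lemma integrable_addr f g : P.-integrable setT (EFin \o f) ->
  P.-integrable setT (EFin \o g) -> P.-integrable setT (EFin \o (fun x => f x + g x)).
Proof. by move=> hf hg; exact: (integrableD measurableT hf hg). Qed.

Lemma integrable_subr f g : P.-integrable setT (EFin \o f) ->
  P.-integrable setT (EFin \o g) -> P.-integrable setT (EFin \o (fun x => f x - g x)).
Proof. by move=> hf hg; exact: (integrableB measurableT hf hg). Qed.

Lemma integrable_mulr c f : P.-integrable setT (EFin \o f) ->
  P.-integrable setT (EFin \o (fun x => c * f x)).
Proof. by move=> hf; exact: (integrableZl measurableT c hf). Qed.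

Lemma integrable_normr f : P.-integrable setT (EFin \o f) ->
  P.-integrable setT (EFin \o (fun x => `|f x|)).
Proof. by move=> hf; exact: (integrable_abse hf). Qed.

End integrable_real.

Lemma integral_gauss_expR v t : 0 <= v ->
  (\int[gauss_law v]_x (expR (t * x))%:E = (expR (t ^+ 2 * v / 2))%:E)%E.
Proof.
move=> v0; have mexp : measurable_fun setT (fun x : R => (expR (t * x))%:E).
  by apply/measurable_EFinP; apply: measurableT_comp => //; exact: measurable_funM.
have exp0 (x : R) : (0 <= (expR (t * x))%:E)%E by rewrite lee_fin expR_ge0.
move: v0; rewrite le_eqVlt => /predU1P[<-|v0].
  by rewrite gauss_law0 integral_dirac//= diracT mul1e !mulr0 mul0r.
rewrite gauss_law_gt0// integral_normal_prob//.
have s0 : 0 < Num.sqrt v by rewrite sqrtr_gt0.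
have s2 : Num.sqrt v ^+ 2 = v by rewrite sqr_sqrtr// ltW.
have pdfE (x : R) : expR (t * x) * normal_pdf 0 (Num.sqrt v) x =
    expR (t ^+ 2 * v / 2) * normal_pdf (t * v) (Num.sqrt v) x.
  rewrite !normal_pdfE ?gt_eqF// mulrCA [RHS]mulrCA; congr (_ * _).
  rewrite /normal_fun -!expRD; congr expR; rewrite s2; field.
  by rewrite gt_eqF.
under eq_integral do rewrite -EFinM pdfE EFinM.
rewrite ge0_integralZl//.
- by rewrite integral_normal_pdf mule1.
- by apply/measurable_EFinP; exact: measurable_normal_pdf.
- by move=> x _; rewrite lee_fin normal_pdf_ge0.
Qed.

Lemma integrable_gauss_expR v t : 0 <= v ->
  (gauss_law v).-integrable setT (EFin \o (fun x => expR (t * x))).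
Proof.
move=> v0; apply/integrableP; split.
  by apply/measurable_EFinP; apply: measurableT_comp => //; exact: measurable_funM.
under eq_integral do rewrite /= ger0_norm ?expR_ge0//.
by rewrite integral_gauss_expR// ltry.
Qed.

Lemma integrable_gauss_cosh v t : 0 <= v ->
  (gauss_law v).-integrable setT (EFin \o (fun x => cosh (t * x))).
Proof.
move=> v0.
rewrite (_ : (fun x => _) = fun x => 2^-1 * (expR (t * x) + expR (- t * x))).
  by apply/integrable_mulr/integrable_addr; exact: integrable_gauss_expR.
by apply/funext => x; rewrite /cosh mulrC mulNr.
Qed.

(* The moment generating function at t and - t. *)
Lemma gauss_cosh v t : 0 <= v ->
  \int[gauss_law v]_x cosh (t * x) = expR (t ^+ 2 * v / 2).
Proof.
move=> v0; rewrite /cosh.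
have i1 := integrable_gauss_expR t v0; have i2 := integrable_gauss_expR (- t) v0.
under eq_Rintegral do rewrite -mulNr.
rewrite RintegralZr//; last exact: integrable_addr.
rewrite RintegralD// /Rintegral !integral_gauss_expR//= sqrrN; lra.
Qed.

(* The law is symmetric. *)
Lemma gauss_sin v : 0 <= v -> \int[gauss_law v]_x sin x = 0.
Proof.
move=> v0.
have msinr : measurable_fun setT (@sin R).
  by apply: continuous_measurable_fun; exact: continuous_sin.
have msin : measurable_fun setT (fun x : R => (sin x)%:E) by exact/measurable_EFinP.
have ms : measurable_fun setT (fun x : R => - 1 * x : measurableTypeR R).
  exact: measurable_funM.
have isin := integrable_gauss_sin v.
have isinN : (gauss_law v).-integrable setT (EFin \o (fun x => sin (-1 * x))).
  apply: (@integrable_bounded _ _ _ _ 1) => [||x];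
    [exact: prob_lty| |exact: sin_max].
  exact: (measurableT_comp msinr ms).
have H : \int[gauss_law v]_x sin x = \int[gauss_law v]_x sin (-1 * x).
  rewrite /Rintegral; congr fine; apply: (@integral_image _ _ _ _ (gauss_law v) (gauss_law v) _ sin ms) => // A mA.
  by have := gauss_law_scale (-1) v0 mA; rewrite sqrrN expr1n mul1r.
have : \int[gauss_law v]_x sin (-1 * x) = - \int[gauss_law v]_x sin x.
  under eq_Rintegral do rewrite mulN1r sinN -mulN1r.
  by rewrite RintegralZl// mulN1r.
by rewrite -H; lra.
Qed.

Let C v := \int[gauss_law v]_x cos x.

Let integrable_cos (d : measure_display) (T : measurableType d)
    (P : {measure set T -> \bar R}) (f : T -> R) :
  (P setT < +oo)%E -> measurable_fun setT f -> P.-integrable setT (EFin \o (cos \o f)).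
Proof.
move=> Poo mf; apply: (@integrable_bounded _ _ _ _ 1) => // [|x]; last exact: cos_max.
apply: measurableT_comp mf; apply: continuous_measurable_fun; exact: continuous_cos.
Qed.

Section product.
Variables P1 P2 : probability (measurableTypeR R) R.

Let Q := (P1 \x P2)%E.

Let Q_lty : (Q setT < +oo)%E.
Proof.
have pT (P : probability (measurableTypeR R) R) :
  (P : {measure set (measurableTypeR R) -> \bar R}) setT = 1%E by exact: probability_setT.
by rewrite -setXTT /Q product_measure1E// !pT mule1 ltry.
Qed.

Let measurable_add : measurable_fun setT
  (fun z : measurableTypeR R * measurableTypeR R => z.1 + z.2 : measurableTypeR R).
Proof. exact: measurable_funD. Qed.

Lemma integral_cos_add : \int[P2]_y sin y = 0 ->
  (\int[Q]_z (cos (z.1 + z.2))%:E = ((\int[P1]_x cos x) * (\int[P2]_y cos y))%:E)%E.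
Proof.
move=> sin0.
have icos (P : probability (measurableTypeR R) R) : P.-integrable setT (EFin \o cos).
  apply: (@integrable_bounded _ _ _ _ 1) => [||x]; [exact: prob_lty| |exact: cos_max].
  by apply: continuous_measurable_fun; exact: continuous_cos.
have isin (P : probability (measurableTypeR R) R) : P.-integrable setT (EFin \o sin).
  apply: (@integrable_bounded _ _ _ _ 1) => [||x]; [exact: prob_lty| |exact: sin_max].
  by apply: continuous_measurable_fun; exact: continuous_sin.
set c := \int[P2]_y cos y.
have icc : P1.-integrable setT (EFin \o (fun x => cos x * c)).
  rewrite (_ : (fun x => _) = fun x => c * cos x); first exact: (integrable_mulr _ (icos P1)).
  by apply/funext => x; rewrite mulrC.
rewrite -(integral12_prod_meas1 (integrable_cos Q_lty measurable_add)).
rewrite -(RintegralZr _ measurableT (icos P1)) /Rintegral.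
rewrite (fineK (integrable_fin_num measurableT icc)).
apply: eq_integral => x _; rewrite /fubini_F/=.
have ix : P2.-integrable setT (EFin \o (fun y => cos (x + y))).
  apply: integrable_cos; first exact: prob_lty.
  exact: measurable_funD.
rewrite -(fineK (integrable_fin_num measurableT ix)).
congr EFin; transitivity (\int[P2]_y (cos x * cos y + (- sin x) * sin y)).
  by apply: eq_Rintegral => y _; rewrite cosD mulNr.
rewrite RintegralD//; [|exact: (integrable_mulr _ (icos P2))|exact: (integrable_mulr _ (isin P2))].
by rewrite (RintegralZl _ measurableT (icos P2)) (RintegralZl _ measurableT (isin P2)) sin0 mulr0 addr0.
Qed.

(** By the angle-addition formula, the mean of the cosine is multiplicative under
    convolution as soon as the sine has mean 0 under one of the laws. *)
Lemma integral_cos_conv (P : probability (measurableTypeR R) R) :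
  (forall A, measurable A -> P A = Q [set z | A (z.1 + z.2)]) ->
  \int[P2]_y sin y = 0 ->
  \int[P]_x cos x = (\int[P1]_x cos x) * (\int[P2]_y cos y).
Proof.
move=> PQ sin0; rewrite [LHS]/Rintegral.
rewrite (@integral_image _ _ _ _ Q P _ cos measurable_add PQ).
- by rewrite integral_cos_add.
- by apply: continuous_measurable_fun; exact: continuous_cos.
- exact: integrable_cos.
Qed.

End product.

Lemma gauss_cos_conv v w : 0 <= v -> 0 <= w -> C (v + w) = C v * C w.
Proof.
move=> v0 w0; apply: integral_cos_conv; last exact: gauss_sin.
by move=> A mA; have := gauss_law_conv v0 w0 mA.
Qed.

Lemma gauss_cos_pow v n : 0 <= v -> C (n%:R * v) = C v ^+ n.
Proof.
move=> v0; elim: n => [|n IH].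
  have mcos : measurable_fun setT (fun x : measurableTypeR R => (cos x)%:E).
    by apply/measurable_EFinP; apply: continuous_measurable_fun; exact: continuous_cos.
  by rewrite mul0r expr0 /C gauss_law0 /Rintegral integral_dirac// diracT mul1e/= cos0.
by rewrite -natr1 mulrDl mul1r gauss_cos_conv// ?mulr_ge0// IH exprSr.
Qed.

Lemma gauss_cos_norm v : `|C v| <= 1.
Proof.
have ic := integrable_gauss_cos v.
apply: le_trans (le_normr_Rintegral measurableT ic) _.
rewrite -[leRHS](Rintegral_prob_cst (gauss_law v)).
apply: le_Rintegral => //.
- exact: integrable_normr.
- by apply: (@integrable_bounded _ _ _ _ 1) => [|//|x]; [exact: prob_lty|rewrite normr1].
- by move=> x _; exact: cos_max.
Qed.

(** The error in replacing the cosine by 2 - cosh is a fourth moment, hence of order v^2.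
    With l = 1 / sqrt v, the fourth power is controlled by x^4 <= 24 v^2 cosh (l x). *)
Lemma gauss_cos_small v : 0 < v <= 1 ->
  `|C v - (2 - expR (v / 2))| <= 2 * expR 2 * v ^+ 2.
Proof.
move=> /andP[v0 v1]; pose s := Num.sqrt v; pose l := s^-1.
have s0 : 0 < s by rewrite sqrtr_gt0.
have s1 : s <= 1 by rewrite -sqrtr1 ler_sqrt.
have s2 : s ^+ 2 = v by rewrite sqr_sqrtr// ltW.
have vge := ltW v0.
have ic := integrable_gauss_cos v.
have ih : (gauss_law v).-integrable setT (EFin \o (fun x => cosh (1 * x))).
  exact: integrable_gauss_cosh.
have i2 : (gauss_law v).-integrable setT (EFin \o (fun=> 2)).
  by apply: (@integrable_bounded _ _ _ _ 2) => [|//|x]; [exact: prob_lty|rewrite ger0_norm].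
have E1 : C v - (2 - expR (v / 2)) = \int[gauss_law v]_x (cos x + cosh (1 * x) - 2).
  rewrite RintegralB//; last exact: integrable_addr.
  rewrite RintegralD// gauss_cosh// Rintegral_prob_cst expr1n mul1r /C.
  by ring.
have hB (x : R) : `|cos x + cosh (1 * x) - 2| <= v ^+ 2 * cosh ((l + 1) * x) + v ^+ 2 * cosh ((l - 1) * x).
  rewrite mul1r; apply: le_trans (cos_cosh_err x) _.
  have x4 : x ^+ 4 <= 24 * v ^+ 2 * cosh (l * x).
    have h := cosh_ge_quart (l * x).
    have h2 : (l * x) ^+ 4 <= 24 * cosh (l * x).
      have := sqr_ge0 (l * x); lra.
    have -> : x ^+ 4 = v ^+ 2 * (l * x) ^+ 4.
      rewrite -s2 /l; field; exact: lt0r_neq0.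
    rewrite (_ : 24 * _ * _ = v ^+ 2 * (24 * cosh (l * x))); last by ring.
    by apply: ler_wpM2l => //; exact: sqr_ge0.
  apply: (@le_trans _ _ (24 * v ^+ 2 * cosh (l * x) / 12 * cosh x)).
    by apply: ler_wpM2r; [rewrite ltW// cosh_gt0|rewrite ler_pM2r].
  rewrite -mulrDr (_ : cosh ((l + 1) * x) + cosh ((l - 1) * x) = 2 * cosh (l * x) * cosh x).
    by rewrite le_eqVlt; apply/orP; left; apply/eqP; field.
  rewrite (_ : (l + 1) * x = l * x + x); last by ring.
  rewrite (_ : (l - 1) * x = l * x - x); last by ring.
  by rewrite /cosh opprD opprB !expRD; field.
have i3 t : (gauss_law v).-integrable setT (EFin \o (fun x => v ^+ 2 * cosh (t * x))).
  by apply: integrable_mulr; exact: integrable_gauss_cosh.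
have ib : (gauss_law v).-integrable setT (EFin \o (fun x => cos x + cosh (1 * x) - 2)).
  by apply: integrable_subr => //; exact: integrable_addr.
rewrite E1; apply: le_trans (le_normr_Rintegral measurableT ib) _.
apply: (@le_trans _ _ (\int[gauss_law v]_x (v ^+ 2 * cosh ((l + 1) * x) + v ^+ 2 * cosh ((l - 1) * x)))).
  apply: le_Rintegral => //.
  - exact: integrable_normr.
  - exact: integrable_addr.
rewrite RintegralD// !RintegralZl//; [|exact: integrable_gauss_cosh..].
rewrite !gauss_cosh//.
have h1 : (l + 1) ^+ 2 * v / 2 <= 2.
  rewrite (_ : (l + 1) ^+ 2 * v = (1 + s) ^+ 2).
    have : (1 + s) ^+ 2 <= 2 ^+ 2 by rewrite ler_sqr ?nnegrE//; lra.
    by lra.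
  rewrite -s2 /l; field; exact: lt0r_neq0.
have h2 : (l - 1) ^+ 2 * v / 2 <= 2.
  rewrite (_ : (l - 1) ^+ 2 * v = (1 - s) ^+ 2).
    have : (1 - s) ^+ 2 <= 2 ^+ 2 by rewrite ler_sqr ?nnegrE//; lra.
    by lra.
  rewrite -s2 /l; field; exact: lt0r_neq0.
move: h1 h2; rewrite -!(ler_expR (_ / 2)) => h1 h2.
have v2 : 0 <= v ^+ 2 by rewrite sqr_ge0.
have := ler_wpM2l v2 h1; have := ler_wpM2l v2 h2; lra.
Qed.

(** The additivity of the variance under convolution determines the function v |->
    C v from its expansion at 0, as in the classical proof that a continuous solution
    of Cauchy's functional equation is an exponential. *)
Theorem gauss_cos v : 0 <= v -> \int[gauss_law v]_x cos x = expR (- (v / 2)).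
Proof.
rewrite -/(C v) le_eqVlt => /predU1P[<-|v0].
  by have := @gauss_cos_pow 0 0%N (lexx 0); rewrite !mul0r oppr0 expR0 expr0.
pose k : R := 2 * expR 2 + expR 1.
have small u : 0 < u <= 1 -> `|C u - expR (- (u / 2))| <= k * u ^+ 2.
  move=> /[dup] u01 /andP[u0 u1].
  have h1 := gauss_cos_small u01.
  have h2 : `|2 - expR (u / 2) - expR (- (u / 2))| <= expR 1 * u ^+ 2.
    have -> : 2 - expR (u / 2) - expR (- (u / 2)) = - (2 * (cosh (u / 2) - 1)).
      by rewrite /cosh; field.
    rewrite normrN ger0_norm ?mulr_ge0 ?subr_ge0 ?cosh_ge1//.
    apply: le_trans (ler_wpM2l _ (cosh_le_quad _)) _ => //.
    have hc : cosh (u / 2) <= expR 1.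
      have : expR (u / 2) <= expR 1 by rewrite ler_expR; lra.
      have : expR (- (u / 2)) <= expR 1 by rewrite ler_expR; lra.
      rewrite /cosh; lra.
    have u2 : 0 <= u ^+ 2 by rewrite sqr_ge0.
    have := ler_wpM2l u2 hc; have := ltW (cosh_gt0 (u / 2)).
    rewrite expr_div_n => h3 h4.
    have : u ^+ 2 * cosh (u / 2) / 4 <= u ^+ 2 * cosh (u / 2).
      by rewrite ler_pdivrMr// ler_peMr ?mulr_ge0//; lra.
    lra.
  rewrite (_ : _ - _ = (C u - (2 - expR (u / 2))) + (2 - expR (u / 2) - expR (- (u / 2)))); last by ring.
  by apply: le_trans (ler_normD _ _) _; rewrite /k mulrDl lerD.
have k0 : 0 <= k by rewrite addr_ge0 ?mulr_ge0 ?expR_ge0.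
have H n : (0 < n)%N -> v <= n%:R -> `|C v - expR (- (v / 2))| <= k * v ^+ 2 / n%:R.
  move=> n0 vn; have n0' : 0 < n%:R :> R by rewrite ltr0n.
  have ev : v = n%:R * (v / n%:R) by field; rewrite pnatr_eq0 -lt0n.
  have u01 : 0 < v / n%:R <= 1 by rewrite divr_gt0//= ler_pdivrMr// mul1r.
  have -> : C v = C (v / n%:R) ^+ n.
    by rewrite {1}ev gauss_cos_pow// divr_ge0// ltW.
  have -> : expR (- (v / 2)) = expR (- (v / n%:R / 2)) ^+ n.
    rewrite -expRM_natl; congr expR; field; exact: lt0r_neq0.
  apply: le_trans (norm_expX_sub _ _ _) _; first exact: gauss_cos_norm.
    rewrite ger0_norm ?expR_ge0// expR_le1 oppr_le0 !divr_ge0// ltW//.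
  apply: le_trans (ler_wpM2l (ltW n0') (small _ u01)) _.
  by rewrite le_eqVlt; apply/orP; left; apply/eqP; field; exact: lt0r_neq0.
apply/eqP; rewrite -subr_eq0 -normr_le0; apply/ler_addgt0Pl => e e0; rewrite addr0.
have [n [n0 vn en]] : exists n : nat, [/\ (0 < n)%N, v <= n%:R & k * v ^+ 2 / e <= n%:R].
  have : \forall n \near \oo, [/\ (0 < n)%N, v <= n%:R & k * v ^+ 2 / e <= n%:R].
    by near=> n; split; near: n; [exact: nbhs_infty_gt|exact: nbhs_infty_ger|exact: nbhs_infty_ger].
  by move=> /filter_ex.
apply: le_trans (H n n0 vn) _; rewrite ler_pdivrMr ?ltr0n//.
by rewrite [leRHS]mulrC -ler_pdivrMr.
Unshelve. all: by end_near. Qed.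

End gauss_fourier.

Section gauss_vector.
Variable R : realType.

(** Independent standard Gaussian variables, described through the laws of their
    linear combinations: one more variable is obtained by taking a product with the
    standard Gaussian law. *)
Lemma gauss_family (K : nat) : exists (d : measure_display) (T : measurableType d)
    (P : probability T R) (Z : 'I_K -> T -> R),
  (forall s, measurable_fun setT (Z s)) /\
  forall (b : 'I_K -> R) (A : set R), measurable A ->
    P [set w | A (\sum_s b s * Z s w)] = gauss_law (\sum_s b s ^+ 2) A.
Proof.
elim: K => [|K [d [T [P [Z [mZ PZ]]]]]].
  exists _, (measurableTypeR R), (gauss_law 0), (fun _ _ => 0); split=> [[]//|b A mA].
  rewrite !big_ord0 gauss_law0/= !diracE.
  by have [A0|A0] := pselect (A 0); [rewrite !mem_set|rewrite !memNset].
pose Z' (s : 'I_K.+1) (w : T * measurableTypeR R) : R :=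
  if unlift ord0 s is Some s' then Z s' w.1 else w.2.
exists _, (T * measurableTypeR R)%type, (P \x gauss_law 1)%E, Z'.
split=> [s|b A mA].
  rewrite /Z'; case: unlift => [s'|]; last exact: measurable_snd.
  exact: (measurableT_comp (mZ s') measurable_fst).
pose b' s := b (lift ord0 s); pose X w := \sum_s b' s * Z s w.
have mX : measurable_fun setT (X : T -> measurableTypeR R).
  by apply: measurable_sum => s; exact: measurable_funM.
pose v := \sum_s b' s ^+ 2.
have v0 : 0 <= v by apply: sumr_ge0 => s _; rewrite sqr_ge0.
have -> : \sum_s b s ^+ 2 = v + b ord0 ^+ 2 by rewrite big_ord_recl addrC.
have setE : [set w | A (\sum_s b s * Z' s w)] = [set w | A (X w.1 + b ord0 * w.2)].
  apply/seteqP; split => w /=; rewrite big_ord_recl /Z' unlift_none addrC;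
    by under eq_bigr do rewrite liftK.
rewrite setE -gauss_law_conv ?sqr_ge0// /product_measure1/=.
pose g (x : measurableTypeR R) := gauss_law (b ord0 ^+ 2) (xsection [set z | A (z.1 + z.2)] x).
transitivity (\int[P]_w g (X w))%E.
  apply: eq_integral => w _ /=.
  have := @gauss_law_scale R 1 (b ord0) ((fun y => y + X w) @^-1` A) ler01.
  rewrite mulr1 => h.
  rewrite (_ : xsection _ w = (fun x => b ord0 * x) @^-1` ((fun y => y + X w) @^-1` A)).
    rewrite h.
      congr (gauss_law _ _); apply/seteqP; split => y; rewrite /xsection/= inE/= addrC//.
    rewrite -[X in measurable X]setTI.
    have m : measurable_fun setT (fun y : measurableTypeR R => y + X w : measurableTypeR R).
      exact: measurable_funD.
    exact: m.
  by apply/seteqP; split => y; rewrite /xsection/= inE/= addrC.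
have mg : measurable_fun setT g.
  apply: measurable_fun_xsection.
  exact: (measurable_add_preimage (@measurable_id _ _ setT) mA).
transitivity (\int[pushforward P (X : T -> measurableTypeR R)]_x g x)%E.
  by rewrite ge0_integral_pushforward.
apply: eq_measure_integral => B mB _; rewrite /pushforward/=.
exact: PZ.
Qed.

End gauss_vector.

Section borel_vectors.
Variables (R : realType) (k : nat).

Lemma measurable_fun_cont (f : 'rV[R]_k -> R) : continuous f ->
  measurable_fun setT (f : borel_rV R k -> measurableTypeR R).
Proof.
move=> cf; apply: (measurability (@RGenOpens.G R)).
  exact: RGenOpens.measurableE.
move=> _ [C [x [y ->]] <-]; rewrite setTI; apply: sub_sigma_algebra.
by apply: open_comp => // z _; exact: cf.
Qed.

(** An open set is the union of the cubes with rational centre and radius 1 / n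
    that it contains, hence a countable union of preimages of intervals under the
    coordinates. *)
Lemma measurable_fun_borel (d : measure_display) (T : measurableType d)
    (f : T -> 'rV[R]_k) : (forall i, measurable_fun setT (fun w => f w 0 i)) ->
  measurable_fun setT (f : T -> borel_rV R k).
Proof.
move=> mf; apply: (@measurability _ _ _ (borel_rV R k) setT f (@open 'rV[R]_k)) => //= _ [U oU <-].
rewrite setTI.
pose box (c : 'rV[rat]_k * nat) : set 'rV[R]_k :=
  [set x | forall i, `|x 0 i - ratr (c.1 0 i)| < c.2.+1%:R^-1].
pose F c := if `[< box c `<=` U >] then f @^-1` box c else set0.
have -> : f @^-1` U = \bigcup_c F c.
  apply/seteqP; split => [w /= Uw|w [c _]]; last first.
    by rewrite /F; case: asboolP => // sub /sub.
  have : nbhs (f w) U by apply: open_nbhs_nbhs.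
  move=> /nbhs_ballP[e /= e0 ballU].
  have e2 : 0 < e / 2 by rewrite divr_gt0.
  have [n n0] : exists n : nat, n.+1%:R^-1 < e / 2.
    by have /filter_ex := near_infty_natSinv_lt (PosNum e2).
  have H i : exists q : rat, `|f w 0 i - ratr q| < n.+1%:R^-1.
    have [|q] := @rat_in_itvoo R (f w 0 i - n.+1%:R^-1) (f w 0 i + n.+1%:R^-1).
      by rewrite ltrD2l gtrN// invr_gt0.
    by rewrite in_itv/= -ltr_distl distrC => hq; exists q.
  pose q := \row_i xchoose (H i).
  exists (q, n) => //; rewrite /F.
  have sub : box (q, n) `<=` U.
    move=> x bx; apply: ballU; split=> // i j; rewrite (ord1 i).
    have := bx j; rewrite mxE/= => h1; have h2 := xchooseP (H j).
    rewrite /ball/= (_ : _ - _ = (f w 0 j - ratr (xchoose (H j))) - (x 0 j - ratr (xchoose (H j)))).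
      by apply: le_lt_trans (ler_normB _ _) _; rewrite (splitr e) ltrD// (lt_trans _ n0).
    by ring.
  case: asboolP => // _ i /=.
  by rewrite mxE; exact: (xchooseP (H i)).
apply: countable_bigcupT_measurable; first exact: countableP.
move=> c; rewrite /F; case: ifP => _ //.
have -> : f @^-1` box c = \bigcap_(i in [set: 'I_k])
    ((fun w => f w 0 i) @^-1` `]ratr (c.1 0 i) - c.2.+1%:R^-1, ratr (c.1 0 i) + c.2.+1%:R^-1[%classic).
  apply/seteqP; split => w /=.
    by move=> h i _ /=; rewrite in_itv/= -ltr_distl; exact: h.
  by move=> h i; have := h i Logic.I; rewrite /= in_itv/= -ltr_distl.
apply: fin_bigcap_measurable; first exact: finite_finset.
move=> i _; rewrite -[X in measurable X]setTI; exact: mf.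
Qed.

End borel_vectors.

Section gauss_limit.
Variables (R : realType) (k K : nat) (xi : 'I_K -> 'rV[R]_k).

(** The variance of the linear functional u of sum_s Z_s xi_s, for independent standard
    Gaussian variables Z_s. *)
Definition lin_var (u : 'cV[R]_k) : R := \sum_s ((xi s *m u) 0 0) ^+ 2.

Lemma lin_var_ge0 u : 0 <= lin_var u.
Proof. by apply: sumr_ge0 => s _; rewrite sqr_ge0. Qed.

Definition gauss_vector_law (G : probability (borel_rV R k) R) :=
  forall (u : 'cV[R]_k) (A : set R), measurable A ->
    G [set x | A (((x : 'rV[R]_k) *m u) 0 0)] = gauss_law (lin_var u) A.

Lemma gauss_vector_exists : exists G, gauss_vector_law G.
Proof.
have [d [T [P [Z [mZ PZ]]]]] := gauss_family R K.
pose f w : borel_rV R k := \sum_s Z s w *: xi s.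
have mf : measurable_fun setT f.
  apply: measurable_fun_borel => i.
  rewrite (_ : (fun w => _) = fun w => \sum_s Z s w * xi s 0 i).
    by apply: measurable_sum => s; exact: measurable_funM.
  by apply/funext => w; rewrite /f summxE; apply: eq_bigr => s _; rewrite mxE.
pose F : {mfun T >-> borel_rV R k} :=
  MeasurableFun.Pack (MeasurableFun.Class (isMeasurableFun.Build _ _ _ _ _ mf)).
exists (distribution P F) => u A mA.
rewrite /lin_var -PZ// /distribution /pushforward; congr (P _).
have e w : ((f w : 'rV[R]_k) *m u) 0 0 = \sum_s (xi s *m u) 0 0 * Z s w.
  rewrite /f mulmx_suml summxE.
  by apply: eq_bigr => s _; rewrite -scalemxAl mxE mulrC.
by apply/seteqP; split => w /=; rewrite e.
Qed.

Variable G : probability (borel_rV R k) R.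
Hypothesis GP : gauss_vector_law G.

Definition gauss_mean (f : 'rV[R]_k -> R) : R := \int[G]_x f x.

Lemma integrable_bdd_cont f : bdd_cont f -> G.-integrable setT (EFin \o f).
Proof.
move=> [cf [M fM]]; apply: (@integrable_bounded R _ _ G f M) => //.
  exact: prob_lty.
exact: measurable_fun_cont.
Qed.

Lemma gauss_is_mean : is_mean gauss_mean.
Proof.
split.
- exact: Rintegral_prob_cst.
- by move=> f g bf bg; rewrite /gauss_mean RintegralD//; exact: integrable_bdd_cont.
- by move=> c f bf; rewrite /gauss_mean RintegralZl//; exact: integrable_bdd_cont.
- by move=> f g bf bg fg; apply: le_Rintegral => //; exact: integrable_bdd_cont.
Qed.

Lemma gauss_mean_lin u (h : R -> R) (M : R) : continuous h -> (forall x, `|h x| <= M) ->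
  gauss_mean (fun x => h ((x *m u) 0 0)) = \int[gauss_law (lin_var u)]_y h y.
Proof.
move=> ch hM; rewrite /gauss_mean /Rintegral; congr fine; apply/esym.
have mu : measurable_fun setT ((fun x : 'rV[R]_k => (x *m u) 0 0) : borel_rV R k -> measurableTypeR R).
  by apply: measurable_fun_cont; exact: continuous_lin.
apply: (@integral_image R _ _ _ _ G (gauss_law (lin_var u)) _ h mu).
- by move=> A mA; have := GP u mA.
- exact: continuous_measurable_fun.
- apply: (@integrable_bounded R _ _ G _ M) => [||x]; [exact: prob_lty| |exact: hM].
  by apply: measurableT_comp mu; exact: continuous_measurable_fun.
Qed.

Lemma gauss_mean_cos u th :
  gauss_mean (fun x => cos ((x *m u) 0 0 + th)) = expR (- (lin_var u / 2)) * cos th.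
Proof.
have ccos : continuous (fun y : R => cos (y + th)).
  move=> y; apply: (@cts_comp _ _ (fun y : R => y + th) cos); last exact: continuous_cos.
  by apply: ctsD; [exact: cvg_id|exact: cts_cst].
rewrite (gauss_mean_lin u ccos (M := 1)); last by move=> y; exact: cos_max.
have v0 := lin_var_ge0 u.
under eq_Rintegral do rewrite cosD.
have ic := integrable_gauss_cos (lin_var u); have isn := integrable_gauss_sin (lin_var u).
rewrite RintegralB//; last 2 first.
- rewrite (_ : (fun y => _) = fun y => cos th * cos y); first exact: (integrable_mulr _ ic).
  by apply/funext => y; rewrite mulrC.
- rewrite (_ : (fun y => _) = fun y => sin th * sin y); first exact: (integrable_mulr _ isn).
  by apply/funext => y; rewrite mulrC.
rewrite (RintegralZr _ measurableT ic) (RintegralZr _ measurableT isn).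
by rewrite gauss_cos// gauss_sin// mul0r subr0.
Qed.

(** Chebyshev's inequality in each coordinate, the second moment being bounded by the mean
    of a hyperbolic cosine. *)
Lemma gauss_tail (e : R) : 0 < e -> exists2 B0, 0 < B0 &
  forall B, B0 <= B -> gauss_mean (tail B) <= e.
Proof.
move=> e0.
pose v i := lin_var (delta_mx i 0).
pose C := \sum_i 2 * expR (v i / 2).
have C0 : 0 <= C by apply: sumr_ge0 => i _; rewrite mulr_ge0// expR_ge0.
exists (C / e + 1) => [|B hB]; first by rewrite ltr_wpDl// divr_ge0// ltW.
have B1 : 1 <= B by apply: le_trans hB; rewrite lerDr divr_ge0// ltW.
have B0 : 0 < B := lt_le_trans ltr01 B1.
have chi : continuous (fun y : R => Num.min 1 ((y / B) ^+ 2)).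
  move=> y; apply: (@continuous_min R _ (fun=> 1) (fun y : R => (y / B) ^+ 2)).
    exact: cts_cst.
  by do 2 (apply: ctsM); do ? [exact: cvg_id|exact: cts_cst|apply: ctsM].
have hi1 (y : R) : `|Num.min 1 ((y / B) ^+ 2)| <= 1.
  by rewrite ger0_norm ?ge_min ?lexx// le_min ler01 sqr_ge0.
have H i : gauss_mean (fun x => Num.min 1 ((x 0 i / B) ^+ 2)) <= 2 * expR (v i / 2) / B ^+ 2.
  have -> : (fun x : 'rV[R]_k => Num.min 1 ((x 0 i / B) ^+ 2)) =
      (fun x : 'rV[R]_k => Num.min 1 (((x *m (delta_mx i 0 : 'cV[R]_k)) 0 0 / B) ^+ 2)).
    apply/funext => x; congr (Num.min _ ((_ / _) ^+ 2)).
    by rewrite mxE (bigD1 i)//= big1 ?addr0 ?mxE ?eqxx ?mulr1// => j /negbTE ji;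
      rewrite mxE ji mulr0.
  rewrite (gauss_mean_lin _ chi hi1) -/(v i).
  have v0 : 0 <= v i by exact: lin_var_ge0.
  rewrite (_ : 2 * expR (v i / 2) / B ^+ 2 = \int[gauss_law (v i)]_y (2 / B ^+ 2 * cosh (1 * y))).
    apply: le_Rintegral => //.
    - apply: (@integrable_bounded R _ _ _ _ 1) => //; first exact: prob_lty.
      exact: continuous_measurable_fun.
    - exact/integrable_mulr/integrable_gauss_cosh.
    - move=> y _; rewrite ge_min; apply/orP; right.
      rewrite mul1r expr_div_n (_ : 2 / B ^+ 2 * cosh y = 2 * cosh y / B ^+ 2); last by ring.
      rewrite ler_pM2r ?invr_gt0 ?exprn_gt0//.
      by have := cosh_ge_quad y; lra.
  rewrite RintegralZl//; last exact: integrable_gauss_cosh.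
  by rewrite gauss_cosh// expr1n mul1r; ring.
have -> : gauss_mean (tail B) = \sum_i gauss_mean (fun x => Num.min 1 ((x 0 i / B) ^+ 2)).
  rewrite /gauss_mean /tail.
  have ih i : G.-integrable setT (EFin \o (fun x : 'rV[R]_k => Num.min 1 ((x 0 i / B) ^+ 2))).
    apply: (@integrable_bounded R _ _ G _ 1) => [||x]; [exact: prob_lty| |exact: hi1].
    apply: measurable_fun_cont => x.
    apply: (@continuous_min R _ (fun=> 1) (fun x : 'rV[R]_k => (x 0 i / B) ^+ 2)).
      exact: cts_cst.
    by do 2 (apply: ctsM); do ? [exact: coord_continuous|exact: cts_cst|apply: ctsM].
  rewrite /Rintegral sum_fine; last by move=> i _; exact: (integrable_fin_num measurableT (ih i)).
  rewrite -(integral_sum measurableT ih); congr fine; apply: eq_integral => x _.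
  by rewrite sumEFin.
apply: (@le_trans _ _ (C / B ^+ 2)).
  by rewrite /C mulr_suml; apply: ler_sum => i _.
rewrite ler_pdivrMr ?exprn_gt0//.
have h1 : C <= e * B.
  by rewrite mulrC -ler_pdivrMr//; apply: le_trans hB; rewrite lerDl.
by apply: le_trans h1 _; rewrite ler_pM2l// expr2 ler_peMr// ltW.
Qed.

End gauss_limit.

(** * The step-stress model *)

Section indices.
Variables (R : realType) (L r : nat).

Lemma cell_vec_fail (f : 'I_L -> 'I_r -> R) f0 l j : cell_vec f f0 (cell_idx l j) 0 = f l j.
Proof. by rewrite /cell_vec /cell_idx col_mxEu mxE mxvecE mxE. Qed.

Lemma cell_vec_surv (f : 'I_L -> 'I_r -> R) f0 : cell_vec f f0 (rshift _ 0) 0 = f0.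
Proof. by rewrite /cell_vec col_mxEd mxE eqxx mulr1n. Qed.

Lemma par_vecE (f : 'I_r -> 'I_2 -> R) k b : par_vec f 0 (mxvec_index k b) = f k b.
Proof. by rewrite /par_vec mxvecE mxE. Qed.

Lemma vec_mxE (v : 'rV[R]_(r * 2)) k b : vec_mx v k b = v 0 (mxvec_index k b).
Proof. by rewrite mxE. Qed.

Variant cell_spec : 'I_(L * r + 1) -> Prop :=
| CellFail l j : cell_spec (cell_idx l j)
| CellSurv : cell_spec (rshift _ 0).

Lemma cellP s : cell_spec s.
Proof.
rewrite -(splitK s); case: (fintype.split s) => i /=; last by rewrite (ord1 i); constructor.
by case/mxvec_indexP: i => l j; exact: CellFail.
Qed.

Lemma sum_mxvec (n m : nat) (F : 'I_(n * m) -> R) :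
  \sum_t F t = \sum_k \sum_b F (mxvec_index k b).
Proof.
rewrite pair_big/=; have [g hg gh] := curry_mxvec_bij n m.
rewrite (reindex (uncurry (@mxvec_index n m)))/=; last by exists g.
by apply: eq_bigr => -[].
Qed.

Lemma sum_cell (F : 'I_(L * r + 1) -> R) :
  \sum_s F s = \sum_l \sum_j F (cell_idx l j) + F (rshift _ 0).
Proof. by rewrite big_split_ord/= big_ord1 sum_mxvec. Qed.

End indices.

Lemma ord2P (i : 'I_2) : i = 0 \/ i = 1.
Proof.
case: i => [[|[|//]] hi]; [left|right]; exact: val_inj.
Qed.

Section model.
Variables (R : realType) (L r : nat) (D : stepStressTest R L).
Implicit Types (a v : 'rV[R]_(r * 2)) (i : 'I_2) (j k : 'I_r) (l : 'I_L).
Hypothesis r_gt0 : (0 < r)%N.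

Lemma theta_gt0 a i j : 0 < theta D a i j.
Proof. exact: expR_gt0. Qed.

Definition rate a i := \sum_j (theta D a i j)^-1.

Lemma rate_gt0 a i : 0 < rate a i.
Proof.
rewrite /rate (bigD1 (Ordinal r_gt0))//= ltr_wpDr ?invr_gt0 ?theta_gt0//.
by apply: sumr_ge0 => j _; rewrite invr_ge0 ltW// theta_gt0.
Qed.

Lemma surv0E a t : surv D a 0 t = expR (- (t * rate a 0)).
Proof.
rewrite /surv /rate mulr_sumr; congr (expR (- _)); apply: eq_bigr => j _.
by rewrite /exposure_shift eqxx addr0.
Qed.

Lemma surv1E a t : surv D a 1 t = expR (- ((t - tau1 D) * rate a 1 + tau1 D * rate a 0)).
Proof.
rewrite /surv /rate !mulr_sumr -big_split/=; congr (expR (- _)); apply: eq_bigr => j _.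
have := theta_gt0 a 0 j; have := theta_gt0 a 1 j => h1 h0.
by rewrite /exposure_shift /=; field; rewrite !gt_eqF.
Qed.

Lemma cause_prob_gt0 a i j : 0 < cause_prob D a i j.
Proof. by rewrite divr_gt0 ?invr_gt0 ?theta_gt0//; exact: rate_gt0. Qed.

Lemma cause_prob_sum a i : \sum_j cause_prob D a i j = 1.
Proof. by rewrite -mulr_suml divff// gt_eqF//; exact: rate_gt0. Qed.

Lemma surv_lt a i (s t : R) : s < t -> surv D a i t < surv D a i s.
Proof.
move=> st; have h1 := rate_gt0 a 1; have h0 := rate_gt0 a 0.
case: (ord2P i) => ->.
  by rewrite !surv0E ltr_expR ltrN2 ltr_pM2r.
by rewrite !surv1E ltr_expR ltrN2 ltrD2r ltr_pM2r// ltrD2r.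
Qed.

Lemma prob_fail_gt0 a l j : 0 < prob_fail D a l j.
Proof. by rewrite mulr_gt0 ?cause_prob_gt0// subr_gt0 surv_lt// IT_incr. Qed.

Lemma cell_prob_gt0 a s : 0 < cell_prob D a s 0.
Proof.
case: (cellP s) => [l j|]; first by rewrite cell_vec_fail prob_fail_gt0.
by rewrite cell_vec_surv expR_gt0.
Qed.

Lemma IT_lt (l l' : nat) : (l < l')%N -> (l' <= L)%N -> IT D l < IT D l'.
Proof.
elim: l' => // l' IH; rewrite ltnS leq_eqVlt => /predU1P[->|ll'] l'L; first exact: IT_incr.
by apply: lt_trans (IH ll' (ltnW l'L)) _; exact: IT_incr.
Qed.

Lemma sum_prob_fail a l : \sum_j prob_fail D a l j =
  surv D a (stress_idx D l) (IT D l) - surv D a (stress_idx D l) (IT D l.+1).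
Proof. by rewrite -mulr_suml cause_prob_sum mul1r. Qed.

(** Up to tau1 the survival function of the first stress level is in force and afterwards
    that of the second one; the exposure shift makes them agree at tau1, so the
    probabilities of the intervals telescope. *)
Lemma cell_prob_sum a : \sum_s cell_prob D a s 0 = 1.
Proof.
rewrite sum_cell /cell_prob cell_vec_surv.
under eq_bigr do under eq_bigr do rewrite cell_vec_fail.
under eq_bigr do rewrite sum_prob_fail.
have [m [m0 mL tm]] := IT_tau1 D.
pose S t := if t <= tau1 D then surv D a 0 t else surv D a 1 t.
have Sl l : surv D a (stress_idx D l) (IT D l) - surv D a (stress_idx D l) (IT D l.+1) =
    S (IT D l) - S (IT D l.+1).
  rewrite /S /stress_idx; case: ifPn => hl.
    by rewrite (le_trans _ hl)// ltW// IT_lt.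
  case: ifPn => [hl'|_]; last by [].
  suff -> : surv D a 1 (IT D l) = surv D a 0 (IT D l) by [].
  have {hl'} -> : IT D l = tau1 D.
    apply/eqP; rewrite eq_le hl'/= -tm leNgt; apply/negP => h.
    have lm : (l < m)%N.
      rewrite ltnNge; apply/negP; rewrite leq_eqVlt => /predU1P[e|ml].
        by rewrite e ltxx in h.
      by have := IT_lt ml (ltnW (ltn_ord l)); rewrite ltNge ltW.
    move: hl; rewrite -tm -ltNge => h2.
    move: lm; rewrite leq_eqVlt => /predU1P[e|lm]; first by rewrite e ltxx in h2.
    by have := IT_lt lm (ltnW mL); rewrite ltNge ltW.
  by rewrite surv0E surv1E subrr mul0r add0r.
under eq_bigr do rewrite Sl.
have := @telescope_sumr R 0 L (fun n : nat => - S (IT D n)) (leq0n L).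
rewrite big_mkord => tel.
rewrite (eq_bigr (fun l : 'I_L => - S (IT D l.+1) - - S (IT D l))); last by move=> l _; ring.
rewrite tel IT_0 IT_L /S (ltW (tau1_gt0 D)) (lt_geF (tau1_lt_tau2 D)) surv0E mul0r oppr0 expR0.
by rewrite /prob_surv; ring.
Qed.

End model.

Lemma big_ord2 (R : realType) (F : 'I_2 -> R) : \sum_b F b = F 0 + F 1.
Proof. by rewrite !big_ord_recl big_ord0 addr0; congr (_ + F _); exact: val_inj. Qed.

Section jacobian.
Variables (R : realType) (L r : nat) (D : stepStressTest R L).
Hypothesis r_gt0 : (0 < r)%N.
Implicit Types (a v : 'rV[R]_(r * 2)) (i : 'I_2) (j k : 'I_r) (l : 'I_L).

Section line.
Variables (a v : 'rV[R]_(r * 2)).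
Local Notation A t := (a + t *: v).

(* minus the logarithmic derivative of the rate of cause j in the direction v *)
Let nu i j := vec_mx v j 0 + vec_mx v j 1 * stress D i.

Lemma is_derive_theta i j (t : R) : is_derive t (1 : R) (fun t => theta D (A t) i j)
  (theta D (A t) i j * nu i j).
Proof.
have e (u : R) : theta D (A u) i j = expR (vec_mx a j 0 + vec_mx a j 1 * stress D i + u * nu i j).
  by rewrite /theta; congr expR; rewrite /nu !mxE; ring.
under eq_fun do rewrite e; rewrite e.
by apply: is_derive_eq; rewrite /GRing.scale/=; ring.
Qed.

Lemma is_derive_rate i j (t : R) : is_derive t (1 : R) (fun t => (theta D (A t) i j)^-1)
  (- ((theta D (A t) i j)^-1 * nu i j)).
Proof.
have t0 := theta_gt0 D (A t) i j.
have h := @derV R (fun t => theta D (A t) i j) t _ (lt0r_neq0 t0) (is_derive_theta i j t).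
by apply: (is_derive_eq h); field; rewrite gt_eqF.
Qed.

Lemma is_derive_exposure i j (t : R) :
  is_derive t (1 : R) (fun t => exposure_shift D (A t) i j)
    (exposure_shift_star D (A t) i j * vec_mx v j 1).
Proof.
rewrite /exposure_shift /exposure_shift_star; case: eqP => _.
  by rewrite mul0r; exact: der_cst.
have h1 := derM (is_derive_theta 1 j t) (is_derive_rate 0 j t).
have h := derM (der_cst (tau1 D) t) (derB h1 (der_cst 1 t)).
apply: (is_derive_eq h); rewrite /nu; ring.
Qed.

(* the logarithmic derivative of surv D (A t) i s, in the form of the entries of W *)
Let G i (s t : R) := \sum_k ((s + exposure_shift D (A t) i k) / theta D (A t) i k * nu i k
  - exposure_shift_star D (A t) i k / theta D (A t) i k * vec_mx v k 1).

Lemma is_derive_surv i (s t : R) :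
  is_derive t (1 : R) (fun t => surv D (A t) i s) (surv D (A t) i s * G i s t).
Proof.
have h k : is_derive t (1 : R)
    (fun t => (s + exposure_shift D (A t) i k) / theta D (A t) i k)
    (- ((s + exposure_shift D (A t) i k) / theta D (A t) i k * nu i k
      - exposure_shift_star D (A t) i k / theta D (A t) i k * vec_mx v k 1)).
  have h := derM (derD (der_cst s t) (is_derive_exposure i k t)) (is_derive_rate i k t).
  by apply: (is_derive_eq h); ring.
have h1 := der_comp (derN (der_sum h)) (is_derive_expR _).
by apply: (is_derive_eq h1); rewrite sumrN opprK.
Qed.

Lemma is_derive_cause i j (t : R) :
  is_derive t (1 : R) (fun t => cause_prob D (A t) i j)
   (cause_prob D (A t) i j * (\sum_k cause_prob D (A t) i k * nu i k - nu i j)).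
Proof.
have L0 := rate_gt0 D r_gt0 (A t) i; rewrite /rate in L0.
have hs := der_sum (fun k => is_derive_rate i k t).
have h := derM (is_derive_rate i j t)
  (@derV R (fun t => \sum_(m < r) (theta D (A t) i m)^-1) t _ (lt0r_neq0 L0) hs).
apply: (is_derive_eq h); rewrite /cause_prob.
under [X in _ = _ * (X - _)]eq_bigr do rewrite mulrAC.
rewrite -mulr_suml sumrN.
set S := \sum_(m < r) _ in L0 *; set Q := \sum_(k < r) _.
by field; rewrite gt_eqF//= gt_eqF// theta_gt0.
Qed.

Let zsum i j (s t : R) := \sum_k \sum_b zfun D (A t) i j k b s * vec_mx v k b.

Let zsumE i j (s t : R) : zsum i j s t = cause_prob D (A t) i j * surv D (A t) i s *
  (\sum_k cause_prob D (A t) i k * nu i k - nu i j + G i s t).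
Proof.
have -> : nu i j = \sum_k (j == k)%:R * nu i k.
  by rewrite (bigD1 j)//= eqxx mul1r big1 ?addr0// => k /negbTE; rewrite eq_sym => ->; rewrite mul0r.
rewrite -sumrB -big_split/= mulr_sumr; apply: eq_bigr => k _.
by rewrite big_ord2 /zfun/= /nu; ring.
Qed.

Lemma W_mulE s (t : R) : (W_mx D (A t) *m v^T) s 0 =
  cell_vec (fun l j => \sum_k \sum_b W_fail D (A t) l j k b * vec_mx v k b)
    (\sum_k \sum_b W_surv D (A t) k b * vec_mx v k b) s 0.
Proof.
rewrite mxE sum_mxvec.
case: (cellP s) => [l j|].
  rewrite cell_vec_fail; apply: eq_bigr => k _; apply: eq_bigr => b _.
  by rewrite [W_mx _ _ _ _]mxE [v^T _ _]mxE [vec_mx _ _ _]mxE cell_vec_fail par_vecE.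
rewrite cell_vec_surv; apply: eq_bigr => k _; apply: eq_bigr => b _.
by rewrite [W_mx _ _ _ _]mxE [v^T _ _]mxE [vec_mx _ _ _]mxE cell_vec_surv par_vecE.
Qed.

(** W is the Jacobian matrix of the cell probabilities, in the form of directional
    derivatives along lines. *)
Lemma is_derive_cell s (t : R) :
  is_derive t (1 : R) (fun t => cell_prob D (A t) s 0) ((W_mx D (A t) *m v^T) s 0).
Proof.
rewrite W_mulE /cell_prob; case: (cellP s) => [l j|].
  rewrite (_ : (fun t => _) = fun t => prob_fail D (A t) l j); last first.
    by apply/funext => u; rewrite cell_vec_fail.
  rewrite cell_vec_fail /prob_fail; set i := stress_idx D l.
  have h := derM (is_derive_cause i j t)
    (derB (is_derive_surv i (IT D l) t) (is_derive_surv i (IT D l.+1) t)).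
  apply: (is_derive_eq h).
  have -> : \sum_k \sum_b W_fail D (A t) l j k b * vec_mx v k b =
      zsum i j (IT D l) t - zsum i j (IT D l.+1) t.
    rewrite /zsum -sumrB; apply: eq_bigr => k _; rewrite -sumrB; apply: eq_bigr => b _.
    by rewrite /W_fail -/i mulrBl.
  by rewrite !zsumE; ring.
rewrite (_ : (fun t => _) = fun t => surv D (A t) 1 (tau2 D)); last first.
  by apply/funext => u; rewrite cell_vec_surv.
rewrite cell_vec_surv; apply: (is_derive_eq (is_derive_surv 1 (tau2 D) t)).
rewrite /G mulr_sumr; apply: eq_bigr => k _.
by rewrite big_ord2 /W_surv/= /nu; ring.
Qed.

End line.

Section continuity.
Variable a : 'rV[R]_(r * 2).

Lemma cts_theta i j : {for a, continuous (fun a => theta D a i j)}.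
Proof.
rewrite /theta.
apply: (@cts_comp _ _ (fun a : 'rV[R]_(r * 2) => vec_mx a j 0 + vec_mx a j 1 * stress D i) expR);
  last exact: continuous_expR.
apply: ctsD; last apply: ctsM; last exact: cts_cst.
- rewrite (_ : (fun a => _) = fun a : 'rV[R]_(r * 2) => a 0 (mxvec_index j 0)).
    exact: coord_continuous.
  by apply/funext => b; rewrite mxE.
- rewrite (_ : (fun a => _) = fun a : 'rV[R]_(r * 2) => a 0 (mxvec_index j 1)).
    exact: coord_continuous.
  by apply/funext => b; rewrite mxE.
Qed.

Lemma cts_rate i j : {for a, continuous (fun a => (theta D a i j)^-1)}.
Proof. by apply: ctsV; [rewrite gt_eqF// theta_gt0|exact: cts_theta]. Qed.

Lemma cts_exposure i j : {for a, continuous (fun a => exposure_shift D a i j)}.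
Proof.
rewrite /exposure_shift; case: eqP => _; first exact: cts_cst.
apply: ctsM; first exact: cts_cst.
apply: ctsB; last exact: cts_cst.
by apply: ctsM; [exact: cts_theta|exact: cts_rate].
Qed.

Lemma cts_exposure_star i j : {for a, continuous (fun a => exposure_shift_star D a i j)}.
Proof.
rewrite /exposure_shift_star; case: eqP => _; first exact: cts_cst.
apply: ctsM; last exact: cts_cst.
apply: ctsM; first exact: cts_cst.
by apply: ctsM; [exact: cts_theta|exact: cts_rate].
Qed.

Lemma cts_surv i (s : R) : {for a, continuous (fun a => surv D a i s)}.
Proof.
rewrite /surv.
apply: (@cts_comp _ _ (fun a => - \sum_(m < r) (s + exposure_shift D a i m) / theta D a i m) expR);
  last exact: continuous_expR.
apply: ctsN; apply: cts_sum => m; apply: ctsM; last exact: cts_rate.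
by apply: ctsD; [exact: cts_cst|exact: cts_exposure].
Qed.

Lemma cts_cause i j : {for a, continuous (fun a => cause_prob D a i j)}.
Proof.
apply: ctsM; first exact: cts_rate.
apply: ctsV; first by rewrite gt_eqF//; exact: (rate_gt0 D r_gt0 a i).
by apply: cts_sum => m; exact: cts_rate.
Qed.

Lemma cts_zfun i j k b (s : R) : {for a, continuous (fun a => zfun D a i j k b s)}.
Proof.
rewrite /zfun; apply: ctsM; first by apply: ctsM; [exact: cts_cause|exact: cts_surv].
have e : {for a, continuous (fun a => (s + exposure_shift D a i k))}.
  by apply: ctsD; [exact: cts_cst|exact: cts_exposure].
have d : {for a, continuous (fun a => cause_prob D a i k - (j == k)%:R)}.
  by apply: ctsB; [exact: cts_cause|exact: cts_cst].
case: eqP => _; first by apply: ctsD => //; apply: ctsM => //; exact: cts_rate.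
apply: ctsD; first by apply: ctsM => //; exact: cts_cst.
apply: ctsM; last exact: cts_rate.
apply: ctsD; first by apply: ctsN; exact: cts_exposure_star.
by apply: ctsM => //; exact: cts_cst.
Qed.

Lemma cts_W s t : {for a, continuous (fun a => W_mx D a s t)}.
Proof.
case/mxvec_indexP: t => k b; case: (cellP s) => [l j|].
  rewrite (_ : (fun a => _) = fun a => W_fail D a l j k b); last first.
    by apply/funext => c; rewrite mxE cell_vec_fail par_vecE.
  by apply: ctsB; exact: cts_zfun.
rewrite (_ : (fun a => _) = fun a => W_surv D a k b); last first.
  by apply/funext => c; rewrite mxE cell_vec_surv par_vecE.
apply: ctsM; first exact: cts_surv.
have e : {for a, continuous (fun a => (tau2 D + exposure_shift D a 1 k))}.
  by apply: ctsD; [exact: cts_cst|exact: cts_exposure].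
case: eqP => _; first by apply: ctsM => //; exact: cts_rate.
apply: ctsM; last exact: cts_rate.
apply: ctsD; first by apply: ctsN; exact: cts_exposure_star.
by apply: ctsM => //; exact: cts_cst.
Qed.

Lemma cts_cell s : {for a, continuous (fun a => cell_prob D a s 0)}.
Proof.
case: (cellP s) => [l j|].
  rewrite (_ : (fun a => _) = fun a => prob_fail D a l j); last first.
    by apply/funext => c; rewrite cell_vec_fail.
  by apply: ctsM; [exact: cts_cause|apply: ctsB; exact: cts_surv].
rewrite (_ : (fun a => _) = fun a => prob_surv D a); last first.
  by apply/funext => c; rewrite cell_vec_surv.
exact: cts_surv.
Qed.

End continuity.
End jacobian.

Section identifiability.
Variables (R : realType) (L r : nat) (D : stepStressTest R L).
Hypothesis r_gt0 : (0 < r)%N.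
Implicit Types (a v : 'rV[R]_(r * 2)) (i : 'I_2) (j k : 'I_r) (q : 'cV[R]_(L * r + 1)).

Lemma L_gt0 : (0 < L)%N.
Proof. by have [m [m0 mL _]] := IT_tau1 D; exact: ltn_trans mL. Qed.

Definition first_int : 'I_L := Ordinal L_gt0.
Definition last_int : 'I_L := rev_ord first_int.

Lemma last_intS : (last_int.+1 = L)%N.
Proof. by rewrite /= subn1 prednK// L_gt0. Qed.

Lemma stress_first : stress_idx D first_int = 0.
Proof.
have [m [m0 mL tm]] := IT_tau1 D; rewrite /stress_idx/=.
move: m0; rewrite leq_eqVlt => /predU1P[e|m1]; first by rewrite -tm -e lexx.
by rewrite -tm ltW// (IT_lt D)// ltnW.
Qed.

Lemma stress_last : stress_idx D last_int = 1.
Proof. by rewrite /stress_idx last_intS IT_L lt_geF// tau1_lt_tau2. Qed.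

Lemma IT1_gt0 : 0 < IT D 1.
Proof. by rewrite -(IT_0 D); apply: IT_incr; exact: L_gt0. Qed.

(** A left inverse of the map from parameters to cell probabilities: the first
    interval lies under the first stress level and yields the rates of that level; the last
    interval and the survivors yield those of the second one. *)
Definition cells_of q i := \sum_j q (cell_idx (if i == 0 then first_int else last_int) j) 0.

Definition total_rate q i : R :=
  let L0 := - ln (1 - cells_of q 0) / IT D 1 in
  if i == 0 then L0
  else (- ln (q (rshift _ 0) 0) - tau1 D * L0) / (tau2 D - tau1 D).

Definition rate_of q i j :=
  total_rate q i * (q (cell_idx (if i == 0 then first_int else last_int) j) 0 / cells_of q i).

Definition slope_of q j : R :=
  (ln (rate_of q 0 j) - ln (rate_of q 1 j)) / (stress D 1 - stress D 0).

Definition par_of q j (b : 'I_2) : R :=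
  if b == 0 then - ln (rate_of q 0 j) - slope_of q j * stress D 0 else slope_of q j.

Section values.
Variable a : 'rV[R]_(r * 2).

Lemma cells_ofE i : cells_of (cell_prob D a) i =
  surv D a i (IT D (if i == 0 then first_int else last_int))
  - surv D a i (IT D (if i == 0 then first_int else last_int).+1).
Proof.
rewrite /cells_of; under eq_bigr do rewrite cell_vec_fail.
rewrite (sum_prob_fail D r_gt0).
by case: (ord2P i) => -> /=; rewrite ?stress_first ?stress_last.
Qed.

Lemma cells_of_gt0 i : 0 < cells_of (cell_prob D a) i.
Proof.
apply: (@lt_le_trans _ _ (cell_prob D a (cell_idx (if i == 0 then first_int else last_int) (Ordinal r_gt0)) 0)).
  exact: cell_prob_gt0.
rewrite /cells_of (bigD1 (Ordinal r_gt0))//= lerDl sumr_ge0// => j _.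
by rewrite ltW// cell_prob_gt0.
Qed.

Lemma first_compl : 1 - cells_of (cell_prob D a) 0 = expR (- (IT D 1 * rate D a 0)).
Proof. by rewrite cells_ofE/= IT_0 !surv0E mul0r oppr0 expR0; ring. Qed.

Lemma total_rateE i : total_rate (cell_prob D a) i = rate D a i.
Proof.
have h0 : - ln (1 - cells_of (cell_prob D a) 0) / IT D 1 = rate D a 0.
  rewrite first_compl expRK opprK mulrC mulKf// gt_eqF//; exact: IT1_gt0.
rewrite /total_rate h0; case: (ord2P i) => -> //=.
rewrite cell_vec_surv /prob_surv surv1E expRK; field.
by rewrite gt_eqF// subr_gt0 tau1_lt_tau2.
Qed.

Lemma rate_ofE i j : rate_of (cell_prob D a) i j = (theta D a i j)^-1.
Proof.
have c0 := cells_of_gt0 i; have L0 := rate_gt0 D r_gt0 a i.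
rewrite /rate_of total_rateE cell_vec_fail.
have -> : prob_fail D a (if i == 0 then first_int else last_int) j =
    cause_prob D a i j * cells_of (cell_prob D a) i.
  rewrite cells_ofE /prob_fail.
  by case: (ord2P i) => -> /=; rewrite ?stress_first ?stress_last.
rewrite mulfK ?gt_eqF// /cause_prob -/(rate D a i) mulrCA mulfV ?mulr1// gt_eqF//.
Qed.

Lemma par_ofE j b : par_of (cell_prob D a) j b = vec_mx a j b.
Proof.
have x0 : stress D 1 - stress D 0 != 0 by rewrite gt_eqF// subr_gt0 stress_lt.
have lnr i : ln (rate_of (cell_prob D a) i j) = - (vec_mx a j 0 + vec_mx a j 1 * stress D i).
  by rewrite rate_ofE /theta -expRN expRK.
have hs : slope_of (cell_prob D a) j = vec_mx a j 1.
  by rewrite /slope_of !lnr; field.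
by rewrite /par_of hs lnr; case: (ord2P b) => -> //=; ring.
Qed.

End values.

(* Any class of functions that is stable under the elementary operations contains
   the recovered parameters as soon as it contains the cell probabilities. *)
Section closure.
Variables (X : Type) (C : (X -> R) -> Prop) (x : X).
Hypothesis C_cst : forall c, C (fun=> c).
Hypothesis C_add : forall f g, C f -> C g -> C (fun y => f y + g y).
Hypothesis C_mul : forall f g, C f -> C g -> C (fun y => f y * g y).
Hypothesis C_inv : forall f, f x != 0 -> C f -> C (fun y => (f y)^-1).
Hypothesis C_ln : forall f, 0 < f x -> C f -> C (fun y => ln (f y)).
Variables (q : X -> 'cV[R]_(L * r + 1)) (a : 'rV[R]_(r * 2)).
Hypothesis qx : q x = cell_prob D a.
Hypothesis C_q : forall s, C (fun y => q y s 0).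

Let C_opp f : C f -> C (fun y => - f y).
Proof.
move=> Cf; have := C_mul (C_cst (-1)) Cf.
by congr C; apply/funext => y; rewrite mulN1r.
Qed.

Let C_sum (F : 'I_r -> X -> R) : (forall j, C (F j)) -> C (fun y => \sum_j F j y).
Proof.
move=> CF; elim: (index_enum _) => [|j s IH].
  by have := C_cst 0; congr C; apply/funext => y; rewrite big_nil.
by have := C_add (CF j) IH; congr C; apply/funext => y; rewrite big_cons.
Qed.

Let C_cells i : C (fun y => cells_of (q y) i).
Proof. by apply: C_sum => j; exact: C_q. Qed.

Let C_total i : C (fun y => total_rate (q y) i).
Proof.
have h0 : C (fun y => - ln (1 - cells_of (q y) 0) / IT D 1).
  apply: (C_mul _ (C_cst _)); apply: C_opp; apply: C_ln.
    by rewrite qx first_compl expR_gt0.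
  exact: (C_add (C_cst 1) (C_opp (C_cells 0))).
rewrite /total_rate; case: (ord2P i) => -> //=.
apply: (C_mul _ (C_cst _)); apply: (C_add _ (C_opp (C_mul (C_cst _) h0))).
by apply: C_opp; apply: C_ln => //; rewrite qx cell_prob_gt0.
Qed.

Let C_rate i j : C (fun y => rate_of (q y) i j).
Proof.
apply: (C_mul (C_total i)); apply: (C_mul (C_q _)).
by apply: C_inv (C_cells i); rewrite qx gt_eqF// cells_of_gt0.
Qed.

Let C_ln_rate i j : C (fun y => ln (rate_of (q y) i j)).
Proof. by apply: C_ln (C_rate i j); rewrite qx rate_ofE invr_gt0 theta_gt0. Qed.

Let C_slope j : C (fun y => slope_of (q y) j).
Proof. exact: (C_mul (C_add (C_ln_rate 0 j) (C_opp (C_ln_rate 1 j))) (C_cst _)). Qed.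

Lemma par_of_closed j b : C (fun y => par_of (q y) j b).
Proof.
rewrite /par_of; case: (ord2P b) => -> //=.
exact: (C_add (C_opp (C_ln_rate 0 j)) (C_opp (C_mul (C_slope j) (C_cst _)))).
Qed.

End closure.

Lemma cts_par_of a j b : {for cell_prob D a, continuous (fun q => par_of q j b)}.
Proof.
apply: (@par_of_closed _ (fun f => {for cell_prob D a, continuous f}) (cell_prob D a)
  _ _ _ _ _ id a erefl).
- by move=> c; exact: cts_cst.
- by move=> f g; exact: ctsD.
- by move=> f g; exact: ctsM.
- by move=> f; exact: ctsV.
- by move=> f f0 cf; apply: (@cts_comp _ _ f (@ln R) _ cf); exact: continuous_ln.
- by move=> s; exact: coord_continuous.
Qed.

(** If the cell probabilities are stationary along a line, then so are the
    parameters recovered from them, that is, the line is a point. *)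
Lemma W_inj a v : W_mx D a *m v^T = 0 -> v = 0.
Proof.
move=> Wv.
have fl s : is_derive (0 : R) (1 : R) (fun t => cell_prob D (a + t *: v) s 0) 0.
  have := is_derive_cell D r_gt0 a v s 0.
  by rewrite scale0r addr0 Wv mxE.
apply/rowP => t; case/mxvec_indexP: t => k b; rewrite [RHS]mxE -vec_mxE.
have : is_derive (0 : R) (1 : R) (fun t => par_of (cell_prob D (a + t *: v)) k b) 0.
  apply: (@par_of_closed _ (fun f => is_derive (0 : R) (1 : R) f 0) 0
    _ _ _ _ _ (fun t => cell_prob D (a + t *: v)) a _ fl).
  - by move=> c; exact: der_cst.
  - by move=> f g hf hg; apply: (is_derive_eq (derD hf hg)); rewrite addr0.
  - by move=> f g hf hg; apply: (is_derive_eq (derM hf hg)); rewrite mul0r mulr0 addr0.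
  - by move=> f f0 hf; apply: (is_derive_eq (derV f0 hf)); rewrite oppr0 mul0r.
  - by move=> f f0 hf; apply: (is_derive_eq (der_comp hf (is_derive1_ln f0))); rewrite mulr0.
  - by rewrite scale0r addr0.
under eq_fun do rewrite par_ofE.
have -> : (fun t : R => vec_mx (a + t *: v) k b) = fun t => vec_mx a k b + t * vec_mx v k b.
  by apply/funext => t; rewrite !mxE.
move=> h0; have h1 := derD (der_cst (vec_mx a k b) 0) (derM (is_derive_id (0 : R) 1) (der_cst (vec_mx v k b) 0)).
have := derive_val (is_derive := h0); rewrite (derive_val (is_derive := h1)).
by rewrite add0r mul1r mulr0 addr0.
Qed.

End identifiability.

(** * The density power divergence *)

Section divergence.
Variables (R : realType) (beta : R).
Hypothesis beta_ge0 : 0 <= beta.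
Implicit Types p q : R.

Lemma der_cts (f : R -> R) (x df : R) : is_derive x (1 : R) f df -> {for x, continuous f}.
Proof.
by move=> h; apply: differentiable_continuous; apply/derivable1_diffP; case: h.
Qed.

(** The contribution of one cell. For beta = 0 the term p - q, which cancels in the
    sum over the cells, makes each contribution nonnegative by itself. *)
Definition div_term q p : R :=
  if beta == 0 then q * ln (q / p) + (p - q)
  else p `^ (1 + beta) - (1 + beta^-1) * q * p `^ beta + beta^-1 * q `^ (1 + beta).

Lemma dpd_div_term K (q p : 'cV[R]_K) : \sum_s q s 0 = \sum_s p s 0 ->
  dpd beta q p = \sum_s div_term (q s 0) (p s 0).
Proof.
rewrite /dpd /div_term; case: eqP => // _ qp.
by rewrite big_split/= sumrB -qp subrr addr0.
Qed.

Lemma powR_succ p : 0 < p -> p * p `^ beta = p `^ (1 + beta).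
Proof.
by move=> p0; rewrite powRD ?(gt_eqF p0) ?implybT// powRr1 ?ltW.
Qed.

Lemma powR_pred p : 0 < p -> p * p `^ (beta - 1) = p `^ beta.
Proof.
move=> p0; rewrite -{1}(powRr1 (ltW p0)) -powRD ?(gt_eqF p0) ?implybT//.
by congr (_ `^ _); ring.
Qed.

Lemma div_term_diag q : 0 < q -> div_term q q = 0.
Proof.
move=> q0; rewrite /div_term; case: eqP => [_|_].
  by rewrite divff ?gt_eqF// ln1 mulr0 subrr addr0.
by rewrite -mulrA powR_succ//; ring.
Qed.

Lemma is_derive_div_term q p : 0 < q -> 0 < p ->
  is_derive p (1 : R) (div_term q) ((1 + beta) * p `^ (beta - 1) * (p - q)).
Proof.
move=> q0 p0; rewrite /div_term; case: eqP => [b0|/eqP b0].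
  have qp : 0 < q / p by rewrite divr_gt0.
  have h1 := derM (der_cst q p) (derV (lt0r_neq0 p0 : id p != 0) (is_derive_id p 1)).
  have h2 := derM (der_cst q p) (der_comp h1 (is_derive1_ln qp)).
  have h := derD h2 (derB (is_derive_id p 1) (der_cst q p)).
  apply: (is_derive_eq h); rewrite b0 addr0 sub0r powR_inv1 ?ltW//.
  by field; rewrite !gt_eqF.
have h1 := derB (is_derive1_powR (1 + beta) p0)
   (derM (der_cst ((1 + beta^-1) * q) p) (is_derive1_powR beta p0)).
have h := derD h1 (der_cst (beta^-1 * q `^ (1 + beta)) p).
apply: (is_derive_eq h).
rewrite (_ : 1 + beta - 1 = beta); last by ring.
rewrite -powR_pred//; field.
exact: b0.
Qed.

Lemma cts_div_term_r q p : 0 < q -> 0 < p -> {for p, continuous (div_term q)}.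
Proof. by move=> q0 p0; exact: der_cts (is_derive_div_term q0 p0). Qed.

Lemma cts_div_term_l q p : 0 < q -> 0 < p -> {for q, continuous (div_term^~ p)}.
Proof.
move=> q0 p0; rewrite /div_term; case: eqP => _.
  apply: ctsD; last by apply: ctsB; [exact: cts_cst|exact: cts_id].
  apply: ctsM; first exact: cts_id.
  apply: (@cts_comp _ _ (fun q => q / p) (@ln R)).
    by apply: ctsM; [exact: cts_id|exact: cts_cst].
  by apply: continuous_ln; rewrite divr_gt0.
apply: ctsD.
  apply: ctsB; first exact: cts_cst.
  apply: ctsM; last exact: cts_cst.
  by apply: ctsM; [exact: cts_cst|exact: cts_id].
apply: ctsM; first exact: cts_cst.
exact: der_cts (is_derive1_powR _ q0).
Qed.

Lemma div_term_mvt q p p' : 0 < q -> 0 < p -> p < p' ->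
  exists2 c, p < c < p' & div_term q p' - div_term q p =
    (1 + beta) * c `^ (beta - 1) * (c - q) * (p' - p).
Proof.
move=> q0 p0 pp'.
have H c : p <= c -> is_derive c (1 : R) (div_term q) ((1 + beta) * c `^ (beta - 1) * (c - q)).
  by move=> pc; apply: is_derive_div_term => //; exact: lt_le_trans pc.
have cd : {within `[p, p'], continuous (div_term q)}.
  by apply: derivable_within_continuous => c; rewrite in_itv/= => /andP[pc _]; have [] := H c pc.
have hd c : c \in `]p, p'[ ->
    is_derive c (1 : R) (div_term q) ((1 + beta) * c `^ (beta - 1) * (c - q)).
  by rewrite in_itv/= => /andP[pc _]; apply: H; exact: ltW.
have [c hc ->] := MVT pp' hd cd.
by exists c => //; move: hc; rewrite in_itv.
Qed.

Let slope_gt0 (c : R) : 0 < c -> 0 < (1 + beta) * c `^ (beta - 1).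
Proof. by move=> c0; apply: mulr_gt0; [exact: ltr_wpDr|exact: powR_gt0]. Qed.

Lemma div_term_lt_left q p p' : 0 < p -> p < p' -> p' <= q -> div_term q p' < div_term q p.
Proof.
move=> p0 pp' pq; have q0 : 0 < q by apply: lt_le_trans pq; exact: lt_trans pp'.
have [c /andP[pc cp] e] := div_term_mvt q0 p0 pp'.
rewrite -subr_lt0 e nmulr_rlt0 ?subr_gt0//.
by rewrite (pmulr_rlt0 _ (slope_gt0 (lt_trans p0 pc))) subr_lt0 (lt_le_trans cp).
Qed.

Lemma div_term_lt_right q p p' : 0 < q -> q <= p -> p < p' -> div_term q p < div_term q p'.
Proof.
move=> q0 qp pp'; have p0 : 0 < p := lt_le_trans q0 qp.
have [c /andP[pc cp] e] := div_term_mvt q0 p0 pp'.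
rewrite -subr_gt0 e pmulr_lgt0 ?subr_gt0// pmulr_rgt0 ?subr_gt0 ?(le_lt_trans qp)//.
exact: slope_gt0 (lt_trans p0 pc).
Qed.

Lemma div_term_gt0 q p : 0 < q -> 0 < p -> p != q -> 0 < div_term q p.
Proof.
move=> q0 p0; rewrite neq_lt -(div_term_diag q0) => /orP[pq|qp].
  exact: div_term_lt_left.
exact: div_term_lt_right.
Qed.

Lemma div_term_ge0 q p : 0 < q -> 0 < p -> 0 <= div_term q p.
Proof.
move=> q0 p0; have [->|pq] := eqVneq p q; first by rewrite div_term_diag.
by rewrite ltW// div_term_gt0.
Qed.

(** A probability vector that is at most as far from q as p0 is close to p0 when q is:
    the contribution of a single cell already detects a deviation by e, as it
    increases on both sides of its minimum. *)
Lemma dpd_consistent K (p0 : 'cV[R]_K) (e : R) : (forall s, 0 < p0 s 0) ->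
  \sum_s p0 s 0 = 1 -> 0 < e ->
  \forall q \near p0, \sum_s (q : 'cV[R]_K) s 0 = 1 -> forall p : 'cV[R]_K, (forall s, 0 < p s 0) ->
    \sum_s p s 0 = 1 -> dpd beta q p <= dpd beta q p0 -> forall s, `|p s 0 - p0 s 0| < e.
Proof.
move=> p0_gt0 p0_sum e0.
suff H s : \forall q \near p0, \sum_s (q : 'cV[R]_K) s 0 = 1 -> forall p : 'cV[R]_K, (forall s, 0 < p s 0) ->
    \sum_s p s 0 = 1 -> dpd beta q p <= dpd beta q p0 -> `|p s 0 - p0 s 0| < e.
  apply: filterS (filter_forall _ H) => q h q1 p pg p1 d s.
  exact: h.
pose d := Num.min e (p0 s 0 / 2).
have ps := p0_gt0 s.
have d0 : 0 < d by rewrite lt_min e0 divr_gt0.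
have de : d <= e by rewrite ge_min lexx.
have dp : d < p0 s 0 by rewrite gt_min; apply/orP; right; lra.
have lo0 : 0 < p0 s 0 - d by rewrite subr_gt0.
have hi0 : 0 < p0 s 0 + d by rewrite addr_gt0.
pose m := Num.min (div_term (p0 s 0) (p0 s 0 - d)) (div_term (p0 s 0) (p0 s 0 + d)).
have m0 : 0 < m.
  by rewrite lt_min !div_term_gt0//; [rewrite gt_eqF//; lra|rewrite lt_eqF//; lra].
have m2 : 0 < m / 2 by rewrite divr_gt0.
have mle : m / 2 < m by lra.
have coordc t : {for p0, continuous (fun q : 'cV[R]_K => q t 0)} by exact: coord_continuous.
have near_gt (c : R) : 0 < c -> m <= div_term (p0 s 0) c ->
    \forall q \near p0, m / 2 < div_term ((q : 'cV[R]_K) s 0) c.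
  move=> c0 mc; have := cts_comp (coordc s) (cts_div_term_l ps c0).
  by move=> /(cvgr_gt (div_term (p0 s 0) c)); apply; exact: lt_le_trans mle mc.
have near_pos : \forall q \near p0, forall t, 0 < (q : 'cV[R]_K) t 0.
  apply: (@filter_forall _ _ _ (nbhs p0)) => t.
  by move: (coordc t) => /(cvgr_gt _); apply; exact: p0_gt0.
have near_s : \forall q \near p0, `|(q : 'cV[R]_K) s 0 - p0 s 0| < d.
  have := coordc s; move=> /cvgrPdist_lt /(_ _ d0).
  by apply: filterS => q; rewrite distrC.
have near_sum : \forall q \near p0, \sum_t div_term ((q : 'cV[R]_K) t 0) (p0 t 0) < m / 2.
  have c : {for p0, continuous (fun q : 'cV[R]_K => \sum_t div_term (q t 0) (p0 t 0))}.
    apply: cts_sum => t.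
    exact: (@cts_comp _ _ (fun q : 'cV[R]_K => q t 0) (div_term^~ (p0 t 0)) p0
      (coordc t) (cts_div_term_l (p0_gt0 t) (p0_gt0 t))).
  move: c => /(cvgr_lt _); apply.
  by rewrite big1// => t _; rewrite div_term_diag.
near=> q => q1 p pg p1 hd.
have qpos : forall t, 0 < q t 0 by near: q.
have qs : `|q s 0 - p0 s 0| < d by near: q.
move: qs; rewrite ltr_distl => /andP[qlo qhi].
rewrite !dpd_div_term ?q1// in hd.
have {}hd : div_term (q s 0) (p s 0) < m / 2.
  apply: le_lt_trans (_ : \sum_t div_term (q t 0) (p0 t 0) < m / 2); last by near: q.
  apply: le_trans hd; rewrite [leRHS](bigD1 s)//= lerDl sumr_ge0// => t _.
  exact: div_term_ge0.
rewrite ltNge; apply/negP => far.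
have {}far := le_trans de far.
have m_lo : m / 2 < div_term (q s 0) (p0 s 0 - d).
  by near: q; apply: near_gt => //; rewrite ge_min lexx.
have m_hi : m / 2 < div_term (q s 0) (p0 s 0 + d).
  by near: q; apply: near_gt => //; rewrite ge_min lexx orbT.
have [pp|pp] := leP (p s 0) (p0 s 0).
  rewrite ler0_norm ?subr_le0// in far.
  have : p s 0 <= p0 s 0 - d by lra.
  rewrite le_eqVlt => /predU1P[e1|lt1]; first by rewrite e1 in hd; lra.
  have := div_term_lt_left (pg s) lt1 (ltW qlo); lra.
rewrite gtr0_norm ?subr_gt0// in far.
have : p0 s 0 + d <= p s 0 by lra.
rewrite le_eqVlt => /predU1P[e1|lt1]; first by rewrite -e1 in hd; lra.
have := div_term_lt_right (qpos s) (ltW qhi) lt1; lra.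
Unshelve. all: by end_near. Qed.

End divergence.

(** * Linearisation of the estimator *)

Section sum_norm.
Variable R : realType.

(* Unlike the maximum norm, this norm is submultiplicative. *)
Definition sum_norm m n (A : 'M[R]_(m, n)) := \sum_i \sum_j `|A i j|.

Lemma sum_norm_ge0 m n (A : 'M[R]_(m, n)) : 0 <= sum_norm A.
Proof. by apply: sumr_ge0 => i _; exact: sumr_ge0. Qed.

Lemma sum_norm0 m n : sum_norm (0 : 'M[R]_(m, n)) = 0.
Proof. by apply: big1 => i _; apply: big1 => j _; rewrite mxE normr0. Qed.

Lemma sum_normD m n (A B : 'M[R]_(m, n)) : sum_norm (A + B) <= sum_norm A + sum_norm B.
Proof.
rewrite -big_split/=; apply: ler_sum => i _; rewrite -big_split/=; apply: ler_sum => j _.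
by rewrite mxE ler_normD.
Qed.

Lemma sum_norm_opp m n (A : 'M[R]_(m, n)) : sum_norm (- A) = sum_norm A.
Proof. by apply: eq_bigr => i _; apply: eq_bigr => j _; rewrite mxE normrN. Qed.

Lemma sum_normB m n (A B : 'M[R]_(m, n)) : sum_norm (A - B) <= sum_norm A + sum_norm B.
Proof.
by apply: le_trans (sum_normD _ _) _; rewrite sum_norm_opp.
Qed.

Lemma sum_norm_tr m n (A : 'M[R]_(m, n)) : sum_norm A^T = sum_norm A.
Proof. by rewrite /sum_norm exchange_big; apply: eq_bigr => i _; apply: eq_bigr => j _; rewrite mxE. Qed.

Lemma le_sum_norm m n (A : 'M[R]_(m, n)) i j : `|A i j| <= sum_norm A.
Proof.
rewrite /sum_norm (bigD1 i)//= (bigD1 j)//= -addrA lerDl addr_ge0//; first exact: sumr_ge0.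
by apply: sumr_ge0 => k _; exact: sumr_ge0.
Qed.

Lemma sum_normM m n k (A : 'M[R]_(m, n)) (B : 'M[R]_(n, k)) :
  sum_norm (A *m B) <= sum_norm A * sum_norm B.
Proof.
rewrite /sum_norm mulr_suml; apply: ler_sum => i _.
apply: le_trans (_ : \sum_j \sum_l `|A i l| * `|B l j| <= _).
  apply: ler_sum => j _; rewrite mxE; apply: le_trans (ler_norm_sum _ _ _) _.
  by apply: ler_sum => l _; rewrite normrM.
rewrite exchange_big mulr_suml; apply: ler_sum => l _; rewrite -mulr_sumr ler_wpM2l//.
rewrite [leRHS](bigD1 l)//= lerDl; apply: sumr_ge0 => i' _; exact: sumr_ge0.
Qed.

Lemma cts_sum_norm (T : topologicalType) m n (F : T -> 'M[R]_(m, n)) (x : T) (e : R) :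
  (forall i j, {for x, continuous (fun y => F y i j)}) -> 0 < e ->
  \forall y \near x, sum_norm (F y - F x) < e.
Proof.
move=> cF e0.
have c : {for x, continuous (fun y => sum_norm (F y - F x))}.
  apply: cts_sum => i; apply: cts_sum => j.
  rewrite (_ : (fun y => _) = fun y => `|F y i j - F x i j|); last first.
    by apply/funext => y; rewrite !mxE.
  apply: (@cts_comp _ _ (fun y => F y i j - F x i j) Num.norm); last exact: norm_continuous.
  by apply: ctsB; [exact: cF|exact: cts_cst].
by move: c => /(cvgr_lt _); apply; rewrite subrr sum_norm0.
Qed.

End sum_norm.

Lemma near_coordP (R : realType) m n (A : 'M[R]_(m, n)) (Q : set 'M[R]_(m, n)) :
  (\forall B \near A, Q B) -> exists2 e : R, 0 < e &
    forall B : 'M[R]_(m, n), (forall i j, `|B i j - A i j| < e) -> Q B.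
Proof.
move=> /nbhs_ballP[e /= e0 h]; exists e => // B hB; apply: h.
by split=> // i j; rewrite -ball_normE /ball_/= distrC.
Qed.

(* One Newton step from the solution of a perturbed linear equation. *)
Lemma newton_step (R : realType) n m (U S : 'M[R]_(n, m)) (W : 'M[R]_(m, n)) (h : 'cV[R]_n)
    (x y : 'cV[R]_m) : U *m W \in unitmx -> S *m (x - y) = 0 ->
  h - invmx (U *m W) *m U *m y =
    invmx (U *m W) *m (U *m (W *m h - x) + (U - S) *m (x - y)).
Proof.
move=> Ju Sxy; rewrite [(U - S) *m _]mulmxBl Sxy subr0 -mulmxDr addrA subrK.
by rewrite mulmxBr mulmxBr !mulmxA -(mulmxA (invmx _) U W) mulVmx// mul1mx.
Qed.

Section estimator.
Variables (R : realType) (L r : nat) (D : stepStressTest R L) (beta : R).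
Hypothesis r_gt0 : (0 < r)%N.
Hypothesis beta_ge0 : 0 <= beta.
Implicit Types (a b v : 'rV[R]_(r * 2)) (q : 'cV[R]_(L * r + 1)).
Local Notation p := (cell_prob D).

(* Deciding by conversion whether two parameters have the same probabilities would unfold
   the whole model. *)
#[local] Opaque cell_prob W_mx.

Definition score_mx a := (W_mx D a)^T *m pow_diag D a (beta - 1).

Lemma score_mxE a t s : score_mx a t s = W_mx D a s t * p a s 0 `^ (beta - 1).
Proof. by rewrite /score_mx /pow_diag mul_mx_diag !mxE. Qed.

Lemma cts_score a t s : {for a, continuous (fun a => score_mx a t s)}.
Proof.
rewrite (funext (fun a => score_mxE a t s)).
apply: ctsM; first exact: cts_W.
apply: (@cts_comp _ _ (fun a => p a s 0) (fun x => x `^ (beta - 1))); first exact: cts_cell.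
have h := is_derive1_powR (beta - 1) (cell_prob_gt0 D r_gt0 a s).
exact: der_cts h.
Qed.

(** v J v^T is a sum of squares of the entries of W v^T with positive weights. *)
Lemma J_unit a : J_mx D a beta \in unitmx.
Proof.
rewrite -row_free_unit -kermx_eq0; apply/rowV0P => v /sub_kermxP vJ.
apply: (W_inj r_gt0 (D := D) (a := a)).
set y := W_mx D a *m v^T.
have q0 : \sum_s p a s 0 `^ (beta - 1) * (y s 0) ^+ 2 = 0.
  have : (v *m J_mx D a beta *m v^T) 0 0 = 0 by rewrite vJ mul0mx mxE.
  have -> : v *m J_mx D a beta *m v^T = y^T *m pow_diag D a (beta - 1) *m y.
    by rewrite /y /J_mx trmx_mul trmxK !mulmxA.
  rewrite /pow_diag mul_mx_diag mxE => h; rewrite -[RHS]h; apply: eq_bigr => s _.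
  by rewrite !mxE expr2; ring.
apply/colP => s; rewrite [RHS]mxE; apply/eqP; rewrite -sqrf_eq0.
have h s' : 0 <= p a s' 0 `^ (beta - 1) * (y s' 0) ^+ 2.
  by rewrite mulr_ge0 ?powR_ge0 ?sqr_ge0.
have /(_ s isT)/eqP := psumr_eq0P (fun s _ => h s) q0.
by rewrite mulf_eq0 gt_eqF//= powR_gt0// cell_prob_gt0.
Qed.

Lemma near_cell_pos a : \forall q \near p a, forall s, 0 < (q : 'cV[R]_(L * r + 1)) s 0.
Proof.
apply: (@filter_forall _ _ _ (nbhs (p a))) => s.
have : {for p a, continuous (fun q : 'cV[R]_(L * r + 1) => q s 0)} by exact: coord_continuous.
by move=> /(cvgr_gt _); apply; exact: cell_prob_gt0.
Qed.

Lemma par_consistent a0 (e : R) : 0 < e ->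
  \forall q \near p a0, \sum_s (q : 'cV[R]_(L * r + 1)) s 0 = 1 ->
    forall a, dpd beta q (p a) <= dpd beta q (p a0) -> forall t, `|a 0 t - a0 0 t| < e.
Proof.
move=> e0.
have : \forall q \near p a0, forall (k : 'I_r) (c : 'I_2), `|par_of D q k c - vec_mx a0 k c| < e.
  apply: (@filter_forall _ _ _ (nbhs (p a0))) => k; apply: (@filter_forall _ _ _ (nbhs (p a0))) => c.
  have /cvgrPdist_lt /(_ _ e0) := @cts_par_of _ _ _ D r_gt0 a0 k c.
  by apply: filterS => q /=; rewrite par_ofE// distrC.
move=> /near_coordP[d d0 hd].
have p0s := cell_prob_gt0 D r_gt0 a0.
have := dpd_consistent beta_ge0 p0s (cell_prob_sum D r_gt0 a0) d0.
apply: filterS => q hq q1 a la t; case/mxvec_indexP: t => k b.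
have := hd (p a); rewrite -!vec_mxE -(par_ofE D r_gt0); apply => s j; rewrite (ord1 j).
exact: (hq q1 (p a) (cell_prob_gt0 D r_gt0 a) (cell_prob_sum D r_gt0 a) la s).
Qed.

Lemma dpd_cells a q : \sum_s q s 0 = 1 -> dpd beta q (p a) = \sum_s div_term beta (q s 0) (p a s 0).
Proof. by move=> q1; rewrite dpd_div_term// q1 cell_prob_sum. Qed.

(** The competitors of a0 lie in a compact cube around a0, where the minimum is attained. *)
Lemma near_argmin a0 : \forall q \near p a0, \sum_s (q : 'cV[R]_(L * r + 1)) s 0 = 1 ->
  exists a, is_argmin_dpd D beta q a.
Proof.
near=> q => q1.
have q0 : forall s, 0 < q s 0 by near: q; exact: near_cell_pos.
have near_a0 : forall a, dpd beta q (p a) <= dpd beta q (p a0) -> forall t, `|a 0 t - a0 0 t| < 1.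
  by move: (q1); near: q; exact: par_consistent.
pose A := [set a : 'rV[R]_(r * 2) | forall t, `[a0 0 t - 1, a0 0 t + 1]%classic (a ord0 t)].
have A_a0 : A a0 by move=> t /=; rewrite in_itv/=; lra.
have cA : compact A.
  apply: (@rV_compact R _ (fun t => `[a0 0 t - 1, a0 0 t + 1]%classic)) => t.
  exact: segment_compact.
have cd : {within A, continuous (fun a => dpd beta q (p a))}.
  apply: continuous_subspaceT => a.
  rewrite (funext (fun a => dpd_cells a q1)).
  apply: cts_sum => s.
  apply: (@cts_comp _ _ (fun a => p a s 0) (div_term beta (q s 0))); first exact: cts_cell.
  by apply: cts_div_term_r => //; exact: cell_prob_gt0.
have [c _ hc] := EVT_min_rV (ex_intro _ a0 A_a0) cA cd.
have {}hc b : A b -> dpd beta q (p c) <= dpd beta q (p b) by move=> /mem_set /hc.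
exists c => b.
have /orP[ba|ab] := le_total (dpd beta q (p b)) (dpd beta q (p a0)).
  apply: (hc b) => t /=; rewrite in_itv/=.
  by have := near_a0 b ba t; rewrite ltr_distl => /andP[? ?]; rewrite !ltW.
exact: le_trans (hc a0 A_a0) ab.
Unshelve. all: by end_near. Qed.

(** The divergence is stationary at a minimizer; its derivative in the direction of a
    coordinate is a multiple of that coordinate of the left-hand side. *)
Lemma argmin_score q a : (forall s, 0 < q s 0) -> \sum_s q s 0 = 1 ->
  is_argmin_dpd D beta q a -> score_mx a *m (p a - q) = 0.
Proof.
move=> q0 q1 amin; apply/colP => t; rewrite [RHS]mxE.
pose v : 'rV[R]_(r * 2) := delta_mx 0 t.
pose f u := \sum_s div_term beta (q s 0) (p (a + u *: v) s 0).
have fE u : f u = dpd beta q (p (a + u *: v)) by exact/esym/dpd_cells.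
have df (u : R) : is_derive u (1 : R) f (\sum_s
    (1 + beta) * p (a + u *: v) s 0 `^ (beta - 1) * (p (a + u *: v) s 0 - q s 0)
      * (W_mx D (a + u *: v) *m v^T) s 0).
  apply: der_sum => s.
  apply: (@der_comp _ (fun u => p (a + u *: v) s 0) (div_term beta (q s 0))).
    exact: (is_derive_cell D r_gt0 a v s u).
  by apply: is_derive_div_term => //; exact: cell_prob_gt0.
have d0 : is_derive (0 : R) (1 : R) f 0.
  apply: (@derive1_at_min _ f (-1) 1).
  - by lra.
  - by move=> u _; have [] := df u.
  - by rewrite in_itv/=; lra.
  - by move=> u _; rewrite !fE scale0r addr0; exact: amin.
have := derive_val (is_derive := d0); rewrite (derive_val (is_derive := df 0)) scale0r addr0 => h.
have b1 : 1 + beta != 0 by rewrite gt_eqF// ltr_wpDr.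
apply: (mulfI b1); rewrite mulr0 -h mxE mulr_sumr; apply: eq_bigr => s _.
by rewrite score_mxE /v trmx_delta -colE !mxE; ring.
Qed.

(* The intermediate point depends on the cell s. *)
Lemma cell_mvt a0 a s : exists2 c : R, 0 < c < 1 &
  p a s 0 - p a0 s 0 = (W_mx D (a0 + c *: (a - a0)) *m (a - a0)^T) s 0.
Proof.
have H (c : R) := is_derive_cell D r_gt0 a0 (a - a0) s c.
have cd : {within `[0, 1], continuous (fun c => p (a0 + c *: (a - a0)) s 0)}.
  by apply: derivable_within_continuous => c _; have [] := H c.
have [c hc e] := MVT (@ltr01 R) (fun c _ => H c) cd.
exists c; first by move: hc; rewrite in_itv.
by rewrite scale1r scale0r addr0 [a0 + (a - a0)]addrC subrK subr0 mulr1 in e; rewrite e.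
Qed.

Definition influence_mx a := invmx (J_mx D a beta) *m score_mx a.

(** Stationarity of the divergence at a minimizer a and J = score W give
    J (a - a0 - M (q - p0)) = score (W (a - a0) - (p a - p0)) + (score - score a) (p a - q),
    where M is the influence matrix and everything is evaluated at a0 unless indicated;
    both terms are small with respect to a - a0 and q - p0. *)
Lemma argmin_linear a0 (e : R) : 0 < e ->
  \forall q \near p a0, \sum_s (q : 'cV[R]_(L * r + 1)) s 0 = 1 ->
    (exists a, is_argmin_dpd D beta q a) /\
    forall a, is_argmin_dpd D beta q a ->
      sum_norm ((a - a0)^T - influence_mx a0 *m (q - p a0)) <= e * sum_norm (q - p a0).
Proof.
move=> e0.
pose W0 := W_mx D a0; pose U0 := score_mx a0; pose Ji := invmx (J_mx D a0 beta).
pose M := influence_mx a0; pose k : R := (L * r + 1)%:R.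
pose C := sum_norm Ji * (sum_norm U0 * k + sum_norm W0 + k) + sum_norm Ji + 1.
pose C2 := 2 * sum_norm M + 2.
have k0 : 0 <= k by exact: ler0n.
have J0 := sum_norm_ge0 Ji; have N0 := sum_norm_ge0 U0; have V0 := sum_norm_ge0 W0.
have M0 := sum_norm_ge0 M.
have C0 : 0 < C by rewrite /C ltr_wpDl// addr_ge0// mulr_ge0// addr_ge0// addr_ge0// mulr_ge0.
have C20 : 0 < C2 by rewrite /C2; lra.
pose eta := Num.min 1 (Num.min (1 / (2 * C)) (e / (C * C2))).
have eta0 : 0 < eta by rewrite !lt_min ltr01 !divr_gt0// mulr_gt0.
have eta1 : eta <= 1 by rewrite ge_min lexx.
have etaC : eta * C <= 1 / 2.
  have : eta <= 1 / (2 * C) by rewrite /eta !ge_min lexx !orbT.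
  rewrite ler_pdivlMr ?mulr_gt0// => h; lra.
have etae : eta * C * C2 <= e.
  have : eta <= e / (C * C2) by rewrite /eta !ge_min lexx !orbT.
  by rewrite ler_pdivlMr ?mulr_gt0// mulrA.
have : \forall a \near a0, sum_norm (W_mx D a - W0) < eta /\ sum_norm (score_mx a - U0) < eta.
  apply: filterI.
    by apply: (@cts_sum_norm _ _ _ _ (W_mx D) a0 eta) => // i j; exact: cts_W.
  by apply: (@cts_sum_norm _ _ _ _ score_mx a0 eta) => // i j; exact: cts_score.
move=> /near_coordP[d d0 hd].
near=> q => q1; split; first by move: q1; near: q; exact: near_argmin.
move=> a amin.
have q0 : forall s, 0 < q s 0 by near: q; exact: near_cell_pos.
have ad : forall t, `|a 0 t - a0 0 t| < d.
  have h : forall a, dpd beta q (p a) <= dpd beta q (p a0) -> forall t, `|a 0 t - a0 0 t| < d.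
    by move: (q1); near: q; exact: par_consistent.
  exact: h.
set Dq := q - p a0; set h := (a - a0)^T; set dp := p a - p a0.
have dp_lin : sum_norm (dp - W0 *m h) <= k * eta * sum_norm h.
  rewrite /sum_norm -/(sum_norm h); under eq_bigr do rewrite big_ord1.
  apply: le_trans (_ : \sum_(s < L * r + 1) eta * sum_norm h <= _); last first.
    by rewrite sumr_const card_ord -mulr_natl mulrA.
  apply: ler_sum => s _; have [c /andP[c0 c1] ec] := cell_mvt a0 a s.
  have -> : (dp - W0 *m h) s 0 = ((W_mx D (a0 + c *: (a - a0)) - W0) *m h) s 0.
    have edp : dp s 0 = (W_mx D (a0 + c *: (a - a0)) *m h) s 0.
      by rewrite -ec /dp mxE [X in _ + X = _]mxE.
    by rewrite mulmxBl [LHS]mxE [RHS]mxE edp.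
  apply: le_trans (le_sum_norm _ _ _) _; apply: le_trans (sum_normM _ _) _.
  rewrite ler_wpM2r ?sum_norm_ge0// ltW//.
  suff [] : sum_norm (W_mx D (a0 + c *: (a - a0)) - W0) < eta
    /\ sum_norm (score_mx (a0 + c *: (a - a0)) - U0) < eta by [].
  apply: hd => i j; rewrite (ord1 i) !mxE addrAC subrr add0r normrM.
  by apply: le_lt_trans (ad j); rewrite gtr0_norm// ler_piMl// ltW.
have U_near : sum_norm (U0 - score_mx a) <= eta.
  rewrite -(sum_norm_opp) opprB ltW//.
  suff [] : sum_norm (W_mx D a - W0) < eta /\ sum_norm (score_mx a - U0) < eta by [].
  by apply: hd => i j; rewrite (ord1 i); exact: ad.
have foc : score_mx a *m (dp - Dq) = 0.
  by rewrite /dp /Dq opprB addrA subrK; exact: argmin_score.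
have e1 : h - M *m Dq = Ji *m (U0 *m (W0 *m h - dp) + (U0 - score_mx a) *m (dp - Dq)).
  by apply: newton_step foc => //; exact: J_unit.
have dp_le : sum_norm dp <= (sum_norm W0 + k) * sum_norm h.
  have -> : dp = W0 *m h + (dp - W0 *m h) by rewrite addrC subrK.
  apply: le_trans (sum_normD _ _) _; rewrite mulrDl lerD ?sum_normM//.
  apply: le_trans dp_lin _; rewrite ler_wpM2r ?sum_norm_ge0// ler_piMr//.
have h0 := sum_norm_ge0 h; have D0 := sum_norm_ge0 Dq.
have main : sum_norm (h - M *m Dq) <= eta * C * (sum_norm h + sum_norm Dq).
  rewrite e1; apply: le_trans (sum_normM _ _) _.
  have b1 : sum_norm (U0 *m (W0 *m h - dp)) <= sum_norm U0 * (k * eta * sum_norm h).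
    apply: le_trans (sum_normM _ _) _; rewrite ler_wpM2l//.
    by rewrite -(sum_norm_opp) opprB.
  have b2 : sum_norm ((U0 - score_mx a) *m (dp - Dq)) <=
      eta * ((sum_norm W0 + k) * sum_norm h + sum_norm Dq).
    apply: le_trans (sum_normM _ _) _; apply: ler_pM => //; try exact: sum_norm_ge0.
    by apply: le_trans (sum_normB _ _) _; rewrite lerD2r.
  apply: le_trans (_ : sum_norm Ji * (sum_norm U0 * (k * eta * sum_norm h) +
    eta * ((sum_norm W0 + k) * sum_norm h + sum_norm Dq)) <= _).
    by rewrite ler_wpM2l//; apply: le_trans (sum_normD _ _) _; exact: lerD.
  rewrite -subr_ge0 /C.
  have -> : forall j n w k eta h d : R, eta * (j * (n * k + w + k) + j + 1) * (h + d) -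
    j * (n * (k * eta * h) + eta * ((w + k) * h + d)) =
    eta * (j * (n * k + w + k) * d + j * h + (h + d)) by move=> *; ring.
  by rewrite !(mulr_ge0, addr_ge0)// ltW.
have h_le : sum_norm h <= sum_norm M * sum_norm Dq + sum_norm (h - M *m Dq).
  have -> : sum_norm h = sum_norm (M *m Dq + (h - M *m Dq)) by rewrite addrC subrK.
  by apply: le_trans (sum_normD _ _) _; rewrite lerD2r sum_normM.
have half : eta * C * (sum_norm h + sum_norm Dq) <= 1 / 2 * (sum_norm h + sum_norm Dq).
  by rewrite ler_wpM2r// addr_ge0.
have h2 := le_trans main half.
apply: le_trans main _.
apply: le_trans (_ : eta * C * (C2 * sum_norm Dq) <= _).
  apply: ler_wpM2l; first by rewrite mulr_ge0// ltW.
  have -> : C2 * sum_norm Dq = 2 * (sum_norm M * sum_norm Dq) + 2 * sum_norm Dq.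
    by rewrite /C2; ring.
  by lra.
by rewrite mulrA ler_wpM2r.
Unshelve. all: by end_near. Qed.

End estimator.

(** * Asymptotically linear statistics of multinomial counts *)

Lemma cos_lip (R : realType) (x y : R) : `|cos x - cos y| <= `|x - y|.
Proof.
wlog xy : x y / x < y.
  move=> h; have [xy|xy|->] := ltgtP x y; first exact: h.
    by rewrite distrC [leRHS]distrC; exact: h.
  by rewrite !subrr.
have cd : {within `[x, y], continuous (@cos R)}.
  by apply: continuous_subspaceT; exact: continuous_cos.
have [c _ e] := MVT xy (fun c _ => is_derive_cos c) cd.
rewrite distrC e normrM [leRHS]distrC ler_piMl// normrN.
by rewrite ler_norml sin_geN1 sin_le1.
Qed.

Lemma sqr_sum_le (R : realType) K (x : 'I_K -> R) :
  (\sum_s x s) ^+ 2 <= K%:R * \sum_s x s ^+ 2.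
Proof.
have : 0 <= \sum_s \sum_t (x s - x t) ^+ 2.
  by apply: sumr_ge0 => s _; apply: sumr_ge0 => t _; exact: sqr_ge0.
have -> : \sum_s \sum_t (x s - x t) ^+ 2 = 2 * (K%:R * \sum_s x s ^+ 2 - (\sum_s x s) ^+ 2).
  pose S := \sum_s x s; pose Q := \sum_s x s ^+ 2.
  have inner s : \sum_t (x s - x t) ^+ 2 = K%:R * x s ^+ 2 + - (2 * S) * x s + Q.
    rewrite (eq_bigr (fun t => x s ^+ 2 + - (2 * x s) * x t + x t ^+ 2)); last by move=> t _; ring.
    rewrite !big_split/= sumr_const card_ord -[x s ^+ 2 *+ K]mulr_natl -/Q.
    have -> : \sum_t - (2 * x s) * x t = - (2 * x s) * S by rewrite /S mulr_sumr.
    by ring.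
  rewrite (eq_bigr _ (fun s _ => inner s)) !big_split/= sumr_const card_ord -[Q *+ K]mulr_natl.
  have -> : \sum_s K%:R * x s ^+ 2 = K%:R * Q by rewrite /Q mulr_sumr.
  have -> : \sum_s - (2 * S) * x s = - (2 * S) * S by rewrite -mulr_sumr.
  by rewrite -/S -/Q; ring.
by rewrite pmulr_rge0// subr_ge0.
Qed.

Lemma sum_normZ (R : realType) m n (c : R) (A : 'M[R]_(m, n)) :
  sum_norm (c *: A) = `|c| * sum_norm A.
Proof.
rewrite mulr_sumr; apply: eq_bigr => i _; rewrite mulr_sumr; apply: eq_bigr => j _.
by rewrite mxE normrM.
Qed.

Lemma sqr_sum_norm_le (R : realType) K (x : 'cV[R]_K) :
  sum_norm x ^+ 2 <= K%:R * \sum_s x s 0 ^+ 2.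
Proof.
rewrite /sum_norm; under eq_bigr do rewrite big_ord1.
apply: le_trans (sqr_sum_le _) _; rewrite ler_wpM2l ?ler0n//.
by apply: ler_sum => s _; rewrite real_normK ?num_real.
Qed.

Section linear_statistic.
Variables (R : realType) (k K : nat) (p : 'cV[R]_K) (M : 'M[R]_(k, K)).
Variable g : nat -> 'cV[nat]_K -> 'rV[R]_k.
Hypothesis p_ge0 : forall s, 0 <= p s 0.
Hypothesis p_sum : \sum_s p s 0 = 1.
Hypothesis g_lin : forall e : R, 0 < e -> \forall q \near p, forall N (n : 'cV[nat]_K),
  (0 < N)%N -> (\sum_s n s 0%R)%N = N -> q = empirical R N n ->
  sum_norm ((g N n)^T - M *m (q - p)) <= e * sum_norm (q - p).
Implicit Types (N : nat) (n : 'cV[nat]_K).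

(* Y is the statistic on the scale of the limit law, Z its linear approximation; chi is
   the squared deviation of the frequencies on that scale. *)
Let Y N n : 'rV[R]_k := Num.sqrt N%:R *: g N n.
Let D N n : 'cV[R]_K := empirical R N n - p.
Let Z N n : 'rV[R]_k := Num.sqrt N%:R *: (M *m D N n)^T.
Let dist N n := sum_norm (Y N n - Z N n).
Let chi N n := N%:R * \sum_s D N n s 0 ^+ 2.

Let chi_ge0 N n : 0 <= chi N n.
Proof. by rewrite mulr_ge0// sumr_ge0// => s _; rewrite sqr_ge0. Qed.

(* the score c minus its mean under p *)
Let centred (c : 'I_K -> R) s := c s - \sum_t p t 0 * c t.

Let centred0 c : \sum_s p s 0 * centred c s = 0.
Proof.
rewrite /centred; under eq_bigr do rewrite mulrBr.
by rewrite sumrB -mulr_suml p_sum mul1r subrr.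
Qed.

Let centred_walk c N n : (0 < N)%N -> (\sum_s n s 0%R)%N = N ->
  \sum_s centred c s * (n s 0%R)%:R = N%:R * \sum_s c s * D N n s 0.
Proof.
move=> N0 nN; have N0' : N%:R != 0 :> R by rewrite pnatr_eq0 -lt0n.
transitivity (\sum_s (c s * (n s 0)%:R - N%:R * (p s 0 * c s))).
  rewrite /centred; under eq_bigr do rewrite mulrBl.
  rewrite !sumrB -[X in _ - X = _]mulr_sumr -[X in _ = _ - X]mulr_sumr -natr_sum nN.
  by rewrite [X in _ - X = _]mulrC.
by rewrite mulr_sumr; apply: eq_bigr => s _; rewrite /D !mxE; field.
Qed.

(* The cell s contributes the variance p s (1 - p s), bounded by 1. *)
Let mexp_chi N : (0 < N)%N -> mexp p N (chi N) <= K%:R.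
Proof.
move=> N0; have N0' : 0 < N%:R :> R by rewrite ltr0n.
pose c (s t : 'I_K) : R := (s == t)%:R.
have p1 s : p s 0 <= 1 by rewrite -p_sum (bigD1 s)//= lerDl sumr_ge0.
have cE s : centred (c s) = fun t => (s == t)%:R - p s 0.
  apply/funext => t; rewrite /centred (bigD1 s)//= {2}/c eqxx mulr1 big1 ?addr0// => u /negbTE us.
  by rewrite /c eq_sym us mulr0.
have chiE n : (\sum_s n s 0%R)%N = N ->
    chi N n = N%:R^-1 * \sum_s (\sum_t centred (c s) t * (n t 0%R)%:R) ^+ 2.
  move=> nN; rewrite /chi !mulr_sumr; apply: eq_bigr => s _.
  rewrite (centred_walk _ N0 nN) (bigD1 s)//= /c eqxx mul1r big1 ?addr0.
    by field; rewrite gt_eqF.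
  by move=> t /negbTE; rewrite eq_sym => ->; rewrite mul0r.
rewrite (eq_mexp p chiE) mexpZ mexp_sum//.
rewrite ler_pdivrMl// (_ : N%:R * K%:R = \sum_(s < K) N%:R); last first.
  by rewrite sumr_const card_ord mulr_natr.
apply: ler_sum => s _.
rewrite (mexp_walk_sqr p_sum (centred0 (c s))).
rewrite ler_piMr//.
rewrite -[leRHS]p_sum; apply: ler_sum => t _; rewrite ler_piMr// cE.
have pt0 := p_ge0 s; have pt1 := p1 s.
case: (s == t) => /=; nra.
Qed.

Let mexp_dist N h1 h2 h3 :
  (forall n, (\sum_s n s 0%R)%N = N -> `|h1 n - h2 n| <= h3 n) ->
  `|mexp p N h1 - mexp p N h2| <= mexp p N h3.
Proof.
move=> H; rewrite ler_distl lerBlDr -!mexpD.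
by apply/andP; split; apply: le_mexp => // n /H; rewrite ler_distl lerBlDr => /andP[].
Qed.

(* The squared distance is truncated because nothing is known about Y when the
   frequencies are far from p. *)
Let rem N n := Num.min 1 (dist N n ^+ 2).

Let dist_ge0 N n : 0 <= dist N n.
Proof. exact: sum_norm_ge0. Qed.

Let rem_ge0 N n : 0 <= rem N n.
Proof. by rewrite le_min ler01 sqr_ge0. Qed.

(** Chebyshev's inequality: the linear approximation applies unless some frequency
    deviates from its probability by a fixed amount. *)
Lemma mexp_rem (eta : R) : 0 < eta -> \forall N \near \oo, mexp p N (rem N) <= eta.
Proof.
move=> eta0.
pose C : R := K%:R * K%:R + 1.
have C0 : 0 < C by rewrite ltr_wpDl// mulr_ge0// ler0n.
pose e := Num.sqrt (eta / (2 * C)).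
have e2 : e ^+ 2 = eta / (2 * C) by rewrite sqr_sqrtr// ltW// divr_gt0// mulr_gt0.
have e0 : 0 < e by rewrite sqrtr_gt0 divr_gt0// mulr_gt0.
have /near_coordP[d d0 hd] := g_lin e0.
have d2 : 0 < d ^+ 2 by rewrite exprn_gt0.
near=> N.
have N0 : (0 < N)%N by near: N; exact: nbhs_infty_gt.
have N0' : 0 < N%:R :> R by rewrite ltr0n.
pose A := e ^+ 2 * K%:R + (N%:R * d ^+ 2)^-1.
have A0 : 0 <= A.
  by apply: addr_ge0; [rewrite mulr_ge0 ?sqr_ge0 ?ler0n|rewrite invr_ge0 mulr_ge0 ?ler0n// ltW].
have H n : (\sum_s n s 0%R)%N = N -> rem N n <= A * chi N n.
  move=> nN; have [far|near] := pselect (exists s, d <= `|D N n s 0|).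
    have [s hs] := far; rewrite ge_min; apply/orP; left.
    apply: (@le_trans _ _ ((N%:R * d ^+ 2)^-1 * chi N n)); last first.
      by rewrite ler_wpM2r// /A lerDr mulr_ge0 ?sqr_ge0 ?ler0n.
    rewrite ler_pdivlMl ?mulr_gt0// mulr1 /chi ler_pM2l//.
    apply: (@le_trans _ _ (D N n s 0 ^+ 2)).
      by rewrite -[leRHS]real_normK ?num_real// ler_sqr ?nnegrE// ltW.
    by rewrite (bigD1 s)//= lerDl sumr_ge0// => t _; exact: sqr_ge0.
  have lin : sum_norm ((g N n)^T - M *m D N n) <= e * sum_norm (D N n).
    apply: hd N0 nN erefl => s j; rewrite (ord1 j) ltNge; apply/negP => h.
    by apply: near; exists s; rewrite !mxE in h *.
  rewrite ge_min; apply/orP; right.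
  have -> : dist N n = Num.sqrt N%:R * sum_norm ((g N n)^T - M *m D N n).
    rewrite /dist /Y /Z -scalerBr sum_normZ ger0_norm ?sqrtr_ge0//; congr (_ * _).
    by rewrite -[LHS]sum_norm_tr linearB/= trmxK.
  apply: (@le_trans _ _ (e ^+ 2 * K%:R * chi N n)); last first.
    by rewrite ler_wpM2r// lerDl invr_ge0 mulr_ge0 ?ler0n// ltW.
  rewrite exprMn sqr_sqrtr ?ler0n// /chi [leRHS]mulrCA ler_pM2l// -mulrA.
  apply: le_trans (_ : (e * sum_norm (D N n)) ^+ 2 <= _).
    by rewrite ler_sqr ?nnegrE ?sum_norm_ge0// mulr_ge0 ?sum_norm_ge0// ltW.
  by rewrite exprMn ler_wpM2l ?sqr_ge0//; exact: sqr_sum_norm_le.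
apply: le_trans (le_mexp p_ge0 H) _; rewrite mexpZ.
apply: le_trans (ler_wpM2l A0 (mexp_chi N0)) _; rewrite /A mulrDl.
have h1 : e ^+ 2 * K%:R * K%:R <= eta / 2.
  rewrite e2 (_ : _ * _ * _ = eta / 2 * (K%:R * K%:R / C)); last by field; rewrite gt_eqF.
  apply: ler_piMr; first by rewrite divr_ge0// ltW.
  by rewrite ler_pdivrMr// mul1r /C lerDl.
have h2 : (N%:R * d ^+ 2)^-1 * K%:R <= eta / 2.
  rewrite ler_pdivrMl ?mulr_gt0//.
  have : 2 * K%:R / (d ^+ 2 * eta) <= N%:R by near: N; exact: nbhs_infty_ger.
  rewrite ler_pdivrMr ?mulr_gt0// => h; rewrite -(ler_pM2l (ltr0n R 2)).
  by apply: le_trans h _; rewrite le_eqVlt; apply/orP; left; apply/eqP; field.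
by apply: le_trans (lerD h1 h2) _; rewrite -splitr.
Unshelve. all: by end_near. Qed.

Let score (u : 'cV[R]_k) s := (row s M^T *m u) 0 0.

Let Z_walk u N n : (0 < N)%N -> (\sum_s n s 0%R)%N = N ->
  (Z N n *m u) 0 0 = (\sum_s centred (score u) s * (n s 0%R)%:R) / Num.sqrt N%:R.
Proof.
move=> N0 nN; rewrite (centred_walk _ N0 nN).
have sN : Num.sqrt N%:R != 0 :> R by rewrite gt_eqF// sqrtr_gt0 ltr0n.
rewrite -[in N%:R * _](@sqr_sqrtr _ N%:R) ?ler0n//.
rewrite [RHS](_ : _ = Num.sqrt N%:R * \sum_s score u s * D N n s 0); last by field.
rewrite /Z -scalemxAl mxE; congr (_ * _).
rewrite trmx_mul -mulmxA mxE; apply: eq_bigr => s _.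
by rewrite [X in X * _]mxE mulrC /score -row_mul [in RHS]mxE.
Qed.

Let var u := \sum_s p s 0 * centred (score u) s ^+ 2.

(** By the inequality dist * U <= eta + dist^2 U^2 / (4 eta), replacing Y by Z in the cosine
    costs eta plus a multiple of the mean of rem. *)
Lemma cvg_cos_linear (u : 'cV[R]_k) th :
  mexp p N (fun n => cos ((Y N n *m u) 0 0 + th)) @[N --> \oo]
    --> expR (- (var u / 2)) * cos th.
Proof.
apply/cvgrPdist_le => e e0.
pose U := sum_norm u; pose eta := e / 3; have eta0 : 0 < eta by rewrite divr_gt0.
have U0 : 0 <= U := sum_norm_ge0 u.
pose C := 2 + U ^+ 2 / (4 * eta).
have C0 : 0 < C by rewrite ltr_wpDr// divr_ge0 ?sqr_ge0// mulr_ge0// ltW.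
have := cvg_mexp_cos p_ge0 p_sum (centred0 (score u)) (th := th).
move=> /cvgrPdist_le /(_ _ eta0) lim.
near=> N.
have N0 : (0 < N)%N by near: N; exact: nbhs_infty_gt.
pose EW := mexp p N (fun n => cos ((\sum_s centred (score u) s * (n s 0%R)%:R) / Num.sqrt N%:R + th)).
have h1 : `|expR (- (var u / 2)) * cos th - EW| <= eta by rewrite /EW; near: N; exact: lim.
have h2 : `|EW - mexp p N (fun n => cos ((Y N n *m u) 0 0 + th))| <= eta + C * mexp p N (rem N).
  rewrite -[eta in leRHS](mexp_cst p_sum N) -mexpZ -mexpD; apply: mexp_dist => n nN.
  rewrite -Z_walk// /rem; set a := (Z N n *m u) 0 0; set b := (Y N n *m u) 0 0.
  have ab : `|a - b| <= dist N n * U.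
    have -> : a - b = ((Z N n - Y N n) *m u) 0 0 by rewrite mulmxBl [RHS]mxE [X in _ = _ + X]mxE.
    apply: le_trans (le_sum_norm _ _ _) _; apply: le_trans (sum_normM _ _) _.
    by rewrite -opprB sum_norm_opp.
  have dist0 := dist_ge0 N n.
  have [big|small] := leP 1 (dist N n ^+ 2).
    rewrite mulr1; apply: le_trans (ler_normB _ _) _.
    have := cos_max (a + th); have := cos_max (b + th) => hb ha.
    have : 0 <= U ^+ 2 / (4 * eta) by rewrite divr_ge0 ?sqr_ge0// mulr_ge0// ltW.
    rewrite /C; lra.
  apply: le_trans (cos_lip _ _) _; rewrite (_ : a + th - (b + th) = a - b); last by ring.
  apply: le_trans ab _.
  apply: (@le_trans _ _ (eta + U ^+ 2 / (4 * eta) * dist N n ^+ 2)); last first.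
    by rewrite lerD2l ler_wpM2r ?sqr_ge0// /C lerDr.
  rewrite -subr_ge0 (_ : _ - _ = (2 * eta - dist N n * U) ^+ 2 / (4 * eta)).
    by rewrite divr_ge0 ?sqr_ge0// mulr_ge0// ltW.
  by field; rewrite gt_eqF.
have h3 : C * mexp p N (rem N) <= eta.
  rewrite -ler_pdivlMl// mulrC; near: N; apply: mexp_rem; exact: divr_gt0.
rewrite (_ : _ - _ = (expR (- (var u / 2)) * cos th - EW) +
  (EW - mexp p N (fun n => cos ((Y N n *m u) 0 0 + th)))); last by ring.
apply: le_trans (ler_normD _ _) _; rewrite /eta in h1 h2 h3 *; lra.
Unshelve. all: by end_near. Qed.

(** Z has bounded second moments, and Y differs from it by a distance controlled by rem. *)
Lemma tight_linear (e : R) : 0 < e -> exists2 B1, 0 < B1 & forall B, B1 <= B ->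
  \forall N \near \oo, mexp p N (fun n => tail B (Y N n)) <= e.
Proof.
move=> e0; pose m := sum_norm M; have m0 : 0 <= m := sum_norm_ge0 M.
pose A : R := k%:R * (2 * m ^+ 2 * K%:R).
have A0 : 0 <= A by rewrite !mulr_ge0 ?ler0n ?sqr_ge0.
have AK0 : 0 <= A * K%:R by rewrite mulr_ge0 ?ler0n.
exists (2 * (A * K%:R) / e + 1) => [|B hB]; first by rewrite ltr_wpDl// divr_ge0 ?mulr_ge0// ltW.
have B1 : 1 <= B by apply: le_trans hB; rewrite lerDr divr_ge0 ?mulr_ge0// ltW.
have B0 : 0 < B := lt_le_trans ltr01 B1.
have B2 : 0 < B ^+ 2 by rewrite exprn_gt0.
pose eta := e / (4 * (k%:R + 1)).
have k1 : 0 < k%:R + 1 :> R by rewrite ltr_wpDl.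
have eta0 : 0 < eta by rewrite divr_gt0// mulr_gt0.
near=> N.
have N0 : (0 < N)%N by near: N; exact: nbhs_infty_gt.
have H n : (\sum_s n s 0%R)%N = N -> tail B (Y N n) <= A / B ^+ 2 * chi N n + (2 * k%:R) * rem N n.
  move=> _.
  have Hi i : Num.min 1 ((Y N n 0 i / B) ^+ 2) <= 2 * m ^+ 2 * K%:R / B ^+ 2 * chi N n + 2 * rem N n.
    have a0 : 0 <= 2 * m ^+ 2 * K%:R / B ^+ 2 * chi N n.
      by rewrite mulr_ge0// divr_ge0 ?sqr_ge0// !mulr_ge0 ?ler0n ?sqr_ge0.
    have := rem_ge0 N n; rewrite /rem; have [big|small] := leP 1 (dist N n ^+ 2) => r0.
      rewrite ge_min; apply/orP; left; lra.
    rewrite ge_min; apply/orP; right.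
    have zi : Z N n 0 i ^+ 2 <= m ^+ 2 * K%:R * chi N n.
      have : `|Z N n 0 i| <= Num.sqrt N%:R * (m * sum_norm (D N n)).
        rewrite mxE normrM ger0_norm ?sqrtr_ge0// ler_wpM2l ?sqrtr_ge0// mxE.
        exact: le_trans (le_sum_norm _ _ _) (sum_normM _ _).
      rewrite -ler_sqr ?nnegrE ?mulr_ge0 ?sqrtr_ge0 ?sum_norm_ge0//.
      rewrite real_normK ?num_real// exprMn sqr_sqrtr ?ler0n// exprMn => h.
      apply: le_trans h _; rewrite /chi [leRHS]mulrCA ler_wpM2l ?ler0n// -(mulrA _ K%:R).
      by rewrite ler_wpM2l ?sqr_ge0//; exact: sqr_sum_norm_le.
    have yi : (Y N n 0 i - Z N n 0 i) ^+ 2 <= dist N n ^+ 2.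
      rewrite -[leLHS]real_normK ?num_real// ler_sqr ?nnegrE//.
      have := le_sum_norm (Y N n - Z N n) 0 i.
      by rewrite [(Y N n - Z N n) 0 i]mxE [(- Z N n) 0 i]mxE.
    rewrite expr_div_n ler_pdivrMr// mulrDl mulrAC -[2 * m ^+ 2 * K%:R / B ^+ 2 * B ^+ 2]mulrA.
    rewrite mulVf ?gt_eqF// mulr1.
    have : dist N n ^+ 2 <= dist N n ^+ 2 * B ^+ 2.
      by rewrite ler_peMr ?sqr_ge0// exprn_ege1.
    have := sqr_ge0 (Y N n 0 i - 2 * Z N n 0 i).
    nra.
  apply: le_trans (ler_sum _ (fun i _ => Hi i)) _.
  rewrite sumr_const card_ord -mulr_natl le_eqVlt; apply/orP; left; apply/eqP.
  by rewrite /A; ring.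
apply: le_trans (le_mexp p_ge0 H) _; rewrite mexpD mexpZ [X in _ + X]mexpZ.
have h1 : A / B ^+ 2 * mexp p N (chi N) <= e / 2.
  apply: le_trans (ler_wpM2l _ (mexp_chi N0)) _; first by rewrite divr_ge0 ?sqr_ge0.
  rewrite mulrAC ler_pdivrMr//.
  have : 2 * (A * K%:R) <= e * B.
    rewrite mulrC [leRHS]mulrC -ler_pdivrMr// [_ * 2]mulrC; apply: le_trans hB; by rewrite lerDl.
  have : e * B <= e * B ^+ 2 by rewrite ler_pM2l// expr2 ler_peMr// ltW.
  lra.
have h2 : 2 * k%:R * mexp p N (rem N) <= e / 2.
  apply: le_trans (_ : 2 * k%:R * eta <= _).
    by rewrite ler_wpM2l ?mulr_ge0 ?ler0n//; near: N; exact: mexp_rem.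
  rewrite /eta mulrA ler_pdivrMr ?mulr_gt0//; lra.
by apply: le_trans (lerD h1 h2) _; rewrite -splitr.
Unshelve. all: by end_near. Qed.

(** The images of the centred indicators of the cells, scaled so that a Gaussian vector
    built from independent standard variables along them has the covariance of M. *)
Definition scaled_influence s : 'rV[R]_k := Num.sqrt (p s 0) *: (col s M - M *m p)^T.

Lemma lin_var_influence u : lin_var scaled_influence u = var u.
Proof.
apply: eq_bigr => s _; rewrite /scaled_influence -scalemxAl mxE exprMn sqr_sqrtr//.
congr (_ * _ ^+ 2); rewrite linearB/= mulmxBl [LHS]mxE [X in _ + X]mxE tr_col; congr (_ - _).
rewrite trmx_mul -mulmxA mxE; apply: eq_bigr => t _.
by rewrite mxE /score -row_mul [in RHS]mxE.
Qed.

(** The central limit theorem for a statistic with an asymptotically linear expansion. *)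
Theorem cvg_linear_statistic (G : probability (borel_rV R k) R) :
  gauss_vector_law scaled_influence G -> forall f, bdd_cont f ->
  mexp p N (fun n => f (Num.sqrt N%:R *: g N n)) @[N --> \oo] --> gauss_mean G f.
Proof.
move=> GP; apply: (cvg_mean_of_cos (E := fun N f => mexp p N (fun n => f (Y N n)))).
- move=> N; split.
  + exact: mexp_cst.
  + by move=> f h _ _; exact: mexpD.
  + by move=> c f _; exact: mexpZ.
  + by move=> f h _ _ fh; apply: le_mexp.
- exact: gauss_is_mean.
- move=> u th; rewrite (gauss_mean_cos GP) lin_var_influence; exact: cvg_cos_linear.
- move=> e e0; have [B0 B00 hB0] := gauss_tail GP e0; have [B1 B10 hB1] := tight_linear e0.
  exists (Num.max B0 B1); split; first by rewrite lt_max B00.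
    by apply: hB0; rewrite le_max lexx.
  by apply: hB1; rewrite le_max lexx orbT.
Qed.

End linear_statistic.

(** * The asymptotic law of the estimator *)

Lemma variance_shift (R : realType) K (p x : 'I_K -> R) : \sum_s p s = 1 ->
  \sum_s p s * (x s - \sum_t p t * x t) ^+ 2
    = \sum_s p s * x s ^+ 2 - (\sum_t p t * x t) ^+ 2.
Proof.
move=> p1; set c := \sum_t p t * x t.
rewrite (eq_bigr (fun s => p s * x s ^+ 2 - 2 * c * (p s * x s) + c ^+ 2 * p s));
  last by move=> s _; ring.
rewrite big_split sumrB /= -[X in _ - X + _ = _]mulr_sumr -[X in _ + X = _]mulr_sumr p1 -/c.
by ring.
Qed.

Lemma rank_one_form (R : realType) K (A : 'M[R]_K) (b z : 'cV[R]_K) :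
  z^T *m (A - b *m b^T) *m z = z^T *m (A *m z) - (z^T *m b) *m (z^T *m b)^T.
Proof. by rewrite mulmxBr mulmxBl trmx_mul trmxK !mulmxA. Qed.

Section asymptotics.
Variables (R : realType) (L r : nat) (D : stepStressTest R L) (beta : R).
Hypothesis r_gt0 : (0 < r)%N.
Hypothesis beta_ge0 : 0 <= beta.
Variable a0 : 'rV[R]_(r * 2).
Local Notation p := (cell_prob D a0).
Local Notation J := (J_mx D a0 beta).
Local Notation M := (influence_mx D beta a0).

#[local] Opaque cell_prob W_mx.

Lemma J_sym : J^T = J.
Proof. by rewrite /J_mx !trmx_mul trmxK /pow_diag tr_diag_mx mulmxA. Qed.

(** The influence matrix applied to the multinomial covariance diag p - p p^T gives the
    sandwich, as diag p merges with the weights p ^ (beta - 1) in the score. *)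
Lemma sandwich_variance (u : 'cV[R]_(r * 2)) :
  (u^T *m (invmx J *m K_mx D a0 beta *m invmx J) *m u) 0 0 = lin_var (scaled_influence p M) u.
Proof.
have p0 s : 0 < p s 0 by exact: cell_prob_gt0.
have p1 : \sum_s p s 0 = 1 by exact: cell_prob_sum.
pose z := W_mx D a0 *m (invmx J *m u).
have xE s : (row s M^T *m u) 0 0 = p s 0 `^ (beta - 1) * z s 0.
  have -> : M^T = pow_diag D a0 (beta - 1) *m W_mx D a0 *m invmx J.
    by rewrite /influence_mx /score_mx !trmx_mul trmx_inv J_sym trmxK /pow_diag tr_diag_mx.
  rewrite -row_mul mxE -!mulmxA -/z /pow_diag mul_diag_mx mxE; congr (_ * _).
  by rewrite !mxE.
rewrite lin_var_influence; last by move=> s; rewrite ltW.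
pose x s := (row s M^T *m u) 0 0; pose c := \sum_t p t 0 * x t.
transitivity (\sum_s p s 0 * (x s - c) ^+ 2); last by [].
have cE : c = \sum_s p s 0 `^ beta * z s 0.
  by apply: eq_bigr => s _; rewrite /x xE mulrA powR_pred.
rewrite (variance_shift (p := fun s => p s 0) x p1) -/c.
have -> : u^T *m (invmx J *m K_mx D a0 beta *m invmx J) *m u =
    z^T *m (pow_diag D a0 (2 * beta - 1) *m z)
    - (z^T *m pow_vec D a0 beta) *m (z^T *m pow_vec D a0 beta)^T.
  have zT : z^T = u^T *m invmx J *m (W_mx D a0)^T.
    by rewrite /z !trmx_mul trmx_inv J_sym.
  rewrite -rank_one_form.
  by rewrite zT /K_mx /z !mulmxA.
have powE b s : (pow_vec D a0 b)^T 0 s = p s 0 `^ b by rewrite mxE /pow_vec mxE.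
clearbody z; rewrite mxE; congr (_ + _).
  rewrite mxE; apply: eq_bigr => s _; rewrite /x xE /pow_diag mul_diag_mx.
  rewrite [z^T _ _]mxE [(\matrix_(_, _) _) s 0]mxE powE.
  have -> : p s 0 `^ (2 * beta - 1) = p s 0 * (p s 0 `^ (beta - 1) * p s 0 `^ (beta - 1)).
    rewrite mulrA powR_pred// -powRD ?(gt_eqF (p0 s)) ?implybT//.
    by congr (_ `^ _); ring.
  by ring.
rewrite mxE mxE big_ord1 [X in _ * X]mxE -expr2 cE; congr (- _ ^+ 2).
rewrite mxE; apply: eq_bigr => s _.
by rewrite -powE [z^T _ _]mxE [LHS]mulrC [X in _ = X * _]mxE.
Qed.

Lemma influence_normal (G : probability (borel_rV R (r * 2)) R) :
  gauss_vector_law (scaled_influence p M) G ->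
  is_multivariate_normal 0 (invmx J *m K_mx D a0 beta *m invmx J) G.
Proof.
move=> GP u A mA /=; rewrite sandwich_variance mul0mx mxE.
have v0 := lin_var_ge0 (scaled_influence p M) u.
have h := GP u A mA.
case: eqP => [v|/eqP v]; first by rewrite v gauss_law0 in h.
by rewrite gauss_law_gt0 // in h; rewrite lt_neqAle eq_sym v.
Qed.

Variable ahat : nat -> 'cV[nat]_(L * r + 1) -> 'rV[R]_(r * 2).
Hypothesis ahat_MDPDE : is_MDPDE D beta ahat.

(** Near the true probabilities every cell is occupied, so the estimator is constrained
    and its linear approximation holds. *)
Lemma MDPDE_linear (e : R) : 0 < e ->
  \forall q \near p, forall N (n : 'cV[nat]_(L * r + 1)),
    (0 < N)%N -> (\sum_s n s 0%R)%N = N -> q = empirical R N n ->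
    sum_norm ((ahat N n - a0)^T - M *m (q - p)) <= e * sum_norm (q - p).
Proof.
move=> e0.
have := near_cell_pos D r_gt0 a0; have := argmin_linear D r_gt0 beta_ge0 a0 e0.
apply: filterS2 => q hq q0 N n N0 nN qE.
have N0' : 0 < N%:R :> R by rewrite ltr0n.
have q1 : \sum_s q s 0 = 1.
  rewrite qE; under eq_bigr do rewrite mxE.
  by rewrite -mulr_suml -natr_sum nN divff// gt_eqF.
have n0 s : (0 < n s 0%R)%N.
  by have := q0 s; rewrite qE mxE pmulr_lgt0 ?invr_gt0// ltr0n.
have [ex lin] := hq q1; apply: lin; rewrite qE in ex *; apply: ahat_MDPDE => // i j.
case: (ord2P i) => ->.
  by exists (first_int D); split; [exact: stress_first|exact: n0].
by exists (last_int D); split; [exact: stress_last|exact: n0].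
Qed.

End asymptotics.

Theorem mainTheorem1 (R : realType) (L r : nat) (r_gt0 : (0 < r)%N)
    (D : stepStressTest R L) (beta : R) (beta_ge0 : 0 <= beta)
    (a0 : 'rV[R]_(r * 2))
    (d : nat -> measure_display) (T : forall N, measurableType (d N))
    (P : forall N, probability (T N) R)
    (X : forall N, T N -> 'cV[nat]_(L * r + 1))
    (X_law : forall N, has_multinomial_law (P N) N (cell_prob D a0) (X N))
    (ahat : nat -> 'cV[nat]_(L * r + 1) -> 'rV[R]_(r * 2))
    (ahat_MDPDE : is_MDPDE D beta ahat) :
  let J := J_mx D a0 beta in
  let K := K_mx D a0 beta in
  J \in unitmx /\
  exists G : probability (borel_rV R (r * 2)) R,
    is_multivariate_normal 0 (invmx J *m K *m invmx J) G /\
    cvg_in_distribution P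
      (fun N w => Num.sqrt N%:R *: (ahat N (X N w) - a0)) G.
Proof.
move=> J K; split; first exact: J_unit.
have [G GP] := gauss_vector_exists (scaled_influence (cell_prob D a0) (influence_mx D beta a0)).
exists G; split; first exact: influence_normal.
move=> f cf bf.
have p_ge0 s : 0 <= cell_prob D a0 s 0 by rewrite ltW// cell_prob_gt0.
have p_sum := cell_prob_sum D r_gt0 a0.
have lim := cvg_linear_statistic p_ge0 p_sum (MDPDE_linear r_gt0 beta_ge0 a0 ahat_MDPDE) GP (conj cf bf).
have -> : (\int[G]_x (f x)%:E)%E = (gauss_mean G f)%:E.
  by rewrite fineK//; exact: (integrable_fin_num measurableT (integrable_bdd_cont G (conj cf bf))).
have eqE N := integral_counts p_sum (X_law N) (fun n => f (Num.sqrt N%:R *: (ahat N n - a0))).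
rewrite (funext eqE); apply: cvg_EFin lim; exact: nearW.
Qed.
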